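(* Let $\Lambda$ be a non-empty set and let $\{A_\lambda:X_\lambda\to Y_\lambda:\lambda\in\Lambda\}$ be a uniformly bounded collection of Asplund operators between Banach spaces. Fix $p\in\{0\}\cup(1,\infty)$ and suppose that at least one of the operators $A_\lambda$, $\lambda\in\Lambda$, is non-compact. Let $D^p:(\oplus_{\lambda\in\Lambda}X_\lambda)_{\ell_p(\Lambda)}\to(\oplus_{\lambda\in\Lambda}Y_\lambda)_{\ell_p(\Lambda)}$ be the diagonal operator such that $D^p|_{X_\lambda}=A_\lambda$, where if $p=0$ the $\ell_p(\Lambda)$ direct sum is replaced by the $c_0(\Lambda)$ direct sum. Then $Sz(D^p)=\sup_{\lambda\in\Lambda}Sz(A_\lambda)$ if and only if for every $\varepsilon>0$, $\sup_{\lambda\in\Lambda}Sz(A_\lambda,\varepsilon)<\sup_{\lambda\in\Lambda}Sz(A_\lambda)$; and otherwise $Sz(D^p)=\bigl(\sup_{\lambda\in\Lambda}Sz(A_\lambda)\bigr)\omega$.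
   Context: Operators are bounded and linear; $B_X$ is the closed unit ball of $X$. For a weak$^*$-compact $K\subset X^*$ and $\varepsilon>0$, $s_\varepsilon(K)$ is the set of $x^*\in K$ such that $\mathrm{diam}(V\cap K)>\varepsilon$ (norm diameter) for every weak$^*$-neighborhood $V$ of $x^*$; $s^0_\varepsilon(K)=K$, $s^{\xi+1}_\varepsilon(K)=s_\varepsilon(s^\xi_\varepsilon(K))$, $s^\xi_\varepsilon(K)=\bigcap_{\zeta<\xi}s^\zeta_\varepsilon(K)$ for limit $\xi$. $Sz(K,\varepsilon)$ is the least ordinal $\xi$ with $s^\xi_\varepsilon(K)=\varnothing$ ($\infty$ if none exists), and $Sz(K)=\sup_{\varepsilon>0}Sz(K,\varepsilon)$. For an operator $A:X\to Y$, $Sz(A,\varepsilon)=Sz(A^*B_{Y^*},\varepsilon)$ and $Sz(A)=Sz(A^*B_{Y^*})$. An operator $A$ is Asplund if $Sz(A)<\infty$, i.e. $Sz(A)$ is an ordinal (this is equivalent to the usual definition). Each $X_\lambda$ is identified with the corresponding coordinate subspace of the direct sum. *)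

(* Defs.v *)
From HB Require Import structures.
From mathcomp Require Import all_boot all_order all_algebra.
From mathcomp Require Import all_classical all_reals all_analysis.
From mathcomp Require Import complex ring lra.

Set Implicit Arguments.
Unset Strict Implicit.
Unset Printing Implicit Defensive.

Import Order.TTheory GRing.Theory Num.Theory.
Import numFieldNormedType.Exports.

Local Open Scope classical_set_scope.
Local Open Scope ring_scope.

(** * Ordinals *)

(* [osup f] is the supremum of the [f i], with no monotonicity or limit
   condition on [f].  Distinct terms may denote the same ordinal, so equality
   of ordinals is the equivalence of the preorder [ole].
   The index types include the carriers of the spaces, whose universe is above
   that of [set]; hence [set ord] is a universe inconsistency, and predicates
   on ordinals are written [ord -> Prop]. *)
Inductive ord : Type :=
| ozero : ord
| osucc : ord -> ord
| osup : forall I : Type, (I -> ord) -> ord.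

Fixpoint ole (a : ord) : ord -> Prop :=
  match a with
  | ozero => fun _ => True
  | osucc a' => fix lt (b : ord) : Prop :=
      match b with
      | ozero => False
      | osucc b' => ole a' b'
      | osup J g => exists i, lt (g i)
      end
  | osup J f => fun b => forall i, ole (f i) b
  end.

Definition olt (a b : ord) : Prop := ole (osucc a) b.

(* The extra index [None] only matters when [J] is empty. *)
Fixpoint oadd (a b : ord) : ord :=
  match b with
  | ozero => a
  | osucc b' => osucc (oadd a b')
  | osup J f => osup (fun i => if i is Some j then oadd a (f j) else a)
  end.

Fixpoint omul (a b : ord) : ord :=
  match b with
  | ozero => ozero
  | osucc b' => oadd (omul a b') a
  | osup J f => osup (fun i => omul a (f i))
  end.

Definition oomega : ord := osup (fun n : nat => iter n osucc ozero).

Lemma ole_sup (I : Type) (g : I -> ord) i a : ole a (g i) -> ole a (osup g).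
Proof. by elim: a => //= [a _|J f IH] h; [exists i | move=> j; exact: IH]. Qed.

Lemma ole_succ a b : ole a b -> ole a (osucc b).
Proof.
elim: a b => //= [a IH|J f IH] b.
  elim: b => //= [b _|I g IHg [i /IHg h]]; first exact: IH.
  exact: (@ole_sup _ _ i).
by move=> h j; apply: IH.
Qed.

Lemma ole_refl a : ole a a.
Proof. by elim: a => //= I f IH i; apply: (@ole_sup _ _ i). Qed.

Lemma ole_trans b a c : ole a b -> ole b c -> ole a c.
Proof.
elim: a b c => [//|a IH|J f IH] b c; last by move=> h k j; exact: IH (h j) k.
elim: b c => [//|b _|I g IHg] c; last by move=> [i h] k; exact: IHg h (k i).
move=> ab; elim: c => //= [c _ bc|I g IHg [i /IHg]]; first exact: IH ab bc.
by exists i.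
Qed.

Lemma ole_total a b : ole a b \/ olt b a.
Proof.
elim: a b => [|a IH|J f IH] b; first by left.
- elim: b => [|b _|J g IHg].
  + by right.
  + by case: (IH b) => h; [left|right].
  + have [[i h]|/forallNP h] := pselect (exists i, olt a (g i)).
      by left; exact: (@ole_sup _ _ i).
    by right; rewrite /olt /= => i; have [/h|] := IHg i.
- have [h|/existsNP[j h]] := pselect (forall j, ole (f j) b); first by left.
  by right; exists j; case: (IH j b).
Qed.

Lemma olt_wf : well_founded olt.
Proof.
suff H a b : ole b a -> Acc olt b by move=> a; exact: (H a a (ole_refl a)).
elim: a b => [|a IH|I f IH] b ba; constructor => c cb.
- by have := ole_trans cb ba.
- exact/IH/(ole_trans cb ba).
- have [i ci] : exists i, olt c (f i) := ole_trans cb ba.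
  exact: IH i c (ole_trans (ole_succ (ole_refl c)) ci).
Qed.

Lemma oleast_ex (P : ord -> Prop) :
  (exists a, P a) -> exists a, P a /\ forall b, P b -> ole a b.
Proof.
move=> [a]; elim/(well_founded_ind olt_wf): a => a IH Pa.
have [[b Pb ba]|h] := pselect (exists2 b, P b & olt b a); first exact: IH ba Pb.
exists a; split=> // b Pb; have [//|ba] := ole_total a b.
by exfalso; apply: h; exists b.
Qed.

(* Ordinals together with the top element oo, represented by [None]. *)
Definition eord : Type := option ord.

Definition eole (a b : eord) : Prop :=
  match a, b with
  | _, None => True
  | None, Some _ => False
  | Some a, Some b => ole a b
  end.

Definition eolt (a b : eord) : Prop :=
  match a, b with
  | None, _ => False
  | Some _, None => True
  | Some a, Some b => olt a b
  end.

Definition eoeq (a b : eord) : Prop := eole a b /\ eole b a.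

Definition eosup (I : Type) (f : I -> eord) : eord :=
  if pselect (exists i, f i = None) then None
  else Some (osup (fun i => odflt ozero (f i))).

Definition eomul (a : eord) (b : ord) : eord := omap (omul^~ b) a.

(* The least ordinal satisfying [P], or oo if there is none. *)
Definition oleast (P : ord -> Prop) : eord :=
  match pselect (exists a, P a) with
  | left h => Some (sval (cid (oleast_ex h)))
  | right _ => None
  end.

(** * Scalars *)

Inductive scalar_kind := real_scalars | complex_scalars.

Definition scalars (R : realType) (k : scalar_kind) : numFieldType :=
  match k with
  | real_scalars => R
  | complex_scalars => R[i]
  end.

(* In the library the norm of a space over K takes its values in K; for complex
   K it is brought back to R by taking real parts. *)
Definition toR (R : realType) (k : scalar_kind) : scalars R k -> R :=
  match k with
  | real_scalars => id
  | complex_scalars => @complex.Re R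
  end.

Definition ofR (R : realType) (k : scalar_kind) : R -> scalars R k :=
  match k with
  | real_scalars => id
  | complex_scalars => fun x => (x%:C)%C
  end.

Definition rnorm (R : realType) (k : scalar_kind)
  (V : normedModType (scalars R k)) (x : V) : R := toR `|x|.

Section scalar_lemmas.
Variables (R : realType) (k : scalar_kind).
Implicit Types (V : normedModType (scalars R k)).

Lemma ofRK : cancel (@ofR R k) (@toR R k).
Proof. by case: k. Qed.

Lemma toRK (a : scalars R k) : 0 <= a -> ofR k (toR a) = a.
Proof. by case: k a => //= -[a b]; rewrite lecE /= => /andP[/eqP -> _]. Qed.

Lemma toRD : {morph @toR R k : x y / x + y}.
Proof. by case: k => //= -[a b] [c d]. Qed.

Lemma toR_le (a b : scalars R k) : a <= b -> toR a <= toR b.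
Proof. by case: k a b => //= -[a b] [c d]; rewrite lecE /= => /andP[]. Qed.

Lemma toRM (a b : scalars R k) : 0 <= a -> toR (a * b) = toR a * toR b.
Proof.
by case: k a b => //= -[a b] [c d]; rewrite lecE /= => /andP[/eqP -> _];
  rewrite mul0r subr0.
Qed.

Lemma ofR_le (a b : R) : a <= b -> ofR k a <= ofR k b.
Proof. by case: k => //= h; rewrite lecR. Qed.

Lemma ofRD : {morph @ofR R k : x y / x + y}.
Proof. by case: k => //; exact: (rmorphD (real_complex R)). Qed.

Lemma ofRM : {morph @ofR R k : x y / x * y}.
Proof. by case: k => //; exact: (rmorphM (real_complex R)). Qed.

Lemma ofR0 : ofR k (0 : R) = 0.
Proof. by case: k. Qed.

Lemma rnorm_ge0 V (x : V) : 0 <= rnorm x.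
Proof.
have -> : (0 : R) = toR (0 : scalars R k) by case: k.
exact/toR_le/normr_ge0.
Qed.

Lemma rnormD V (x y : V) : rnorm (x + y) <= rnorm x + rnorm y.
Proof. by rewrite /rnorm -toRD; apply/toR_le/ler_normD. Qed.

Lemma rnormZ V (a : scalars R k) (x : V) : rnorm (a *: x) = toR `|a| * rnorm x.
Proof. by rewrite /rnorm normrZ toRM. Qed.

Lemma rnorm0 V : rnorm (0 : V) = 0.
Proof. by rewrite /rnorm normr0; case: k. Qed.

Lemma rnorm_eq0 V (x : V) : rnorm x = 0 -> x = 0.
Proof.
by move=> h; apply/normr0_eq0; rewrite -(toRK (normr_ge0 x)) -/(rnorm x) h ofR0.
Qed.

End scalar_lemmas.

(** * Operators and the Szlenk index *)

Record bop (K : numFieldType) (X Y : normedModType K) := Bop {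
  bop_fun :> {linear X -> Y};
  bop_continuous : continuous bop_fun }.

Definition dual (K : numFieldType) (X : normedModType K) : Type := bop X K^o.

HB.instance Definition _ (K : numFieldType) (X : normedModType K) :=
  gen_eqMixin (dual X).
HB.instance Definition _ (K : numFieldType) (X : normedModType K) :=
  gen_choiceMixin (dual X).

Definition weak_star (K : numFieldType) (X : normedModType K) : Type :=
  initial_topology (fun f : dual X => (f : X -> K^o) : {ptws X -> K^o}).

HB.instance Definition _ (K : numFieldType) (X : normedModType K) :=
  Topological.on (weak_star X).

Lemma adjoint_continuous (K : numFieldType) (X Y : normedModType K)
  (A : bop X Y) (g : dual Y) : continuous (g \o A).
Proof.
by move=> x; apply: continuous_comp; [exact: bop_continuous|exact: bop_continuous].
Qed.

Definition adjoint (K : numFieldType) (X Y : normedModType K)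
  (A : bop X Y) (g : dual Y) : dual X := Bop (@adjoint_continuous K X Y A g).

Section szlenk.
Variables (R : realType) (k : scalar_kind).
Local Notation K := (scalars R k).
Implicit Types (X Y : normedModType K).

Definition unit_ball X : set X := [set x | rnorm x <= 1].
Arguments unit_ball : clear implicits.

Definition dual_norm X (f : X -> K) : \bar R :=
  ereal_sup [set (toR `|f x|)%:E | x in unit_ball X].

Definition dual_ball X : set (dual X) := [set f | (dual_norm f <= 1)%E].
Arguments dual_ball : clear implicits.

Definition diam X (S : set (dual X)) : \bar R :=
  ereal_sup [set d | exists f g, [/\ S f, S g & d = dual_norm (fun x => f x - g x)]].

Definition szlenk_derivative X (e : R) (S : set (dual X)) : set (dual X) :=
  [set f | S f /\ forall V : set (dual X),
    nbhs (f : weak_star X) V -> (e%:E < diam (V `&` S))%E].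

(* For a limit ordinal [osup f] the derivatives s^(f i) are cofinal in the
   intersection over all smaller ordinals; [S] itself only matters when the
   index type is empty.  [szlenk_iter_anti] shows that the result depends only
   on the ordinal denoted by [a]. *)
Fixpoint szlenk_iter X (e : R) (S : set (dual X)) (a : ord) : set (dual X) :=
  match a with
  | ozero => S
  | osucc b => szlenk_derivative e (szlenk_iter e S b)
  | osup J f => [set x | S x /\ forall j, szlenk_iter e S (f j) x]
  end.

Lemma szlenk_derivative_sub X e (S T : set (dual X)) :
  S `<=` T -> szlenk_derivative e S `<=` szlenk_derivative e T.
Proof.
move=> ST f [Sf h]; split=> [|V /h]; first exact: ST.
move/lt_le_trans; apply; apply: le_ereal_sup => _ [g [g' [[Vg Sg] [Vg' Sg'] ->]]].
by exists g, g'; split=> //; split=> //; exact: ST.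
Qed.

Lemma szlenk_iter_sub X e (S : set (dual X)) a : szlenk_iter e S a `<=` S.
Proof. by elim: a => //= [a IH f [/IH]|J f _ x []]. Qed.

Lemma szlenk_iter_anti X e (S : set (dual X)) a b :
  ole a b -> szlenk_iter e S b `<=` szlenk_iter e S a.
Proof.
elim: a b => [b _|a IH b|J f IH b ab x Sx].
- exact: szlenk_iter_sub.
- elim: b => //= [b _ ab|J g IHg [i /IHg h] x [_ /(_ i)]]; last exact: h.
  exact/szlenk_derivative_sub/IH.
- split=> [|j]; first exact: szlenk_iter_sub Sx.
  exact: IH (ab j) _ Sx.
Qed.

Definition Sz_set_eps X (S : set (dual X)) (e : R) : eord :=
  oleast (fun a => szlenk_iter e S a = set0).

Definition Sz_set X (S : set (dual X)) : eord :=
  eosup (fun e : {posnum R} => Sz_set_eps S e%:num).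

Definition Sz_eps X Y (A : bop X Y) (e : R) : eord :=
  Sz_set_eps (adjoint A @` dual_ball Y) e.

Definition Sz X Y (A : bop X Y) : eord := Sz_set (adjoint A @` dual_ball Y).

Definition asplund X Y (A : bop X Y) : Prop := Sz A <> None.

Definition compact_operator X Y (A : bop X Y) : Prop :=
  precompact (A @` unit_ball X).

End szlenk.

(** * Direct sums *)

Section direct_sum.
Variables (R : realType) (k : scalar_kind) (L : choiceType).
Variables (p : R) (hp : p = 0 \/ 1 < p).
Local Notation K := (scalars R k).
Variable X : L -> normedModType K.
Implicit Types x y : forall l, X l.

Definition psum x : \bar R := \esum_(l in [set: L]) (rnorm (x l) `^ p)%:E.

(* The exponent p = 0 stands for the c_0 direct sum. *)
Definition dsum_mem x : Prop :=
  if p == 0 then forall e : R, 0 < e -> finite_set [set l | e <= rnorm (x l)]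
  else (psum x < +oo)%E.

Definition dsum_norm x : R :=
  if p == 0 then sup [set rnorm (x l) | l in [set: L]]
  else fine (psum x) `^ p^-1.

(* For [t >= 0] and [x] in the direct sum: the norm of [x] is at most [t]. *)
Definition dsum_bound x (t : R) : Prop :=
  if p == 0 then forall l, rnorm (x l) <= t else (psum x <= (t `^ p)%:E)%E.

Lemma psum_ge0 x : (0 <= psum x)%E.
Proof. by apply: esum_ge0 => l _; rewrite lee_fin powR_ge0. Qed.

Lemma p_gt1 : p != 0 -> 1 < p.
Proof. by case: hp => [->|//]; rewrite eqxx. Qed.

Lemma psum_le x c : (psum x <= c%:E)%E <->
  forall A : set L, finite_set A -> \sum_(l \in A) (rnorm (x l) `^ p) <= c.
Proof.
split=> [h A fA|h].
  rewrite -lee_fin -fsumEFin//; apply: le_trans h.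
  by apply: esum_ge; exists A.
apply: ge_ereal_sup => _ [A [fA _] <-].
by rewrite fsumEFin// lee_fin; exact: h.
Qed.

Lemma dsum_bound_norm x : dsum_mem x -> dsum_bound x (dsum_norm x).
Proof.
rewrite /dsum_mem /dsum_bound /dsum_norm; case: eqVneq => [p0|p0] mx.
  move=> l; apply: ub_le_sup; last by exists l.
  have /finite_seqP[s sE] := mx 1 ltr01.
  exists (\big[Num.max/1]_(m <- s) rnorm (x m)) => _ [m _ <-].
  have [h|h] := leP 1 (rnorm (x m)).
    have ms : m \in s by have : [set` s] m by rewrite -sE.
    exact: (le_bigmax_seq 1 m predT (fun m => rnorm (x m)) ms).
  by apply: le_trans (ltW h) _; exact: bigmax_ge_id.
have fx : psum x \is a fin_num by rewrite ge0_fin_numE ?psum_ge0.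
by rewrite -powRrM mulVf// powRr1 ?fine_ge0 ?psum_ge0// fineK.
Qed.

Lemma dsum_norm_le x t : 0 <= t -> dsum_bound x t -> dsum_norm x <= t.
Proof.
rewrite /dsum_bound /dsum_norm => t0; case: eqVneq => [p0|p0] bx.
  have [->|/set0P ne] := eqVneq [set rnorm (x l) | l in [set: L]] set0.
    by rewrite sup0.
  by apply: ge_sup => // _ [l _ <-].
have p1 := p_gt1 p0; have p_ge0 : 0 <= p by apply: le_trans (ltW p1).
have fx : psum x \is a fin_num.
  by rewrite ge0_fin_numE ?psum_ge0// (le_lt_trans bx)// ltry.
rewrite -[leRHS](powRr1 t0) -(mulfV p0) powRrM ge0_ler_powR ?invr_ge0//.
- by rewrite nnegrE fine_ge0 ?psum_ge0.
- by rewrite nnegrE powR_ge0.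
- by rewrite -lee_fin fineK.
Qed.

Lemma dsum_norm_ge0 x : dsum_mem x -> 0 <= dsum_norm x.
Proof.
move/dsum_bound_norm; rewrite /dsum_bound /dsum_norm; case: eqVneq => [_|_] bx.
  have [->|/set0P[_ [l _ _]]] := eqVneq [set rnorm (x l) | l in [set: L]] set0.
    by rewrite sup0.
  exact: le_trans (rnorm_ge0 (x l)) (bx l).
exact: powR_ge0.
Qed.

Lemma dsum_boundD x y s t : 0 < s -> 0 < t -> dsum_bound x s ->
  dsum_bound y t -> dsum_bound (fun l => x l + y l) (s + t).
Proof.
rewrite /dsum_bound => s0 t0; case: eqVneq => [_|p0] bx b_y.
  by move=> l; apply: le_trans (rnormD _ _) _; rewrite lerD.
have p1 := p_gt1 p0; have p_ge0 : 0 <= p by apply: le_trans (ltW p1).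
have st0 : 0 < s + t by rewrite addr_gt0.
have w_ge0 : 0 <= s / (s + t) by rewrite divr_ge0 ?(ltW s0) ?(ltW st0).
have w_le1 : s / (s + t) <= 1 by rewrite ler_pdivrMr// mul1r lerDl ltW.
have hw : 1 - s / (s + t) = t / (s + t).
  by rewrite -{1}(divff (lt0r_neq0 st0)) -mulrBl addrAC subrr add0r.
pose c r := (s + t) `^ p * (r / (s + t)) * (r `^ p)^-1.
have key l : rnorm (x l + y l) `^ p <=
    c s * rnorm (x l) `^ p + c t * rnorm (y l) `^ p.
  have dom r v : 0 < r -> 0 <= v ->
    v / r \in (`[0, +oo[%classic : set R).
    by move=> r0 v0; rewrite inE/= in_itv/= andbT divr_ge0// ltW.
  have pdiv r v : 0 < r -> 0 <= v -> (v / r) `^ p = v `^ p * (r `^ p)^-1.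
    move=> r0 v0; apply: (mulIf (lt0r_neq0 (powR_gt0 p r0))).
    rewrite -powRM ?divr_ge0 ?(ltW r0)// divfK ?gt_eqF// mulfVK//.
    by rewrite gt_eqF// powR_gt0.
  have := convex_powR (ltW p1) (Itv01 w_ge0 w_le1)
    (dom _ _ s0 (rnorm_ge0 (x l))) (dom _ _ t0 (rnorm_ge0 (y l))).
  rewrite [leRHS]convRE [X in X `^ p <= _ -> _]convRE /= /unstable.onem hw.
  set u := rnorm (x l); set v := rnorm (y l).
  have -> : s / (s + t) * (u / s) + t / (s + t) * (v / t) = (u + v) / (s + t).
    by field; rewrite !gt_eqF.
  have u0 : 0 <= u by exact: rnorm_ge0.
  have v0 : 0 <= v by exact: rnorm_ge0.
  rewrite !pdiv ?addr_ge0// ler_pdivrMr ?powR_gt0// => h.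
  have : rnorm (x l + y l) `^ p <= (u + v) `^ p.
    by rewrite ge0_ler_powR ?nnegrE ?addr_ge0 ?rnorm_ge0// rnormD.
  move=> /le_trans; apply; apply: le_trans h _.
  by rewrite le_eqVlt; apply/orP; left; apply/eqP; rewrite /c; ring.
apply/psum_le => A fA.
have /psum_le/(_ A fA) hx := bx; have /psum_le/(_ A fA) hy := b_y.
have c_ge0 r : 0 < r -> 0 <= c r.
  by move=> r0; rewrite /c !mulr_ge0 ?invr_ge0 ?powR_ge0// ltW.
have -> : (s + t) `^ p = c s * s `^ p + c t * t `^ p.
  rewrite /c !mulfVK ?gt_eqF ?powR_gt0// -mulrDr -mulrDl divff ?mulr1//.
  by rewrite gt_eqF.
apply: (@le_trans _ _ (\sum_(l \in A)
    (c s * rnorm (x l) `^ p + c t * rnorm (y l) `^ p))).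
  by rewrite !fsbig_finite//=; apply: ler_sum => l _; exact: key.
rewrite fsbig_split//= -!mulr_fsumr.
by rewrite lerD// ler_wpM2l ?c_ge0.
Qed.

Lemma dsum_boundZ x (a : K) t : 0 <= t -> dsum_bound x t ->
  dsum_bound (fun l => a *: x l) (toR `|a| * t).
Proof.
have a0 : 0 <= toR `|a| by exact: (rnorm_ge0 (a : K^o)).
rewrite /dsum_bound => t0; case: eqVneq => [_|p0] bx.
  by move=> l; rewrite rnormZ ler_wpM2l.
apply/psum_le => A fA; have /psum_le/(_ A fA) hx := bx.
under eq_fsbigr => l _ do rewrite rnormZ powRM ?rnorm_ge0//.
by rewrite -mulr_fsumr powRM// ler_wpM2l ?powR_ge0.
Qed.

Lemma dsum_bound_mem x t : p != 0 -> dsum_bound x t -> dsum_mem x.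
Proof.
by rewrite /dsum_bound /dsum_mem => /negbTE -> /le_lt_trans; apply; exact: ltry.
Qed.

Lemma dsum_bound_norm1 x : dsum_mem x -> 0 < dsum_norm x + 1.
Proof. by move=> mx; rewrite ltr_wpDl// dsum_norm_ge0. Qed.

Lemma dsum_bound_weak x s t : 0 <= s -> s <= t -> dsum_bound x s -> dsum_bound x t.
Proof.
rewrite /dsum_bound => s0 st; case: eqVneq => [_ h l|p0].
  exact: le_trans (h l) st.
have p_ge0 : 0 <= p by apply: le_trans (ltW (p_gt1 p0)).
move=> /le_trans; apply; rewrite lee_fin ge0_ler_powR ?nnegrE//.
exact: le_trans st.
Qed.

Lemma dsum_memD x y :
  dsum_mem x -> dsum_mem y -> dsum_mem (fun l => x l + y l).
Proof.
move=> mx my; have [p0|p0] := eqVneq p 0.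
  move: mx my; rewrite /dsum_mem p0 eqxx => mx my e e0.
  have e20 : 0 < e / 2 by rewrite divr_gt0.
  have fU : finite_set ([set l | e / 2 <= rnorm (x l)] `|`
                        [set l | e / 2 <= rnorm (y l)]).
    by rewrite finite_setU; split; [exact: mx|exact: my].
  apply: sub_finite_set fU => l /= h.
  have := le_trans h (rnormD (x l) (y l)).
  by have [|hx] := leP (e / 2) (rnorm (x l)); [left|right; lra].
apply: (dsum_bound_mem p0).
apply: (dsum_boundD (dsum_bound_norm1 mx) (dsum_bound_norm1 my)).
- by apply: dsum_bound_weak (dsum_bound_norm mx); rewrite ?dsum_norm_ge0// lerDl.
- by apply: dsum_bound_weak (dsum_bound_norm my); rewrite ?dsum_norm_ge0// lerDl.
Qed.

Lemma dsum_memZ (a : K) x : dsum_mem x -> dsum_mem (fun l => a *: x l).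
Proof.
move=> mx; have [p0|p0] := eqVneq p 0; last first.
  exact: dsum_bound_mem p0 (dsum_boundZ a (dsum_norm_ge0 mx) (dsum_bound_norm mx)).
move: mx; rewrite /dsum_mem p0 eqxx => mx e e0.
have a0 : 0 <= toR `|a| by exact: (rnorm_ge0 (a : K^o)).
have d0 : 0 < toR `|a| + 1 by rewrite ltr_wpDl.
apply: sub_finite_set (mx (e / (toR `|a| + 1)) (divr_gt0 e0 d0)) => l /=.
rewrite rnormZ ler_pdivrMr// => /le_trans; apply.
by rewrite mulrC ler_wpM2l ?rnorm_ge0// lerDl.
Qed.

(* [v] in position [l] and 0 elsewhere. *)
Definition single l (v : X l) : forall m, X m := @dfwith L X (fun _ => 0) l v.

Lemma dsum_mem_single l (v : X l) : dsum_mem (single v).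
Proof.
rewrite /dsum_mem; case: eqVneq => [p0 e e0|p0].
  apply: (@sub_finite_set _ _ [set l]) => // m /=; have [<-//|ne] := eqVneq l m.
  by rewrite /single dfwithout// rnorm0 leNgt e0.
apply: (@le_lt_trans _ _ (rnorm v `^ p)%:E); last exact: ltry.
rewrite /psum [leLHS](_ : _ =
    (\esum_(m in [set l]) (rnorm (single v m) `^ p)%:E)%E).
  by rewrite esum_set1 /single ?dfwithin// lee_fin powR_ge0.
rewrite [RHS]esum_mkcond; apply: eq_esum => m _.
case: ifPn => // /negP nin; rewrite /single dfwithout ?rnorm0 ?powR0//.
by apply/eqP => lm; apply: nin; rewrite -lm; exact: mem_set.
Qed.

Lemma dsum_mem0 : dsum_mem (fun _ => 0).
Proof.
rewrite /dsum_mem; case: eqVneq => [p0 e e0|p0].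
  rewrite [X in finite_set X](_ : _ = set0)//.
  by apply/seteqP; split=> // l /=; rewrite rnorm0 leNgt e0.
by rewrite /psum esum1 ?ltry// => l _; rewrite rnorm0 powR0.
Qed.

Lemma dsum_norm_leD x y s t : 0 <= s -> 0 <= t -> dsum_bound x s ->
  dsum_bound y t -> dsum_norm (fun l => x l + y l) <= s + t.
Proof.
move=> s0 t0 bx b_y; apply/ler_addgt0Pr => e e0.
have e20 : 0 < e / 2 by rewrite divr_gt0.
rewrite (splitr e) addrACA; apply: dsum_norm_le.
  by rewrite !addr_ge0// ltW.
apply: dsum_boundD; rewrite ?ltr_wpDl//.
- by apply: dsum_bound_weak bx => //; rewrite lerDl ltW.
- by apply: dsum_bound_weak b_y => //; rewrite lerDl ltW.
Qed.

Lemma dsum_normD x y : dsum_mem x -> dsum_mem y ->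
  dsum_norm (fun l => x l + y l) <= dsum_norm x + dsum_norm y.
Proof.
move=> mx my; exact: dsum_norm_leD (dsum_norm_ge0 mx) (dsum_norm_ge0 my)
  (dsum_bound_norm mx) (dsum_bound_norm my).
Qed.

Lemma dsum_normZ (a : K) x : dsum_mem x ->
  dsum_norm (fun l => a *: x l) = toR `|a| * dsum_norm x.
Proof.
have le b z : dsum_mem z -> dsum_norm (fun l => b *: z l) <= toR `|b| * dsum_norm z.
  move=> mz; have b0 : 0 <= toR `|b| by exact: (rnorm_ge0 (b : K^o)).
  apply: dsum_norm_le; first by rewrite mulr_ge0// dsum_norm_ge0.
  exact/dsum_boundZ/dsum_bound_norm/mz/dsum_norm_ge0.
move=> mx; apply/eqP; rewrite eq_le le//=.
have [->|a0] := eqVneq a 0.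
  have -> : toR `|0 : K| = 0 by exact: (rnorm0 K^o).
  by rewrite mul0r dsum_norm_ge0//; apply: dsum_memZ.
have := le a^-1 _ (dsum_memZ a mx).
have -> : (fun l => a^-1 *: (a *: x l)) = x.
  by apply: functional_extensionality_dep => l; rewrite scalerA mulVf// scale1r.
move=> h.
have aa : toR `|a| * toR `|a^-1| = 1.
  by rewrite -toRM// -normrM divff// normr1; case: (k).
have a_ge0 : 0 <= toR `|a| by exact: (rnorm_ge0 (a : K^o)).
by have := ler_wpM2l a_ge0 h; rewrite mulrA aa mul1r.
Qed.

Lemma dsum_norm_eq0 x : dsum_mem x -> dsum_norm x = 0 -> x = fun _ => 0.
Proof.
move=> /dsum_bound_norm + x0; rewrite x0 /dsum_bound.
case: eqVneq => [_|p0] h; apply: functional_extensionality_dep => l;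
    apply: rnorm_eq0; apply/eqP; rewrite eq_le rnorm_ge0 andbT//.
have /psum_le/(_ [set l] (finite_set1 l)) := h.
rewrite fsbig_set1 powR0// => {}h.
have : rnorm (x l) `^ p == 0 by rewrite eq_le h powR_ge0.
by rewrite powR_eq0 => /andP[/eqP ->].
Qed.

End direct_sum.

(* The argument [hp] is not used in the record; it is what makes the norm
   canonically available on the type. *)
Record dsum (R : realType) (k : scalar_kind) (L : choiceType) (p : R)
    (hp : p = 0 \/ 1 < p) (X : L -> normedModType (scalars R k)) := DSum {
  dsum_coord :> forall l, X l;
  dsum_coordP : dsum_mem p dsum_coord }.

Section direct_sum_space.
Variables (R : realType) (k : scalar_kind) (L : choiceType).
Variables (p : R) (hp : p = 0 \/ 1 < p).
Local Notation K := (scalars R k).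
Variable X : L -> normedModType K.
Local Notation S := (dsum hp X).
Implicit Types x y z : S.

Lemma dsum_ext x y : (forall l, x l = y l) -> x = y.
Proof.
case: x y => [f hf] [g hg] /= fg.
have {}fg : f = g by apply: functional_extensionality_dep.
by case: g / fg hg => hg; rewrite (Prop_irrelevance hf hg).
Qed.

Lemma dsum_memN x : dsum_mem p (fun l => - x l).
Proof.
have := dsum_memZ (-1) (dsum_coordP x).
congr dsum_mem; apply: functional_extensionality_dep => l.
by rewrite scaleN1r.
Qed.

Definition dsum_zero : S := DSum hp (dsum_mem0 p X).
Definition dsum_opp x : S := DSum hp (dsum_memN x).
Definition dsum_add x y : S :=
  DSum hp (dsum_memD hp (dsum_coordP x) (dsum_coordP y)).
Definition dsum_scale (a : K) x : S := DSum hp (dsum_memZ a (dsum_coordP x)).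

HB.instance Definition _ := gen_eqMixin S.
HB.instance Definition _ := gen_choiceMixin S.

Lemma dsum_addA : associative dsum_add.
Proof. by move=> x y z; apply: dsum_ext => l /=; rewrite addrA. Qed.

Lemma dsum_addC : commutative dsum_add.
Proof. by move=> x y; apply: dsum_ext => l /=; rewrite addrC. Qed.

Lemma dsum_add0 : left_id dsum_zero dsum_add.
Proof. by move=> x; apply: dsum_ext => l /=; rewrite add0r. Qed.

Lemma dsum_addN : left_inverse dsum_zero dsum_opp dsum_add.
Proof. by move=> x; apply: dsum_ext => l /=; rewrite addNr. Qed.

HB.instance Definition _ :=
  GRing.isZmodule.Build S dsum_addA dsum_addC dsum_add0 dsum_addN.

Lemma dsum_scaleA a b x : dsum_scale a (dsum_scale b x) = dsum_scale (a * b) x.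
Proof. by apply: dsum_ext => l /=; rewrite scalerA. Qed.

Lemma dsum_scale1 : left_id 1 dsum_scale.
Proof. by move=> x; apply: dsum_ext => l /=; rewrite scale1r. Qed.

Lemma dsum_scaleDr : right_distributive dsum_scale +%R.
Proof. by move=> a x y; apply: dsum_ext => l /=; rewrite scalerDr. Qed.

Lemma dsum_scaleDl x : {morph dsum_scale^~ x : a b / a + b}.
Proof. by move=> a b; apply: dsum_ext => l /=; rewrite scalerDl. Qed.

HB.instance Definition _ := GRing.Zmodule_isLmodule.Build K S
  dsum_scaleA dsum_scale1 dsum_scaleDr dsum_scaleDl.

Definition dsum_normK x : K := ofR k (dsum_norm p x).

Lemma dsum_normKD x y : dsum_normK (x + y) <= dsum_normK x + dsum_normK y.
Proof.
rewrite /dsum_normK -ofRD; apply: ofR_le.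
exact: dsum_normD (dsum_coordP x) (dsum_coordP y).
Qed.

Lemma dsum_normKZ (a : K) x : dsum_normK (a *: x) = `|a| * dsum_normK x.
Proof.
rewrite /dsum_normK -(toRK (normr_ge0 a)) -ofRM; congr ofR.
exact: dsum_normZ (dsum_coordP x).
Qed.

Lemma dsum_normK_eq0 x : dsum_normK x = 0 -> x = 0.
Proof.
move=> x0; apply: dsum_ext => l.
have : dsum_norm p x = 0.
  by rewrite -(ofRK k (dsum_norm p x)) -/(dsum_normK x) x0; case: (k).
by move=> /(dsum_norm_eq0 (dsum_coordP x)) ->.
Qed.

HB.instance Definition _ :=
  Lmodule_isNormed.Build K S dsum_normKD dsum_normKZ dsum_normK_eq0.

Lemma rnorm_dsum x : rnorm x = dsum_norm p x.
Proof. exact: ofRK. Qed.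

Definition dsum_inj l (v : X l) : S := DSum hp (dsum_mem_single p v).

End direct_sum_space.

(* Main.v *)
(** Write [K_A] for the image of the dual ball under the adjoint of [A].

    Upper bound.  If [x] in [K_D] is not in [r K_D] for [r] close to 1, finitely
    many coordinates of [x] carry almost all of its l_q mass, and this persists
    on a weak*-neighborhood of [x].  Two points of [K_D] in that neighborhood
    that are far apart differ, relatively to their size, on coordinates of total
    weight bounded below.  Recording for each coordinate its Szlenk rank (below
    [beta]) turns a chain of derivatives at [x] into a game in which every move
    decreases ordinals of total weight at least 1; such a game has length below
    [beta * m + 1] with [m] independent of the number of coordinates.  Hence
    [beta * m + 1] derivatives shrink [K_D] to [r K_D], and finitely many
    multiples of [beta] exhaust it.

    Lower bound.  The sets [K_(A l)] embed in [K_D]; if their [e]-indices are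
    cofinal in [alpha], compactness gives a point in the [alpha]-th derivative of
    [K_D], and convexity doubles the index each time [e] is halved. *)

Require Import Defs.
From HB Require Import structures.
From mathcomp Require Import all_boot all_order all_algebra.
From mathcomp Require Import all_classical all_reals all_analysis.
From mathcomp Require Import complex ring lra.

Set Implicit Arguments.
Unset Strict Implicit.
Unset Printing Implicit Defensive.

Import Order.TTheory GRing.Theory Num.Theory.
Import numFieldNormedType.Exports.

Local Open Scope classical_set_scope.
Local Open Scope ring_scope.

(** * Ordinal arithmetic *)

(** The finite set of coordinates varies with the point and its size has no bound, so a count of
    moves depending on that size would give no order of derivation valid on all of K_D. Only mass is
    controlled: the l_q mass of a point is at most 1 and the coordinates that drop in one move have
    mass at least a fixed kappa. Hence the game has weights, and its length is bounded through their
    sum. Ranks are taken after division by 2 b l, where b l is a lower bound for the gauge of the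
    coordinate in K_(A l). Separation e in K_D becomes e / 8 there: one factor 2 pays for replacing
    one of the two points by the center x, one for discarding coordinates with small relative
    difference, one for the division. The doubling argument gives b + b < alpha for b < alpha, so
    alpha is closed under finite multiples: beta < alpha bounds Sz(D) by alpha, while beta = alpha
    only gives alpha omega. Noncompactness gives alpha > 1, which makes alpha a limit ordinal, and
    compactness then applies at stage alpha. *)

Lemma oleP a b : ~ olt b a <-> ole a b.
Proof.
split=> [h|ab ba]; first by case: (ole_total a b).
have {ab ba} : olt b b := ole_trans ba ab.
by elim/(well_founded_ind olt_wf): b => b IH h; exact: (IH b h).
Qed.

Lemma oltP a b : ~ ole a b <-> olt b a.
Proof.
split=> [h|ba ab]; first by case: (ole_total a b).
by move/oleP: ab.
Qed.

Lemma olt_irr a : ~ olt a a.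
Proof. by move/oleP: (ole_refl a). Qed.

Lemma oltW a b : olt a b -> ole a b.
Proof. exact: ole_trans (ole_succ (ole_refl a)). Qed.

Lemma ole_lt_trans b a c : ole a b -> olt b c -> olt a c.
Proof. by move=> ab; apply: (@ole_trans (osucc b)). Qed.

Lemma olt_le_trans b a c : olt a b -> ole b c -> olt a c.
Proof. exact: ole_trans. Qed.

Lemma olt_trans b a c : olt a b -> olt b c -> olt a c.
Proof. by move=> /oltW; exact: ole_lt_trans. Qed.

Lemma oltS a : olt a (osucc a).
Proof. exact: ole_refl. Qed.

Lemma oadd_base a b : ole a (oadd a b).
Proof.
elim: b => [|b IH|J f IH] /=; first exact: ole_refl.
  exact: ole_succ.
by apply: (@ole_sup _ _ None); exact: ole_refl.
Qed.

Lemma oadd_monoR a b c : ole b c -> ole (oadd a b) (oadd a c).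
Proof.
elim: b c => [|b IH|J f IH] c; first by move=> _; exact: oadd_base.
  elim: c => //= [c _|J g IHg [i /IHg h]]; first exact: IH.
  by exists (Some i).
move=> h [j|]; first exact: IH.
exact: oadd_base.
Qed.

Lemma oadd_ltR a b c : olt b c -> olt (oadd a b) (oadd a c).
Proof. exact: (@oadd_monoR a (osucc b) c). Qed.

Lemma oadd_monoL a b c : ole a b -> ole (oadd a c) (oadd b c).
Proof.
move=> ab; elim: c => [|c IH|J f IH] //= [j|]; first exact: (@ole_sup _ _ (Some j)).
exact: (@ole_sup _ _ None).
Qed.

Lemma oadd_mono a b c d : ole a b -> ole c d -> ole (oadd a c) (oadd b d).
Proof. by move=> ab cd; apply: ole_trans (oadd_monoL _ ab) (oadd_monoR _ cd). Qed.

Lemma oaddA_le a b c : ole (oadd a (oadd b c)) (oadd (oadd a b) c).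
Proof.
elim: c => [|c IH|J f IH] /=; first exact: ole_refl.
  exact: IH.
move=> [[j|]|]; [exact: (@ole_sup _ _ (Some j)) | |].
  by apply: (@ole_sup _ _ None); exact: ole_refl.
by apply: (@ole_sup _ _ None); exact: oadd_base.
Qed.

Lemma oaddA_ge a b c : ole (oadd (oadd a b) c) (oadd a (oadd b c)).
Proof.
elim: c => [|c IH|J f IH] /=; first exact: ole_refl.
  exact: IH.
move=> [j|]; first exact: (@ole_sup _ _ (Some (Some j))).
by apply: (@ole_sup _ _ (Some None)); exact: ole_refl.
Qed.

Lemma oadd_0l a : ole (oadd ozero a) a.
Proof. by elim: a => //= J f IH [j|//]; exact: ole_sup (IH j). Qed.

Lemma ole_0add a : ole a (oadd ozero a).
Proof. by elim: a => //= J f IH j; exact: (@ole_sup _ _ (Some j)). Qed.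

(** A form of subtraction: a strict bound by [a + c] becomes a bound by [a + s] with [s < c]. The
    first alternative matters only when [c] denotes 0. *)
Lemma olt_add_inv r a c : olt r (oadd a c) -> ole r a \/ exists2 s, olt s c & ole r (oadd a s).
Proof.
elim: c r => [|c IH|J f IH] r /=; first by move/oltW; left.
  by move=> h; right; exists c => //; exact: oltS.
case=> -[j|]; last by move/oltW; left.
case/IH => [|[s sj rs]]; first by left.
by right; exists s => //; exists j.
Qed.

Fixpoint onat (a : ord) (n : nat) : ord :=
  if n is n'.+1 then oadd (onat a n') a else ozero.

Lemma omul_nat a n : omul a (iter n osucc ozero) = onat a n.
Proof. by elim: n => //= n ->. Qed.

Lemma onat_le a m n : (m <= n)%N -> ole (onat a m) (onat a n).
Proof.
move/subnK <-; elim: (n - m)%N => [|d IH]; first exact: ole_refl.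
by rewrite addSn; exact: ole_trans IH (oadd_base _ _).
Qed.

Lemma onat_mono a b n : ole a b -> ole (onat a n) (onat b n).
Proof. by move=> ab; elim: n => //= n IH; exact: oadd_mono. Qed.

Lemma onat1_le a : ole a (onat a 1).
Proof. exact: ole_0add. Qed.

Lemma onat1_ge a : ole (onat a 1) a.
Proof. exact: oadd_0l. Qed.

Lemma onatD_le a m n : ole (onat a (m + n)) (oadd (onat a m) (onat a n)).
Proof.
elim: n => [|n IH]; first by rewrite addn0; exact: ole_refl.
rewrite addnS /=; apply: ole_trans (oadd_monoL _ IH) _.
exact: oaddA_ge.
Qed.

Lemma onatD_ge a m n : ole (oadd (onat a m) (onat a n)) (onat a (m + n)).
Proof.
elim: n => [|n IH]; first by rewrite addn0; exact: ole_refl.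
rewrite addnS /=; apply: ole_trans (oaddA_le _ _ _) _.
exact: oadd_monoL.
Qed.

Lemma onatM_le a m n : ole (onat (onat a m) n) (onat a (m * n)).
Proof.
elim: n => [|n IH]; first by rewrite muln0.
rewrite mulnS addnC /=; apply: ole_trans (onatD_ge _ _ _).
exact: oadd_monoL.
Qed.

Lemma olt_double a : olt ozero a -> olt a (onat a 2).
Proof.
move=> a0; apply: (@ole_lt_trans (onat a 1)); first exact: onat1_le.
exact: (@oadd_ltR (onat a 1) ozero a).
Qed.

(* [t] is the leading power of omega in the Cantor normal form of [b]. *)
Lemma leading_term b : olt ozero b -> exists t, [/\ ole t b,
  exists n, olt b (onat t n) & forall s n, olt s t -> olt (onat s n) t].
Proof.
(* [t] is the least ordinal with a finite multiple above [b]. If [t <= s m] with [s < t], then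
   [b < t n <= s (m n)], against minimality. *)
move=> b0; have [|t [[n bn] tmin]] := @oleast_ex (fun t => exists n, olt b (onat t n)).
  by exists b, 2; exact: olt_double.
have small s m : olt s t -> ole (onat s m) b.
  move=> st; apply/oleP => h; move/oleP: (tmin s (ex_intro _ m h)); exact.
exists t; split; [exact/tmin/(ex_intro _ 2)/olt_double | by exists n |].
move=> s m st; apply/oltP => h.
have /oleP := small s (m * n)%N st; apply; apply: olt_le_trans bn _.
exact: ole_trans (onat_mono _ h) (onatM_le _ _ _).
Qed.

(** * A game on tuples of ordinals *)

(** A lower bound for the rank of [r] in the tree of moves. At a successor one move is played and
    [b] remain, just as a point of a derivative of order [b + 1] has nearby points in the derivative
    of order [b]. *)
Fixpoint iterated (T : Type) (move : T -> T -> Prop) (a : ord) (r : T) : Prop :=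
  match a with
  | ozero => True
  | osucc b => exists2 r', move r r' & iterated move b r'
  | osup J f => forall j, iterated move (f j) r
  end.

Lemma iterated_anti T (move : T -> T -> Prop) a b r :
  ole a b -> iterated move b r -> iterated move a r.
Proof.
elim: a b r => [//|a IH|J f IH] b r; last by move=> h br j; exact: IH (h j) br.
elim: b r => [//|b _|J g IHg] r.
  by move=> ab [r' rr' br']; exists r' => //; exact: IH ab br'.
by move=> [i h] br; exact: IHg h (br i).
Qed.

Section game.
Variables (R : realType) (I : choiceType).
Implicit Types (s : seq I) (w : I -> R) (base r : I -> ord).

Definition weight s w (P : I -> Prop) : R := \sum_(i <- s | `[< P i >]) w i.

(** [base] is a floor: a decrease counts only if it ends at or above it. Raising the floor turns
    moves of one game into moves of a game of smaller rank. *)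
Definition tuple_move s w base r r' : Prop :=
  (forall i, ole (r' i) (r i)) /\
  1 <= weight s w (fun i => olt (r' i) (r i) /\ ole (base i) (r' i)).

Lemma weight_sub s w (P Q : I -> Prop) : (forall i, 0 <= w i) ->
  (forall i, i \in s -> P i -> Q i) -> weight s w P <= weight s w Q.
Proof.
move=> w0 PQ; rewrite /weight [leLHS]big_mkcond [leRHS]big_mkcond /= big_seq [leRHS]big_seq.
apply: ler_sum => i si; case: asboolP => [/(PQ i si) Qi|_]; first by rewrite asboolT.
by case: ifP.
Qed.

Lemma weight_ex s w (P Q : I -> Prop) : (forall i, 0 <= w i) ->
  weight s w Q < weight s w P -> exists i, [/\ i \in s, P i & ~ Q i].
Proof.
move=> w0 QP; have [//|/forallNP h] := pselect (exists i, [/\ i \in s, P i & ~ Q i]).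
move: QP; rewrite ltNge weight_sub// => i si Pi.
by have [//|nQ] := pselect (Q i); case: (h i).
Qed.

Lemma weight_mem s (P : I -> Prop) i : i \in s -> P i -> 1 <= weight s (fun=> 1) P.
Proof.
move=> si Pi; rewrite /weight (perm_big _ (perm_to_rem si)) big_cons asboolT//.
by rewrite lerDl sumr_ge0.
Qed.

(** While the coordinates fallen below [base + theta n] weigh less than 1, a move, whose weight is
    at least 1, also decreases a coordinate that stays above this raised floor; so it is a move of
    the game with unit weights. In the induction [r] remains the start of the phase and [r'] is the
    current tuple. *)
Lemma game_phase s w base theta (n : I -> nat) r xi eta r' :
  (forall i, 0 <= w i) ->
  (forall i, ole (r' i) (r i)) ->
  iterated (tuple_move s w base) (oadd xi eta) r' ->
  (exists r'', [/\ forall i, ole (r'' i) (r i),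
     1 <= weight s w (fun i => (0 < n i)%N /\
                        olt (r'' i) (oadd (base i) (onat theta (n i)))) &
     iterated (tuple_move s w base) xi r'']) \/
  iterated (tuple_move s (fun=> 1)
              (fun i => oadd (base i) (onat theta (n i)))) eta r'.
Proof.
move=> w0; elim: eta r' => [|eta IH|J f IH] r' r'r /=; first by right.
- move=> [r'' [r''r' wr] hr].
  have r''r i : ole (r'' i) (r i) by exact: ole_trans (r''r' i) (r'r i).
  case: (IH r'' r''r hr) => [|inner]; first by left.
  pose P i := (0 < n i)%N /\ olt (r'' i) (oadd (base i) (onat theta (n i))).
  have [h|h] := leP 1 (weight s w P).
    by left; exists r''; split=> //; exact: iterated_anti (oadd_base _ _) hr.
  right; exists r'' => //; split=> //.
  have [i [si [lt_i base_i] nP]] := weight_ex w0 (lt_le_trans h wr).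
  apply: (weight_mem si); split=> //.
  (* For [n i = 0] the raised floor is the old one. *)
  apply/oleP => q; have [n0|n0] := posnP (n i); last exact: nP.
  by move: q; rewrite n0 /= => /oleP; exact.
- move=> h; have [|/forallNP none] := pselect (exists r'',
      [/\ forall i, ole (r'' i) (r i),
       1 <= weight s w (fun i => (0 < n i)%N /\
                          olt (r'' i) (oadd (base i) (onat theta (n i)))) &
       iterated (tuple_move s w base) xi r'']); first by left.
  right=> j; case: (IH j r' r'r (h (Some j))) => // -[r'' hr''].
  by case: (none r'').
Qed.

Lemma ordinal_bound s theta (P : I -> ord -> Prop) : olt ozero theta ->
  (forall i a b, ole a b -> P i a -> P i b) ->
  (forall i, i \in s -> exists2 a, olt a theta & P i a) ->
  exists2 a, olt a theta & forall i, i \in s -> P i a.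
Proof.
move=> t0 mono; elim: s => [|i s IH] h; first by exists ozero.
have [a at_ Pa] : exists2 a, olt a theta & forall i, i \in s -> P i a.
  by apply: IH => j sj; apply: h; rewrite inE sj orbT.
have [b bt Pb] := h i (mem_head _ _).
case: (ole_total a b) => ab; [exists b|exists a] => // j; rewrite inE => /predU1P[->|sj] //.
- exact: mono ab (Pa j sj).
- exact: mono (oltW ab) Pb.
- exact: Pa.
Qed.

(* The tuple is split along the leading term of [beta]: as long as less than
   unit weight has passed below the multiple of [theta] it started above, every
   move decreases another remainder, which is a game of smaller rank. *)
Lemma game_bound beta (W : R) : exists m, forall s w base r,
  (forall i, 0 <= w i) -> \sum_(i <- s) w i <= W ->
  (forall i, i \in s -> ole (r i) (oadd (base i) beta)) ->
  ~ iterated (tuple_move s w base) (osucc (onat beta m)) r.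
Proof.
elim/(well_founded_ind olt_wf): beta W => beta IH W.
have [b0|b0] := ole_total beta ozero.
  exists 0%N => s w base r w0 _ hr [r' [_ w1] _].
  move: w1; rewrite leNgt => /negP; apply.
  rewrite /weight big1_seq ?ltr01// => i /andP[/asboolP[lt_i base_i] si].
  have rb : ole (r i) (base i) := ole_trans (hr i si) (oadd_monoR (base i) b0).
  by case: (@olt_irr (r i)); exact: ole_lt_trans (ole_trans rb base_i) lt_i.
have [theta [tb [k bk] small]] := leading_term b0.
have t0 : olt ozero theta.
  apply/oltP => h; have k0 : ole (onat theta k) ozero.
    by elim: (k) => //= n IHn; exact: ole_trans (oadd_mono IHn h) (oadd_0l _).
  by move: (olt_le_trans bk k0).
(* The potential [sum w i * n i] is at most [W k], and every phase of length [theta] lowers it by at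
   least 1. Since [theta <= beta], this many phases fit into [beta m]. *)
exists (Num.truncn (W * k%:R)).+1 => s w base r w0 sW hr.
(* [n] is the quotient by [theta] of the part of [r0 i] above [base i]. For [n = 0] no lower bound
   is asked, since [r0 i] may lie below [base i]. *)
have nex r0 : (forall i, i \in s -> ole (r0 i) (oadd (base i) beta)) -> forall i,
    exists n, i \in s -> (n <= k)%N /\ (olt (r0 i) (oadd (base i) (onat theta n.+1)) /\
      ((0 < n)%N -> ole (oadd (base i) (onat theta n)) (r0 i))).
  move=> hr0 i; have [si|] := boolP (i \in s); last by exists 0%N.
  have h0 : olt (r0 i) (oadd (base i) (onat theta k.+1)).
    apply: ole_lt_trans (hr0 i si) (oadd_ltR _ (olt_le_trans bk _)).
    exact: oadd_base.
  have ex : exists n, `[< olt (r0 i) (oadd (base i) (onat theta n.+1)) >].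
    by exists k; exact/asboolP.
  case: (ex_minnP ex) => n /asboolP hn nmin; exists n => _; split.
    by apply: nmin; exact/asboolP.
  split=> // n0; apply/oleP => q; have := nmin n.-1.
  by rewrite prednK// asboolT// => /(_ isT); rewrite leqNgt ltn_predL n0.
suff main q : forall r n, (forall i, i \in s -> ole (r i) (oadd (base i) beta)) ->
    (forall i, i \in s -> olt (r i) (oadd (base i) (onat theta (n i).+1)) /\
      ((0 < n i)%N -> ole (oadd (base i) (onat theta (n i))) (r i))) ->
    \sum_(i <- s) w i * (n i)%:R < q%:R ->
    ~ iterated (tuple_move s w base) (onat theta q) r.
  have [n hn] := choice (nex r hr).
  move=> it; apply: (main (Num.truncn (W * k%:R)).+1 r n hr).
  - by move=> i si; case: (hn i si).
  - apply: (@le_lt_trans _ _ (W * k%:R)); last exact: truncnS_gt.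
    apply: (@le_trans _ _ (\sum_(i <- s) w i * k%:R)).
      rewrite big_seq [leRHS]big_seq; apply: ler_sum => i si.
      by rewrite ler_wpM2l// ler_nat; case: (hn i si).
    by rewrite -mulr_suml ler_wpM2r.
  - apply: iterated_anti it; apply: ole_succ; exact: onat_mono.
elim: q => [|q IHq] {hr}r n hr hn.
  rewrite ltNge sumr_ge0// => i _; exact: mulr_ge0.
move=> sq it.
have [sigma st hsigma] : exists2 a, olt a theta & forall i, i \in s ->
    ole (r i) (oadd (oadd (base i) (onat theta (n i))) a).
  apply: ordinal_bound => //.
    move=> i a b ab h; exact: ole_trans h (oadd_monoR _ ab).
  move=> i si; case: (hn i si) => /= h _.
  have {}h := olt_le_trans h (oaddA_le _ _ _).
  by case: (olt_add_inv h) => [ra|//]; exists ozero.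
have sb : olt sigma beta by exact: olt_le_trans st tb.
(* This [m] depends on the length of [s], which does no harm: [theta] exceeds every finite multiple
   of [sigma]. *)
have [m hm] := IH sigma sb (size s)%:R.
have small_m : ole (osucc (onat sigma m)) theta by exact: small.
have := @game_phase s w base theta n r (onat theta q) (osucc (onat sigma m)) r w0
  (fun i => ole_refl _).
case.
- exact: iterated_anti (oadd_monoR _ small_m) it.
- move=> [r'' [r''r w1 it'']].
  have hr'' i : i \in s -> ole (r'' i) (oadd (base i) beta).
    by move=> si; exact: ole_trans (r''r i) (hr i si).
  have [n'' hn''] := choice (nex r'' hr'').
  apply: (IHq r'' n'' hr'') it''; first by move=> i si; case: (hn'' i si).
  have n''n i : i \in s -> (n'' i <= n i)%N.
    move=> si; rewrite leqNgt; apply/negP => lt_n; case: (hn'' i si) => _ [_].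
    move=> /(_ (leq_trans (ltn0Sn _) lt_n)) h.
    case: (@olt_irr (r'' i)); apply: (ole_lt_trans (r''r i)).
    apply: olt_le_trans (proj1 (hn i si)) (ole_trans _ h).
    exact/oadd_monoR/onat_le.
  (* A coordinate that fell below [base i + theta n i] has a strictly smaller quotient, so the
     potential drops at least by the weight of these coordinates. *)
  suff : \sum_(i <- s) w i * (n'' i)%:R + 1 <= \sum_(i <- s) w i * (n i)%:R.
    by move=> h; move: (le_lt_trans h sq); rewrite -[q.+1]addn1 natrD ltrD2r.
  apply: le_trans (lerD (lexx _) w1) _; rewrite /weight [X in _ + X]big_mkcond -big_split/=.
  rewrite big_seq [leRHS]big_seq; apply: ler_sum => i si.
  case: asboolP => [[n0 h]|_]; last by rewrite addr0 ler_wpM2l// ler_nat n''n.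
  rewrite -[X in _ + X]mulr1 -mulrDr; apply: ler_wpM2l => //; rewrite natr1 ler_nat.
  rewrite ltnNge; apply/negP => le_n; case: (hn'' i si) => _ [_].
  move=> /(_ (leq_trans n0 le_n)) h'.
  case: (@olt_irr (r'' i)); apply: olt_le_trans h (ole_trans _ h').
  exact/oadd_monoR/onat_le.
- apply: hm => //; by rewrite big_const_seq iter_addr_0 count_predT.
Qed.

End game.
(** * Duals and the weak* topology *)

Section scalar_facts.
Variables (R : realType) (k : scalar_kind).
Local Notation K := (scalars R k).
Implicit Types V : normedModType K.

Definition modulus (a : K) : R := toR `|a|.

Lemma modulus_ge0 a : 0 <= modulus a.
Proof. exact: (rnorm_ge0 (a : K^o)). Qed.

Lemma modulusD a b : modulus (a + b) <= modulus a + modulus b.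
Proof. exact: (rnormD (a : K^o) b). Qed.

Lemma modulusM a b : modulus (a * b) = modulus a * modulus b.
Proof. exact: (rnormZ a (b : K^o)). Qed.

Lemma modulus0 : modulus 0 = 0.
Proof. exact: (rnorm0 (K^o : normedModType K)). Qed.

Lemma modulus_eq0 a : modulus a = 0 -> a = 0.
Proof. exact: (@rnorm_eq0 _ _ (K^o : normedModType K) a). Qed.

Lemma modulus_ofR (x : R) : modulus (ofR k x) = `|x|.
Proof.
rewrite /modulus; case: (k) => //=.
by rewrite expr0n addr0 sqrtr_sqr.
Qed.

Lemma ofR1 : ofR k (1 : R) = 1.
Proof. by case: (k). Qed.

Lemma ofRN (x : R) : ofR k (- x) = - ofR k x.
Proof. by apply/eqP; rewrite -addr_eq0 -ofRD addNr ofR0. Qed.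

Lemma ofRV (x : R) : x != 0 -> ofR k x^-1 * ofR k x = 1.
Proof. by move=> x0; rewrite -ofRM mulVf// ofR1. Qed.

Lemma toR_lt (a b : K) : 0 <= a -> 0 <= b -> (toR a < toR b) = (a < b).
Proof.
move=> a0 b0; apply/idP/idP => [h|h].
  rewrite lt_neqAle -(toRK a0) -(toRK b0) ofR_le ?(ltW h)// andbT.
  by apply: contraTneq h => /(congr1 (@toR R k)); rewrite !ofRK => ->; rewrite ltxx.
rewrite lt_neqAle toR_le ?(ltW h)// andbT.
by apply: contraTneq h => /(congr1 (@ofR R k)); rewrite !toRK// => ->; rewrite ltxx.
Qed.

Lemma ofR_ge0 (x : R) : 0 <= x -> 0 <= ofR k x.
Proof. by move=> x0; rewrite -(ofR0 R k) ofR_le. Qed.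

Lemma ofR_gt0 (x : R) : 0 < x -> 0 < ofR k x.
Proof.
move=> x0; rewrite -(ofR0 R k) -toR_lt ?ofRK// ?ofR_ge0//; exact: ltW.
Qed.

Lemma toR_gt0 (a : K) : 0 < a -> 0 < toR a.
Proof. by move=> a0; rewrite -(ofRK k (0 : R)) ofR0 toR_lt// ltW. Qed.

Lemma rnormN V (x : V) : rnorm (- x) = rnorm x.
Proof. by rewrite /rnorm normrN. Qed.

Lemma rnormB V (x y : V) : rnorm (x - y) = rnorm (y - x).
Proof. by rewrite -rnormN opprB. Qed.

Lemma modulusN a : modulus (- a) = modulus a.
Proof. by rewrite /modulus normrN. Qed.

Lemma modulusB a b : modulus (a - b) = modulus (b - a).
Proof. by rewrite -modulusN opprB. Qed.

Lemma rnorm_nbhsP V (x : V) (U : set V) :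
  nbhs x U <-> exists2 e : R, 0 < e & forall y, rnorm (x - y) < e -> U y.
Proof.
split=> [/nbhs_normP[e /= e0 h]|[e e0 h]].
  exists (toR e); first exact: toR_gt0.
  by move=> y; rewrite /rnorm toR_lt ?(ltW e0)//; exact: h.
apply/nbhs_normP; exists (ofR k e); first exact: ofR_gt0.
move=> y /= hy; apply: h; rewrite -(ofRK k e) toR_lt//.
exact/ofR_ge0/ltW.
Qed.

Lemma rnorm_cvgP V (T : Type) (F : set_system T) (f : T -> V) (y : V) : Filter F ->
  f @ F --> y <-> forall e : R, 0 < e -> \forall t \near F, rnorm (y - f t) < e.
Proof.
move=> FF; split=> [h e e0|h U /rnorm_nbhsP[e e0 eU]].
  by apply: (h [set t | rnorm (y - t) < e]); apply/rnorm_nbhsP; exists e.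
by apply: filterS (h e e0) => t; exact: eU.
Qed.

Lemma rnorm_closed V (r : R) : closed [set x : V | rnorm x <= r].
Proof.
move=> x clx; rewrite /= leNgt; apply/negP => rx.
have [|y /= [yr xy]] := clx [set y | rnorm (x - y) < rnorm x - r].
  by apply: (proj2 (rnorm_nbhsP _ _)); exists (rnorm x - r); rewrite ?subr_gt0.
have := rnormD (x - y) y; rewrite subrK => h.
by move: (le_lt_trans h (ltr_leD xy yr)); rewrite subrK ltxx.
Qed.

End scalar_facts.

Lemma modulus_complex (R : realType) (a b : R) :
  modulus (k := complex_scalars) (a +i* b)%C = Num.sqrt (a ^+ 2 + b ^+ 2).
Proof. by []. Qed.

(** In the complex case the disc is a closed subset of the image of a square under
    [(x, y) |-> x + i y]. *)
Lemma modulus_ball_compact (R : realType) (k : scalar_kind) (r : R) :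
  compact [set a : ((scalars R k)^o : normedModType (scalars R k)) | modulus a <= r].
Proof.
case: k => /=.
  have -> : [set a : R^o | modulus (k := real_scalars) a <= r] = `[- r, r]%classic.
    by apply/seteqP; split=> a; rewrite /= in_itv /= -ler_norml.
  exact: segment_compact.
pose f (z : R * R) : (R[i]^o : normedModType (scalars R complex_scalars)) :=
  (z.1 +i* z.2)%C.
have fct : continuous f.
  move=> z; apply/(@rnorm_cvgP R complex_scalars) => e e0.
  have e20 : 0 < e / 2 by rewrite divr_gt0.
  have h1 : \forall t \near z, `|z.1 - t.1| < e / 2.
    have : fst @ z --> z.1 by exact: cvg_fst.
    by move/cvgrPdist_lt/(_ _ e20).
  have h2 : \forall t \near z, `|z.2 - t.2| < e / 2.
    have : snd @ z --> z.2 by exact: cvg_snd.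
    by move/cvgrPdist_lt/(_ _ e20).
  near=> t; rewrite [e]splitr /f.
  have -> : rnorm (f z - f t) = modulus (k := complex_scalars)
     (((z.1 - t.1)%:C)%C + (0 +i* (z.2 - t.2))%C).
    rewrite -[LHS]/(modulus (k := complex_scalars) (f z - f t)).
    by congr (modulus (k := complex_scalars) _); rewrite /f; apply/eqP;
      rewrite eq_complex /= addr0 add0r !eqxx.
  apply: le_lt_trans (modulusD _ _) _; rewrite !modulus_complex expr0n add0r addr0.
  rewrite !sqrtr_sqr; apply: ltrD; near: t; [exact: h1|exact: h2].
have sq : compact (f @` (`[- r, r]%classic `*` `[- r, r]%classic)).
  apply: continuous_compact; first exact/continuous_subspaceT.
  by apply: compact_setX; exact: segment_compact.
apply: subclosed_compact sq _.
  exact: (@rnorm_closed R complex_scalars).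
move=> [a b] h; have {}h : Num.sqrt (a ^+ 2 + b ^+ 2) <= r := h.
exists (a, b) => //=; rewrite !in_itv /= -!ler_norml -!sqrtr_sqr.
by split; apply: le_trans h; rewrite ler_wsqrtr// ?lerDl ?lerDr sqr_ge0.
Unshelve. all: by end_near.
Qed.


Section weak_star.
Variables (R : realType) (k : scalar_kind).
Local Notation K := (scalars R k).
Implicit Types X Y : normedModType K.

Lemma weak_star_cvgP X (F : set_system (dual X)) (f : dual X) : Filter F ->
  F --> (f : weak_star X) <->
  forall x (e : R), 0 < e -> \forall g \near F, modulus (f x - (g : dual X) x) < e.
Proof.
move=> FF; pose j (g : dual X) := (g : X -> K^o) : {ptws X -> K^o}.
have -> : (F --> (f : weak_star X)) <-> {ptws, j @ F --> (f : X -> K^o)}.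
  split=> [cv|cv A [_ [[B oB <-] Bf BA]]].
    move=> B nB; have nB' : nbhs (f : weak_star X) (j @^-1` B).
      exact: (@initial_continuous (dual X) _ j f B nB).
    exact: (cv _ nB').
  by apply: filterS BA _; apply: cv; exact: open_nbhs_nbhs.
have -> : {ptws, j @ F --> (f : X -> K^o)} <->
    forall x, (fun g => g x) @ (j @ F) --> (f x : K^o).
  exact: pointwise_cvgP.
split=> h x; first by move=> e e0; exact: (proj1 (@rnorm_cvgP _ _ K^o _ _ _ _ _) (h x)).
by apply/rnorm_cvgP => e e0; exact: h.
Qed.

End weak_star.

Section operators.
Variables (R : realType) (k : scalar_kind).
Local Notation K := (scalars R k).
Implicit Types X Y Z : normedModType K.

Lemma bop_ext X Y (f g : bop X Y) : (forall x, f x = g x) -> f = g.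
Proof.
case: f g => f cf [g cg] /= fg.
have {}fg : f = g.
  case: f g fg {cf cg} => [f [[a] [b]]] [g [[c] [d]]] /= fg.
  have {}fg : f = g by exact/funext.
  by case: g / fg c d => c d; rewrite (Prop_irrelevance a c) (Prop_irrelevance b d).
by case: g / fg cg => cg; rewrite (Prop_irrelevance cf cg).
Qed.

Lemma bop_bounded X Y (f : bop X Y) :
  exists2 C : R, 0 <= C & forall x, rnorm (f x) <= C * rnorm x.
Proof.
have /rnorm_cvgP/(_ 1 ltr01) : f @ (0 : X) --> f 0 by exact: bop_continuous.
move=> /rnorm_nbhsP[e e0 he].
exists (2 / e) => [|x]; first by rewrite divr_ge0// ltW.
have [x0|x0] := eqVneq (rnorm x) 0.
  by rewrite (rnorm_eq0 x0) raddf0 !rnorm0 mulr0.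
have x_gt0 : 0 < rnorm x by rewrite lt_def x0 rnorm_ge0.
pose c := e / (2 * rnorm x).
have c0 : 0 < c by rewrite divr_gt0// mulr_gt0.
have := he (ofR k c *: x).
rewrite !raddf0 !sub0r !rnormN linearZ !rnormZ -!/(modulus _) modulus_ofR gtr0_norm//.
have -> : c * rnorm x = e / 2 by rewrite /c; field; rewrite x0.
rewrite gtr_pMr// invf_lt1 ?ltr1n// => /(_ isT) h.
have := ltW h; rewrite -ler_pdivlMl// mulr1 /c invf_div => /le_trans; apply.
by rewrite mulrAC.
Qed.

Definition linear_of X Y (f : X -> Y) (lf : linear f) : {linear X -> Y} :=
  HB.pack f (GRing.isLinear.Build K X Y *:%R f lf).

Lemma bounded_continuous X Y (f : X -> Y) (lf : linear f) (C : R) :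
  (forall x, rnorm (f x) <= C * rnorm x) -> continuous (linear_of lf).
Proof.
move=> bf x; apply/rnorm_cvgP => e e0; apply/rnorm_nbhsP.
have C1 : 0 < `|C| + 1 by rewrite ltr_wpDl.
exists (e / (`|C| + 1)); first by rewrite divr_gt0.
move=> y; rewrite ltr_pdivlMr// => h; rewrite -linearB; apply: le_lt_trans (bf _) _.
apply: le_lt_trans h; rewrite mulrC ler_wpM2l ?rnorm_ge0//.
by apply: le_trans (ler_norm C) _; rewrite lerDl.
Qed.

Definition bop_of X Y (f : X -> Y) (lf : linear f) (C : R)
  (bf : forall x, rnorm (f x) <= C * rnorm x) : bop X Y := Bop (@bounded_continuous X Y f lf C bf).

Lemma dual_comb_linear X (a b : K) (f g : dual X) :
  linear (fun x => a * f x + b * g x : K^o).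
Proof.
move=> c x y; rewrite !linearP /= !mulrDr -!scalerAr.
by rewrite -![_ *: _]/(_ * _); ring.
Qed.

Lemma dual_comb_bounded X (a b : K) (f g : dual X) :
  exists C : R, forall x, rnorm (a * f x + b * g x : K^o) <= C * rnorm x.
Proof.
have [C C0 Cf] := bop_bounded f; have [D D0 Dg] := bop_bounded g.
exists (modulus a * C + modulus b * D) => x.
apply: le_trans (rnormD _ _) _; rewrite mulrDl -!mulrA.
apply: lerD.
  by rewrite -[leLHS]/(modulus (a * f x)) modulusM ler_wpM2l ?modulus_ge0//; exact: Cf.
by rewrite -[leLHS]/(modulus (b * g x)) modulusM ler_wpM2l ?modulus_ge0//; exact: Dg.
Qed.

(** Differences, real multiples and midpoints of functionals are all instances of this combination,
    so linearity, boundedness and weak* continuity are proved once. *)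
Definition dual_comb X (a b : K) (f g : dual X) : dual X :=
  bop_of (dual_comb_linear a b f g) (proj2_sig (cid (dual_comb_bounded a b f g))).

Lemma dual_combE X (a b : K) (f g : dual X) x : dual_comb a b f g x = a * f x + b * g x.
Proof. by []. Qed.

Definition dual_zero X : dual X.
Proof.
apply: (@bop_of _ (K^o : normedModType K) (fun=> 0) _ 0) => [a x y|x].
  by rewrite scaler0 addr0.
by rewrite mul0r rnorm0.
Defined.

Definition dual_scale X (a : R) (f : dual X) : dual X := dual_comb (ofR k a) 0 f f.

Lemma dual_scaleE X (a : R) (f : dual X) x : dual_scale a f x = ofR k a * f x.
Proof. by rewrite dual_combE mul0r addr0. Qed.

Lemma dual_ballP X (f : dual X) :
  dual_ball f <-> forall x, modulus (f x) <= rnorm x.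
Proof.
split=> [h x|h]; last first.
  by apply: ge_ereal_sup => _ [x x1 <-]; rewrite lee_fin; exact: le_trans (h x) x1.
have [x0|x0] := eqVneq (rnorm x) 0.
  by rewrite (rnorm_eq0 x0) raddf0 modulus0 rnorm0.
have x_gt0 : 0 < rnorm x by rewrite lt_def x0 rnorm_ge0.
pose y := ofR k (rnorm x)^-1 *: x.
have : ((modulus (f y))%:E <= 1)%E.
  apply: le_trans h; apply: ereal_sup_ubound; exists y => //.
  by rewrite /unit_ball /= rnormZ -/(modulus _) modulus_ofR ger0_norm ?invr_ge0 ?rnorm_ge0// mulVf.
rewrite lee_fin /y linearZ modulusM modulus_ofR ger0_norm ?invr_ge0 ?rnorm_ge0//.
by rewrite mulrC ler_pdivrMr// mul1r.
Qed.

Definition separated X (e : R) (f g : dual X) : Prop :=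
  exists2 x, rnorm x <= 1 & e < modulus (f x - g x).

Lemma diam_gtP X (e : R) (S : set (dual X)) :
  (e%:E < diam S)%E <-> exists f g, [/\ S f, S g & separated e f g].
Proof.
split=> [/ereal_sup_gt[_ [f [g [Sf Sg ->]]]]|[f [g [Sf Sg [x x1 h]]]]].
  move=> /ereal_sup_gt[_ [x x1 <-]]; rewrite lte_fin => h.
  by exists f, g; split=> //; exists x.
apply: (@lt_le_trans _ _ (modulus (f x - g x))%:E); first by rewrite lte_fin.
apply: (@le_trans _ _ (dual_norm (fun x => f x - g x))).
  by apply: ereal_sup_ubound; exists x.
by apply: ereal_sup_ubound; exists f, g.
Qed.

Lemma szlenk_derivativeP X (e : R) (S : set (dual X)) (f : dual X) :
  szlenk_derivative e S f <-> S f /\ forall V : set (dual X), nbhs (f : weak_star X) V ->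
    exists g h, [/\ V g /\ S g, V h /\ S h & separated e g h].
Proof. by split=> -[Sf h]; split=> // V /h/diam_gtP. Qed.

Lemma weak_star_hausdorff X : hausdorff_space (weak_star X).
Proof.
move=> f g fg; apply: bop_ext => x; apply/eqP; rewrite -subr_eq0; apply/eqP.
apply: (@modulus_eq0 R k); apply/eqP; rewrite eq_le modulus_ge0 andbT leNgt; apply/negP => h.
have near_f (f0 : dual X) : nbhs (f0 : weak_star X)
    [set h : dual X | modulus (f0 x - h x) < modulus (f x - g x) / 2].
  by apply: (proj1 (weak_star_cvgP (F := nbhs (f0 : weak_star X)) f0 _)) => //; rewrite divr_gt0.
have [u [/= hf hg]] := fg _ _ (near_f f) (near_f g).
have : modulus (f x - g x) < modulus (f x - g x).
  rewrite [X in _ < X]splitr.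
  have -> : f x - g x = (f x - u x) + (u x - g x) by rewrite addrA subrK.
  apply: le_lt_trans (modulusD _ _) _; rewrite addrA subrK.
  by rewrite [modulus (u x - _)]modulusB ltrD.
by rewrite ltxx.
Qed.

Lemma weak_star_continuousP X Y (phi : dual X -> dual Y) (f : dual X) :
  (forall y (e : R), 0 < e -> \forall g \near (f : weak_star X),
      modulus (phi f y - phi (g : dual X) y) < e) ->
  forall V : set (dual Y), nbhs (phi f : weak_star Y) V ->
    nbhs (f : weak_star X) (phi @^-1` V).
Proof.
move=> h; apply/(@weak_star_cvgP _ _ Y (phi @ nbhs (f : weak_star X))) => y e e0.
exact: h.
Qed.

Lemma weak_star_near X (f : dual X) x (e : R) : 0 < e ->
  \forall g \near (f : weak_star X), modulus (f x - (g : dual X) x) < e.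
Proof. by move=> e0; exact: (proj1 (weak_star_cvgP (F := nbhs (f : weak_star X)) f _)). Qed.

Lemma ultra_bounded_cvg (T : Type) (F : set_system T) (phi : T -> K^o) (r : R) :
  UltraFilter F -> F [set t | modulus (phi t) <= r] -> exists a : K^o, phi @ F --> a.
Proof.
move=> FU Fr; have [a [_ cla]] := @modulus_ball_compact R k r (phi @ F) _ Fr.
exists a => V aV; have [//|FV] := in_ultra_setVsetC (phi @^-1` V) FU.
by have [b [bV1 bV2]] := cla (~` V) V FV aV.
Qed.

(* Banach-Alaoglu: an ultrafilter on the ball converges pointwise. *)
Lemma dual_ball_compact X : compact (@dual_ball R k X : set (weak_star X)).
Proof.
rewrite compact_ultra => F FU FB.
have ev x : exists a : K^o, (fun g : dual X => g x) @ F --> a.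
  apply: (@ultra_bounded_cvg _ _ (fun g : dual X => g x) (rnorm x)).
  by apply: filterS FB => g /dual_ballP gb; exact: gb.
have {ev}[h hF] := choice ev.
have hP x e : 0 < e -> \forall g \near F, modulus (h x - (g : dual X) x) < e.
  exact: (proj1 (@rnorm_cvgP R k (K^o) _ F (fun g : dual X => g x) (h x) _) (hF x) e).
have close_eq (a b : K) : (forall e : R, 0 < e -> modulus (a - b) < e) -> a = b.
  move=> ab; apply/eqP; rewrite -subr_eq0; apply/eqP/modulus_eq0/eqP.
  rewrite eq_le modulus_ge0 andbT leNgt; apply/negP => /ab; by rewrite ltxx.
have hlin : linear (h : X -> K^o).
  move=> a x y; apply: close_eq => e e0.
  have d0 : 0 < e / (3 * (modulus a + 1)).
    by rewrite divr_gt0// mulr_gt0// ltr_wpDl ?modulus_ge0.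
  have e3 : 0 < e / 3 by rewrite divr_gt0.
  have FI : F ([set g : dual X | modulus (h (a *: x + y) - g (a *: x + y)) < e / 3] `&`
      [set g : dual X | modulus (h x - g x) < e / (3 * (modulus a + 1))] `&`
      [set g : dual X | modulus (h y - g y) < e / 3]).
    by apply: filterI; [apply: filterI|]; exact: hP.
  have [g [[/= g1 g2] g3]] := filter_ex FI.
  have -> : h (a *: x + y) - (a *: h x + h y) =
     (h (a *: x + y) - g (a *: x + y)) + (- (a * (h x - g x)) - (h y - g y)).
    by rewrite linearP -[a *: h x]/(a * h x) -[a *: g x]/(a * g x); ring.
  apply: le_lt_trans (modulusD _ _) _; apply: le_lt_trans (lerD (lexx _) (modulusD _ _)) _.
  rewrite !modulusN modulusM.
  have : modulus a * modulus (h x - g x) <= e / 3.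
    apply: (@le_trans _ _ ((modulus a + 1) * (e / (3 * (modulus a + 1))))).
      by apply: ler_pM; rewrite ?modulus_ge0 ?lerDl// ltW.
    by rewrite le_eqVlt; apply/orP; left; apply/eqP; field; rewrite gt_eqF// ltr_wpDl ?modulus_ge0.
  by move=> ?; lra.
have hb x : modulus (h x) <= rnorm x.
  apply/ler_addgt0Pr => e e0.
  have FI : F ([set g : dual X | modulus (h x - g x) < e] `&` (@dual_ball R k X)).
    by apply: filterI => //; exact: hP.
  have [g [/= g1 /dual_ballP g2]] := filter_ex FI.
  rewrite -(subrK (g x) (h x)) addrC; apply: le_trans (modulusD _ _) _.
  by apply: lerD; [exact: g2|exact: ltW].
have hb1 x : rnorm (h x : K^o) <= 1 * rnorm x by rewrite mul1r; exact: hb.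
exists (bop_of hlin hb1); split; first exact/dual_ballP.
by apply/weak_star_cvgP => x e; exact: hP.
Qed.

Lemma adjoint_weak_star_continuous X Y (A : bop X Y) :
  continuous (adjoint A : weak_star Y -> weak_star X).
Proof.
move=> g; apply: weak_star_continuousP => x e e0; exact: weak_star_near.
Qed.

End operators.
(** * Szlenk derivatives *)

Section szlenk_theory.
Variables (R : realType) (k : scalar_kind).
Local Notation K := (scalars R k).
Implicit Types X Y : normedModType K.

Lemma szlenk_iterD X (e : R) (S : set (dual X)) a b :
  szlenk_iter e S (oadd a b) = szlenk_iter e (szlenk_iter e S a) b.
Proof.
elim: b => //= [b ->//|J f IH]; apply/seteqP; split=> [x [Sx h]|x [Sx h]].
  by split=> [|j]; [exact: (h None)|rewrite -IH; exact: (h (Some j))].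
split; first exact: szlenk_iter_sub Sx.
by move=> [j|//]; rewrite IH.
Qed.

Lemma szlenk_iter_closed X (e : R) (S : set (dual X)) a :
  closed (S : set (weak_star X)) -> closed (szlenk_iter e S a : set (weak_star X)).
Proof.
move=> cS; elim: a => //= [a IH|J f IH] x clx.
  have ax : szlenk_iter e S a x.
    by apply: IH => U /clx[y [[Sy _] Uy]]; exists y.
  split=> // V; rewrite nbhsE => -[U [oU Ux] UV].
  have [y [[Sy hy] Uy]] := clx U (open_nbhs_nbhs (conj oU Ux)).
  apply: lt_le_trans (hy U (open_nbhs_nbhs (conj oU Uy))) _.
  apply: le_ereal_sup => _ [g [h [[Ug ag] [Uh ah] ->]]].
  by exists g, h; split=> //; split=> //; exact: UV.
split; first by apply: cS => U /clx[y [[Sy _] Uy]]; exists y.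
by move=> j; apply: IH => U /clx[y [[_ Sy] Uy]]; exists y.
Qed.

(** Preimages of weak* neighborhoods are neighborhoods, and separated pairs go to separated pairs.
    Inclusions, multiples, midpoints with a fixed point and the embeddings of the K_(A l) into K_D
    are all compared through this lemma. *)
Lemma szlenk_iter_map X Y (phi : dual X -> dual Y) (e e' : R)
    (S : set (dual X)) (T : set (dual Y)) a :
  (forall x, S x -> T (phi x)) ->
  continuous (phi : weak_star X -> weak_star Y) ->
  (forall x y, S x -> S y -> separated e x y -> separated e' (phi x) (phi y)) ->
  forall x, szlenk_iter e S a x -> szlenk_iter e' T a (phi x).
Proof.
move=> ST cphi sep; elim: a => [|a IH|J f IH] x /=; first exact: ST.
  move=> /szlenk_derivativeP[Sx h]; apply/szlenk_derivativeP; split; first exact: IH.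
  move=> V /cphi/h[g [h' [[Vg Sg] [Vh Sh] gh]]]; exists (phi g), (phi h').
  split; [by split=> //; exact: IH|by split=> //; exact: IH|].
  by apply: sep gh; [exact: szlenk_iter_sub Sg|exact: szlenk_iter_sub Sh].
by move=> [Sx h]; split=> [|j]; [exact: ST|exact: IH].
Qed.

Lemma dual_comb_continuous X (a b : K) (g : dual X) :
  continuous ((fun f => dual_comb a b f g) : weak_star X -> weak_star X).
Proof.
move=> f; apply: weak_star_continuousP => x e e0.
have d0 : 0 < e / (modulus a + 1) by rewrite divr_gt0// ltr_wpDl ?modulus_ge0.
apply: filterS (weak_star_near f x d0) => h.
rewrite ltr_pdivlMr ?ltr_wpDl ?modulus_ge0// !dual_combE => fh.
have -> : a * f x + b * g x - (a * h x + b * g x) = a * (f x - h x) by ring.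
rewrite modulusM; apply: le_lt_trans fh; rewrite mulrC ler_wpM2l ?modulus_ge0//.
by rewrite lerDl.
Qed.

Lemma dual_scale_continuous X (a : R) :
  continuous (dual_scale a : weak_star X -> weak_star X).
Proof.
have -> : (dual_scale a : dual X -> dual X) = (fun f => dual_comb (ofR k a) 0 f (dual_zero X)).
  by apply/funext => f; apply: bop_ext => x; rewrite dual_scaleE dual_combE mul0r addr0.
exact: dual_comb_continuous.
Qed.

Definition dual_mid X (f g : dual X) : dual X := dual_comb (ofR k 2^-1) (ofR k 2^-1) f g.

Lemma dual_midE X (f : dual X) : dual_mid f f = f.
Proof.
apply: bop_ext => x; rewrite dual_combE -mulrDl -ofRD.
have -> : 2^-1 + 2^-1 = 1 :> R by rewrite -mulr2n -[_ *+ 2]mulr_natr mulVf.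
by rewrite ofR1 mul1r.
Qed.

(* For [x] in the derivative, [(S + x) / 2] lies in the derivative for [e / 2], and
   [u |-> (u + x) / 2] fixes [x]. *)
Lemma szlenk_iter_double X (e : R) (S : set (dual X)) a :
  (forall f g, S f -> S g -> S (dual_mid f g)) ->
  szlenk_iter e S a `<=` szlenk_iter (e / 2) S (oadd a a).
Proof.
move=> convex x sx; rewrite szlenk_iterD.
have sep (g : dual X) u v : separated e u v -> separated (e / 2) (dual_mid u g) (dual_mid v g).
  move=> [z z1 h]; exists z => //; rewrite !dual_combE.
  rewrite (_ : _ - _ = ofR k 2^-1 * (u z - v z)); last by ring.
  by rewrite modulusM modulus_ofR ger0_norm// mulrC ltr_pM2l.
rewrite -[x]dual_midE.
apply: (@szlenk_iter_map _ _ (fun u => dual_mid u x) e _ S) (sx) => [y Sy|f|].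
(* The roles are exchanged: for [y] in [S], the point [(x + y) / 2] is the image under
   [u |-> (u + y) / 2] of [x], which lies in the derivative. *)
- rewrite (_ : dual_mid y x = dual_mid x y); last first.
    by apply: bop_ext => z; rewrite !dual_combE addrC.
  apply: (@szlenk_iter_map _ _ (fun u => dual_mid u y) e _ S) (sx) => [z Sz|f|].
  + exact: convex.
  + exact: dual_comb_continuous.
  + by move=> u v _ _; exact: sep.
- exact: dual_comb_continuous.
- by move=> u v _ _; exact: sep.
Qed.

Lemma dual_scaleA X (a b : R) (f : dual X) : dual_scale a (dual_scale b f) = dual_scale (a * b) f.
Proof. by apply: bop_ext => x; rewrite !dual_scaleE mulrA ofRM. Qed.

Lemma dual_scale1 X (f : dual X) : dual_scale 1 f = f.
Proof. by apply: bop_ext => x; rewrite !dual_scaleE ofR1 mul1r. Qed.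

(** Multiplication by [r^-1 >= 1] does not decrease separation, so it maps derivatives of [r S] into
    derivatives of [S] for the same [e]. *)
Lemma szlenk_iter_scale X (e r : R) (S : set (dual X)) a : 0 <= e -> 0 < r -> r <= 1 ->
  szlenk_iter e (dual_scale r @` S) a `<=` dual_scale r @` szlenk_iter e S a.
Proof.
move=> e0 r0 r1 x sx; exists (dual_scale r^-1 x); last first.
  by rewrite dual_scaleA mulfV ?gt_eqF// dual_scale1.
apply: szlenk_iter_map sx => [_ [f Sf <-]|f|u v _ _ [z z1 h]].
- by rewrite dual_scaleA mulVf ?gt_eqF// dual_scale1.
- exact: dual_scale_continuous.
- exists z => //; rewrite !dual_scaleE -mulrBr modulusM modulus_ofR gtr0_norm ?invr_gt0//.
  by apply: lt_le_trans h _; rewrite ler_peMl ?modulus_ge0// invf_ge1.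
Qed.

Lemma szlenk_iter_subset X (e : R) (S T : set (dual X)) a :
  S `<=` T -> szlenk_iter e S a `<=` szlenk_iter e T a.
Proof. by move=> ST x; apply: (@szlenk_iter_map _ _ id e e S T) => // f; exact: cvg_id. Qed.

(** The derivatives below [a] are nonempty, closed and decreasing in a compact set, so the filter
    they generate has a cluster point, which lies in all of them. *)
Lemma szlenk_iter_limit X (e : R) (S : set (dual X)) a :
  compact (S : set (weak_star X)) -> olt ozero a ->
  (forall b, olt b a -> olt (osucc b) a) ->
  (forall b, olt b a -> szlenk_iter e S b !=set0) -> szlenk_iter e S a !=set0.
Proof.
move=> cS; have clS := compact_closed (@weak_star_hausdorff R k X) cS.
elim: a => [//|a _|J f IH] a0 lim ne.
  by case: (@olt_irr (osucc a)); exact: lim (oltS a).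
(* A supremum may be attained by some [f j]; both terms then denote the same ordinal and the
   induction hypothesis applies. *)
have [[j h]|/forallNP small] := pselect (exists j, ole (osup f) (f j)).
  have [||| x hx] := IH j.
  - exact: olt_le_trans a0 h.
  - move=> b bj; apply: olt_le_trans h; apply: lim; apply: olt_le_trans bj _.
    exact: ole_sup (ole_refl _).
  - by move=> b bj; apply: ne; apply: olt_le_trans bj _; exact: ole_sup (ole_refl _).
  - by exists x; exact: szlenk_iter_anti h _ hx.
have {}small j : olt (f j) (osup f) by apply/oltP; exact: small.
pose F : set_system (weak_star X) :=
  [set B | exists b, olt b (osup f) /\ szlenk_iter e S b `<=` B].
have FF : ProperFilter F.
  apply: Build_ProperFilter_ex.
    by move=> B [b [/ne[x bx] bB]]; exists x; exact: bB.
  split.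
  - by exists ozero; split.
  - move=> B C [b [ba bB]] [c [ca cC]].
    have [bc|/oltW cb] := ole_total b c.
      exists c; split=> // x cx; split; last exact: cC.
      by apply: bB; exact: szlenk_iter_anti bc _ cx.
    exists b; split=> // x bx; split; first exact: bB.
    by apply: cC; exact: szlenk_iter_anti cb _ bx.
  - by move=> B C BC [b [ba bB]]; exists b; split=> //; exact: subset_trans BC.
have [x [Sx clx]] : S `&` cluster F !=set0 by apply: cS; exists ozero; split.
exists x; split=> // j; apply: (szlenk_iter_closed clS) => U Ux.
by apply: clx Ux; exists (f j); split.
Qed.

(** Derivatives decrease, so the stages before the first empty one are exactly the nonempty ones.
    All indices below are handled through the ordinals strictly below them. *)
Lemma Sz_set_eps_gtP X (S : set (dual X)) (e : R) b :
  eolt (Some b) (Sz_set_eps S e) <-> szlenk_iter e S b !=set0.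
Proof.
rewrite /Sz_set_eps /oleast; case: pselect => [h|h] /=; last first.
  split=> // _; apply/set0P/eqP => b0; by apply: h; exists b.
case: (cid _) => a [a0 amin] /=; split=> [ba|[x bx]].
  by apply/set0P/eqP => /amin/oleP.
by apply/oltP => ab; have := szlenk_iter_anti ab bx; rewrite a0.
Qed.

End szlenk_theory.

(** * Comparison of ordinals and oo with suprema *)

Lemma eoltP a b : ~ eole a b <-> eolt b a.
Proof.
case: a b => [a|] [b|] /=; [exact: oltP| | |]; split=> //; tauto.
Qed.

Lemma eoleP a b : ~ eolt b a <-> eole a b.
Proof.
case: a b => [a|] [b|] /=; [exact: oleP| | |]; split=> //; tauto.
Qed.

Lemma eosup_leP (I : Type) (f : I -> eord) a :
  eole (eosup f) (Some a) <-> forall i, eole (f i) (Some a).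
Proof.
rewrite /eosup; case: pselect => [[i fi]|nf] /=; split=> //.
- by move=> /(_ i); rewrite fi.
- by move=> h i; move: (h i); case: (f i) (fun e => nf (ex_intro _ i e)) => //= /(_ erefl).
- by move=> h i; move: (h i); case: (f i).
Qed.

Lemma eosup_gtP (I : Type) (f : I -> eord) a :
  eolt (Some a) (eosup f) <-> exists i, eolt (Some a) (f i).
Proof.
split=> [/eoltP h|[i /eoltP h]]; last by apply/eoltP => /eosup_leP.
have [//|/forallNP n] := pselect (exists i, eolt (Some a) (f i)).
by case: h; apply/eosup_leP => i; apply/eoleP.
Qed.
(** * The Hahn-Banach theorem *)

Section hahn_banach.
Variables (R : realType) (k : scalar_kind).
Local Notation K := (scalars R k).
Variable Y : normedModType K.
Implicit Types (p q : Y -> R) (x y z : Y) (t : R).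

Definition sublinear q : Prop :=
  (forall x y, q (x + y) <= q x + q y) /\
  forall t x, 0 <= t -> q (ofR k t *: x) <= t * q x.

Lemma sublinear0 q : sublinear q -> q 0 = 0.
Proof.
move=> [qD qZ]; apply/eqP; rewrite eq_le; apply/andP; split.
  by have := qZ 0 0 (lexx _); rewrite mul0r scaler0.
by have := qD 0 0; rewrite addr0 lerDl.
Qed.

Lemma sublinear_opp q x : sublinear q -> - q (- x) <= q x.
Proof.
by move=> qs; have := qs.1 x (- x); rewrite subrr (sublinear0 qs) => ?; lra.
Qed.

Lemma sublinearZ q t x : sublinear q -> 0 <= t -> q (ofR k t *: x) = t * q x.
Proof.
move=> qs; rewrite le_eqVlt => /predU1P[<-|t0].
  by rewrite ofR0 scale0r mul0r sublinear0.
apply/eqP; rewrite eq_le qs.2 ?(ltW t0)//= -ler_pdivlMl//.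
apply: le_trans (qs.2 t^-1 _ _); last by rewrite invr_ge0 ltW.
by rewrite scalerA ofRV ?gt_eqF// scale1r.
Qed.

Lemma sublinear_rnorm : sublinear (@rnorm R k Y).
Proof.
split=> [|t x t0]; first exact: rnormD.
by rewrite rnormZ -/(modulus _) modulus_ofR ger0_norm.
Qed.

(* A minimal sublinear [q] satisfies [shave q y = q] for all [y], which makes it
   additive. *)
Definition shave q y x : R :=
  inf [set q (x + ofR k t *: y) - t * q y | t in [set t | 0 <= t]].

Section shave.
Variables (q : Y -> R) (y : Y).
Hypothesis qs : sublinear q.

Let lb x : lbound [set q (x + ofR k t *: y) - t * q y | t in [set t | 0 <= t]] (- q (- x)).
Proof.
move=> _ [t /= t0 <-]; rewrite -(sublinearZ y qs t0).
have := qs.1 (x + ofR k t *: y) (- x); rewrite addrAC subrr add0r => ?; lra.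
Qed.

Lemma shave_le x t : 0 <= t -> shave q y x <= q (x + ofR k t *: y) - t * q y.
Proof.
by move=> t0; apply: ge_inf; [exists (- q (- x)); exact: lb|exists t].
Qed.

Lemma shave_ge x c : (forall t, 0 <= t -> c <= q (x + ofR k t *: y) - t * q y) ->
  c <= shave q y x.
Proof.
move=> h; apply: lb_le_inf; first by exists (q (x + ofR k 0 *: y) - 0 * q y), 0 => /=.
by move=> _ [t t0 <-]; exact: h.
Qed.

Lemma shave_le_self x : shave q y x <= q x.
Proof. by have := shave_le x (lexx 0); rewrite ofR0 scale0r addr0 mul0r subr0. Qed.

Lemma shave_opp : shave q y (- y) <= - q y.
Proof.
have := shave_le (- y) ler01.
by rewrite ofR1 scale1r addNr (sublinear0 qs) mul1r sub0r.
Qed.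

Lemma sublinear_shave : sublinear (shave q y).
Proof.
split=> [x1 x2|t x t0].
  rewrite -lerBlDr; apply: shave_ge => s s0; rewrite lerBlDr -lerBlDl.
  apply: shave_ge => t t0; rewrite lerBlDl.
  apply: le_trans (shave_le _ (addr_ge0 s0 t0)) _.
  have -> : x1 + x2 + ofR k (s + t) *: y = (x1 + ofR k s *: y) + (x2 + ofR k t *: y).
    by rewrite ofRD scalerDl addrACA.
  by apply: le_trans (lerB (qs.1 _ _) (lexx _)) _; rewrite mulrDl; lra.
have [->|t_neq0] := eqVneq t 0.
  rewrite mul0r ofR0 scale0r; apply: le_trans (shave_le_self 0) _.
  by rewrite (sublinear0 qs).
have t_gt0 : 0 < t by rewrite lt_def t_neq0.
rewrite -ler_pdivrMl//; apply: shave_ge => s s0; rewrite ler_pdivrMl//.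
apply: le_trans (shave_le _ (mulr_ge0 t0 s0)) _.
rewrite ofRM -scalerA -scalerDr mulrBr mulrA lerB//.
exact: qs.2.
Qed.

End shave.

Lemma minimal_sublinear q : sublinear q -> exists u,
  [/\ sublinear u, forall x, u x <= q x &
      forall r, sublinear r -> (forall x, r x <= u x) -> r = u].
Proof.
move=> qs; pose T := {r : Y -> R | sublinear r /\ forall x, r x <= q x}.
(* The order is reversed: a maximal element of [rel] is a minimal sublinear function. *)
pose rel (r s : T) : bool := `[< forall x, sval s x <= sval r x >].
have [|||A tot|[u [us uq]] umax] := @Zorn T rel.
- by move=> r; apply/asboolP.
- move=> r s t /asboolP rs /asboolP st; apply/asboolP => x.
  exact: le_trans (st x) (rs x).
- move=> [r hr] [s hs] /asboolP/= sr /asboolP/= rs.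
  apply: eq_exist; apply/funext => x; apply/eqP; by rewrite eq_le rs sr.
- have [[s0 As0]|/forallNP none] := pselect (exists s, A s); last first.
    by exists (exist _ q (conj qs (fun x => lexx _))) => s /none.
  (* The infimum is finite since each member of [A] is at least [- q (- x)] at [x]. It is
     subadditive because of any two members of the chain the smaller one can be used for both
     terms. *)
  pose f x := inf [set sval s x | s in A].
  have lbA x : lbound [set sval s x | s in A] (- q (- x)).
    move=> _ [[s [ss sq]] As <-] /=; apply: le_trans (sublinear_opp x ss).
    by rewrite lerN2.
  have f_le s x : A s -> f x <= sval s x.
    by move=> As; apply: ge_inf; [exists (- q (- x)); exact: lbA|exists s].
  have f_ge x c : (forall s, A s -> c <= sval s x) -> c <= f x.
    by move=> h; apply: lb_le_inf; [exists (sval s0 x), s0|move=> _ [s As <-]; exact: h].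
  have fs : sublinear f.
    split=> [x y|t x t0].
      rewrite -lerBlDr; apply: (f_ge) => s As; rewrite lerBlDr -lerBlDl.
      apply: (f_ge) => r Ar; rewrite lerBlDl.
      have [sr|rs] : rel s r \/ rel r s by exact: tot.
        move/asboolP: sr => sr; apply: le_trans (f_le r _ Ar) _.
        by apply: le_trans ((svalP r).1.1 _ _) _; rewrite lerD2r.
      move/asboolP: rs => rs; apply: le_trans (f_le s _ As) _.
      by apply: le_trans ((svalP s).1.1 _ _) _; rewrite lerD2l.
    have [->|t_neq0] := eqVneq t 0.
      rewrite mul0r ofR0 scale0r; apply: le_trans (f_le _ _ As0) _.
      by rewrite (sublinear0 (svalP s0).1).
    have t_gt0 : 0 < t by rewrite lt_def t_neq0.
    rewrite -ler_pdivrMl//; apply: (f_ge) => s As; rewrite ler_pdivrMl//.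
    exact: le_trans (f_le _ _ As) ((svalP s).1.2 _ _ t0).
  have fq x : f x <= q x by exact: le_trans (f_le _ _ As0) ((svalP s0).2 x).
  exists (exist _ f (conj fs fq)) => s As; apply/asboolP => x /=; exact: f_le.
exists u; split=> // r rs ru.
have rq x : r x <= q x by exact: le_trans (ru x) (uq x).
have := umax (exist _ r (conj rs rq)); move=> /(_ _)/(congr1 sval) /= -> //.
exact/asboolP.
Qed.

Lemma minimal_sublinear_additive u : sublinear u ->
  (forall r, sublinear r -> (forall x, r x <= u x) -> r = u) ->
  (forall x y, u (x + y) = u x + u y) /\ forall t x, u (ofR k t *: x) = t * u x.
Proof.
move=> us umin.
have uE y : shave u y = u.
  by apply: umin; [exact: sublinear_shave|move=> x; exact: shave_le_self].
have uD x y : u (x + y) = u x + u y.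
  apply/eqP; rewrite eq_le us.1 /= -lerBrDr.
  by have := @shave_le u y us x 1 ler01; rewrite uE ofR1 scale1r mul1r.
have uN x : u (- x) = - u x.
  by apply/eqP; rewrite -subr_eq0 opprK -uD addNr (sublinear0 us).
have uZ t x : 0 <= t -> u (ofR k t *: x) = t * u x.
  move=> t0; apply/eqP; rewrite eq_le us.2//=.
  by have := us.2 t (- x) t0; rewrite scalerN !uN mulrN lerN2.
split=> // t x; have [t0|t0] := leP 0 t; first exact: uZ.
have := uZ (- t) x; rewrite ofRN scaleNr uN mulNr => h.
by apply: oppr_inj; apply: h; rewrite oppr_ge0 ltW.
Qed.

End hahn_banach.

(** A complex linear functional is recovered from its real part [u] as [u y - i u (i y)]. *)
Lemma real_part_functional (R : realType) (k : scalar_kind) (Y : normedModType (scalars R k))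
    (u : Y -> R) :
  (forall x y, u (x + y) = u x + u y) -> (forall t x, u (ofR k t *: x) = t * u x) ->
  exists g : Y -> scalars R k,
    (forall a x y, g (a *: x + y) = a * g x + g y) /\ forall y, toR (g y) = u y.
Proof.
case: k Y u => /= Y u uD uZ.
  by exists u; split=> // a x y; rewrite uD uZ.
pose g y : R[i] := (u y -i* u ('i%C *: y))%C.
exists g; split=> // a x y.
have uN x' : u (- x') = - u x'.
  by have := uZ (- 1) x'; rewrite /ofR /= (rmorphN (real_complex R)) rmorph1 scaleN1r mulN1r.
case: a => a b.
have aE : (a +i* b)%C = a%:C%C + b%:C%C * 'i%C :> R[i].
  by simpc.
have key z : u ((a +i* b)%C *: z) = a * u z + b * u ('i%C *: z).
  by rewrite aE scalerDl uD -scalerA !uZ.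
have key' z : u ('i%C *: ((a +i* b)%C *: z)) = a * u ('i%C *: z) - b * u z.
  rewrite scalerA mulrC -scalerA key; congr (_ + _).
  rewrite scalerA (_ : 'i%C * 'i%C = - 1 :> R[i]); last by rewrite -expr2 sqr_i.
  by rewrite scaleN1r uN mulrN.
rewrite /g scalerDr !uD key key'.
by apply/eqP; rewrite eq_complex /=; apply/andP; split; apply/eqP; ring.
Qed.

Lemma unit_rotation (R : realType) (k : scalar_kind) (a : scalars R k) :
  exists2 c : scalars R k, modulus c = 1 & toR (c * a) = modulus a.
Proof.
have [->|a0] := eqVneq a 0.
  exists 1; first by rewrite -(ofR1 R k) modulus_ofR normr1.
  by rewrite mulr0 modulus0 -(ofR0 R k) ofRK.
case: k a a0 => /= a a0.
  exists (Num.sg a); last by rewrite -normrEsg.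
  by rewrite /modulus /= normr_sg a0.
case: a a0 => x y; rewrite eq_complex /= => xy0.
have n0 : 0 < x ^+ 2 + y ^+ 2.
  rewrite lt_neqAle addr_ge0 ?sqr_ge0// andbT eq_sym paddr_eq0 ?sqr_ge0//.
  by rewrite !sqrf_eq0.
pose n := Num.sqrt (x ^+ 2 + y ^+ 2).
have n_gt0 : 0 < n by rewrite sqrtr_gt0.
have nE : x ^+ 2 + y ^+ 2 = n ^+ 2 by rewrite sqr_sqrtr// ltW.
(* The conjugate of [a / |a|]. *)
exists (x / n -i* (y / n))%C.
  rewrite [LHS]modulus_complex sqrrN !expr_div_n -mulrDl nE divff ?sqrtr1//.
  by rewrite sqrf_eq0 gt_eqF.
rewrite [RHS]modulus_complex -/n /= mulNr opprK.
transitivity ((x ^+ 2 + y ^+ 2) / n); first by rewrite mulrDl !expr2; ring.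
by rewrite nE expr2 mulfK// gt_eqF.
Qed.

Lemma toR_le_modulus (R : realType) (k : scalar_kind) (a : scalars R k) :
  toR a <= modulus a.
Proof.
rewrite /modulus; case: k a => /= [a|[a b]] /=; first exact: ler_norm.
by apply: le_trans (ler_norm a) _; rewrite -sqrtr_sqr ler_wsqrtr// lerDl sqr_ge0.
Qed.

Section norming.
Variables (R : realType) (k : scalar_kind) (Y : normedModType (scalars R k)).

(** Shaving the norm along [y] gives a sublinear function whose value at [- y] is at most [- |y|].
    An additive [u] below it satisfies [u y = - u (- y) >= |y|], and is still below the norm. *)
Theorem hahn_banach_norming (y : Y) :
  exists2 g : dual Y, dual_ball g & rnorm y <= modulus (g y).
Proof.
have [u [us uq umin]] := minimal_sublinear (sublinear_shave y (sublinear_rnorm Y)).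
have [uD uZ] := minimal_sublinear_additive us umin.
have un x : u x <= rnorm x by exact: le_trans (uq x) (shave_le_self y (sublinear_rnorm Y) x).
have [g [gl gu]] := real_part_functional uD uZ.
have lg : linear (g : Y -> (scalars R k)^o) by [].
have gb x : modulus (g x) <= rnorm x.
  have [c c1 <-] := unit_rotation (g x).
  have -> : c * g x = g (c *: x).
    have g0 : g 0 = 0 by have := gl (- 1) 0 0; rewrite scaler0 addr0 mulN1r addNr.
    by have := gl c x 0; rewrite addr0 g0 addr0.
  by rewrite gu; apply: le_trans (un _) _; rewrite rnormZ -/(modulus c) c1 mul1r.
have gb1 x : rnorm (g x : (scalars R k)^o) <= 1 * rnorm x by rewrite mul1r; exact: gb.
exists (bop_of lg gb1); first exact/dual_ballP.
have uN : u (- y) = - u y.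
  by apply/eqP; rewrite -subr_eq0 opprK -uD addNr (sublinear0 us).
apply: (@le_trans _ _ (u y)).
  rewrite -lerN2 -uN; apply: le_trans (uq _) _; exact: shave_opp (sublinear_rnorm Y).
by rewrite -gu toR_le_modulus.
Qed.

End norming.

(** * Adjoint images of the dual ball *)

Section adjoint_ball.
Variables (R : realType) (k : scalar_kind).
Local Notation K := (scalars R k).
Variables (X Y : normedModType K) (A : bop X Y).

Definition adjoint_ball : set (dual X) := adjoint A @` @dual_ball R k Y.

Lemma adjoint_ball_compact : compact (adjoint_ball : set (weak_star X)).
Proof.
apply: (@continuous_compact (weak_star Y) (weak_star X)); last exact: dual_ball_compact.
exact/continuous_subspaceT/adjoint_weak_star_continuous.
Qed.

Lemma adjoint_ball_closed : closed (adjoint_ball : set (weak_star X)).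
Proof. exact: compact_closed (@weak_star_hausdorff R k X) adjoint_ball_compact. Qed.

Lemma adjoint_ball_comb (a b : R) f g : 0 <= a -> 0 <= b -> a + b <= 1 ->
  adjoint_ball f -> adjoint_ball g -> adjoint_ball (dual_comb (ofR k a) (ofR k b) f g).
Proof.
move=> a0 b0 ab [f' /dual_ballP hf <-] [g' /dual_ballP hg <-].
exists (dual_comb (ofR k a) (ofR k b) f' g').
  apply/dual_ballP => y; rewrite dual_combE; apply: le_trans (modulusD _ _) _.
  rewrite !modulusM !modulus_ofR !ger0_norm//.
  apply: (@le_trans _ _ (a * rnorm y + b * rnorm y)).
    by apply: lerD; rewrite ler_wpM2l.
  by rewrite -mulrDl ler_piMl// rnorm_ge0.
exact: bop_ext.
Qed.

Lemma adjoint_ball_mid f g : adjoint_ball f -> adjoint_ball g -> adjoint_ball (dual_mid f g).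
Proof. by apply: adjoint_ball_comb; rewrite ?invr_ge0// [leRHS]splitr -mulr2n -mulr_natr; lra. Qed.

Lemma adjoint_ball0 : adjoint_ball (dual_zero X).
Proof.
exists (dual_zero Y); last exact: bop_ext.
by apply/dual_ballP => y; rewrite [leLHS](modulus0 R k) rnorm_ge0.
Qed.

(** The Hahn-Banach theorem enters here: bounds that are uniform on K_A become norm bounds in
    [Y]. *)
Lemma rnorm_adjoint_ball x (c : R) :
  (forall f, adjoint_ball f -> modulus (f x) <= c) -> rnorm (A x) <= c.
Proof.
move=> h; have [g gb gx] := hahn_banach_norming (A x).
by apply: le_trans gx _; apply: (h (adjoint A g)); exists g.
Qed.

(* A finite cover is avoided: norm-smallness of the derivatives makes the
   functionals of K_A uniformly Cauchy along every ultrafilter on the ball. *)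
Lemma szlenk_derivative_ultra (U : set_system X) : UltraFilter U -> U (@unit_ball R k X) ->
  (forall e : R, 0 < e -> szlenk_derivative e adjoint_ball = set0) ->
  forall e : R, 0 < e -> exists2 P, U P &
    forall x x', P x -> P x' -> rnorm (A x - A x') <= e.
Proof.
move=> UU UB small e e0; have e4 : 0 < e / 4 by rewrite divr_gt0.
have := proj1 (compact_near_coveringP _) adjoint_ball_compact.
move/near_covering_withinP => cover.
pose small_on (P : set X) (f : dual X) :=
  forall x x', P x -> P x' -> modulus (f x - f x') <= e.
(* Near [f] the points of K_A are within [e / 4] of [f], and on a member of [U] the values of [f]
   are within [e / 4] of their limit; four such steps make [e]. The near-covering form of
   compactness merges the local choices of members of [U] into one. *)
have near_small f : adjoint_ball f -> \forall f' \near (f : weak_star X) &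
    P \near powerset_filter_from U, adjoint_ball f' -> small_on P f'.
  move=> Kf.
  have [V nV dV] : exists2 V : set (dual X), nbhs (f : weak_star X) V &
      forall g, V g -> adjoint_ball g -> ~ separated (e / 4) g f.
    have [//|/forallNP none] := pselect (exists V : set (dual X), nbhs (f : weak_star X) V /\
      forall g, V g -> adjoint_ball g -> ~ separated (e / 4) g f); first by case=> V []; exists V.
    have : szlenk_derivative (e / 4) adjoint_ball f.
      apply/szlenk_derivativeP; split=> // V nV; apply/not_existsP => no.
      apply: (none V); split=> // g Vg Kg sep; apply: (no g); exists f; split=> //.
      by split=> //; exact: nbhs_singleton nV.
    by rewrite small.
  have [C C0 Cf] := bop_bounded f.
  have [|a fa] := @ultra_bounded_cvg R k X U f C UU.
    apply: filterS UB => x x1; apply: le_trans (Cf x) _.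
    by rewrite ler_piMr.
  have Pa : U ([set x | modulus (a - f x) < e / 4] `&` @unit_ball R k X).
    apply: filterI => //.
    exact: (proj1 (@rnorm_cvgP R k (K^o) _ U f a _) fa _ e4).
  exists (V, [set P | P `<=` [set x | modulus (a - f x) < e / 4] `&` @unit_ball R k X]).
    by split=> //=; exact: small_set_sub Pa.
  move=> [g P] [/= Vg PP] Kg x x' /PP[/= ax x1] /PP[/= ax' x1'].
  have gf z : rnorm z <= 1 -> modulus (g z - f z) <= e / 4.
    by move=> z1; rewrite leNgt; apply/negP => h; apply: (dV g Vg Kg); exists z.
  have -> : g x - g x' = ((g x - f x) - (a - f x)) + ((a - f x') - (g x' - f x')) by ring.
  apply: le_trans (modulusD _ _) _.
  have := le_trans (modulusD (g x - f x) (- (a - f x))) (lerD (gf x x1) (lexx _)).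
  have := le_trans (modulusD (a - f x') (- (g x' - f x'))) (lerD (lexx _) (lexx _)).
  by rewrite !modulusN; have := gf x' x1'; lra.
have cv := cover _ _ (fun P f => small_on P f) (powerset_filter_from_filter _) near_small.
have [P UP PK] : exists2 P, U P & adjoint_ball `<=` small_on P.
  apply/near_powerset_filter_fromP; last exact: cv.
  by move=> P Q PQ h f Kf x x' /PQ Qx /PQ Qx'; exact: h.
exists P => // x x' Px Px'; rewrite -raddfB; apply: rnorm_adjoint_ball => f Kf.
by rewrite raddfB; exact: PK.
Qed.

End adjoint_ball.

(** A filter on the closure of the image is lifted to the ball. Along an ultrafilter refining the
    lift, the image is Cauchy by the previous lemma; its limit in the complete space [Y] is a
    cluster point of the filter. *)
Lemma compact_operator_szlenk (R : realType) (k : scalar_kind)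
    (X : normedModType (scalars R k)) (Y : completeNormedModType (scalars R k))
    (A : bop X Y) :
  (forall e : R, 0 < e -> szlenk_derivative e (adjoint_ball A) = set0) -> compact_operator A.
Proof.
move=> small; rewrite /compact_operator precompactE => G FG Gcl.
(* Members of [G] may miss the image itself, since [G] lives on its closure; they are enlarged by
   [e] before being pulled back. *)
pose near_G (W : set Y) (e : R) :=
  [set x | rnorm x <= 1 /\ exists2 w, W w & rnorm (A x - w) < e].
pose H : set_system X := [set B | exists W e, [/\ G W, 0 < e & near_G W e `<=` B]].
have HF : ProperFilter H.
  apply: Build_ProperFilter_ex.
    move=> B [W [e [GW e0 WB]]].
    have GW' : G (W `&` closure (A @` @unit_ball R k X)) by exact: filterI.
    have [w [Ww clw]] := filter_ex GW'.
    have [|_ [[x x1 <-] /= xw]] := clw [set y | rnorm (w - y) < e].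
      by apply/rnorm_nbhsP; exists e.
    by exists x; apply: WB; split=> //; exists w => //; rewrite rnormB.
  split.
  - by exists setT, 1; split=> //; exact: filterT.
  - move=> B C [W [e [GW e0 WB]]] [V [d [GV d0 VC]]].
    exists (W `&` V), (Num.min e d); split; first exact: filterI.
      by rewrite lt_min e0.
    move=> x [x1 [w [Ww Vw]]]; rewrite lt_min => /andP[xe xd].
    by split; [apply: WB|apply: VC]; split=> //; exists w.
  - by move=> B C BC [W [e [GW e0 WB]]]; exists W, e; split=> //; exact: subset_trans BC.
have [U [UU HU]] := ultraFilterLemma HF.
have UB : U (@unit_ball R k X).
  by apply: HU; exists setT, 1; split=> //; [exact: filterT|move=> x []].
have Uc := szlenk_derivative_ultra UU UB small.
have /cvg_ex[y Uy] : cvg (A @ U).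
  apply/cauchy_cvgP/cauchy_ballP => e e0.
  have [|P UP PA] := Uc (toR e / 2); first by rewrite divr_gt0// toR_gt0.
  have UAP : U (A @^-1` (A @` P)) by apply: filterS UP => x Px; exists x.
  exists (A @` P, A @` P) => //=.
  move=> [_ _] [/= [x Px <-] [x' Px' <-]]; rewrite -ball_normE /= -toR_lt ?(ltW e0)//.
  apply: le_lt_trans (PA x x' Px Px') _.
  by rewrite ltr_pdivrMr// ltr_pMr ?toR_gt0// ltr1n.
have yclu : cluster G y.
  move=> W V GW /rnorm_nbhsP[e e0 eV]; have e2 : 0 < e / 2 by rewrite divr_gt0.
  have U1 : U (near_G W (e / 2)) by apply: HU; exists W, (e / 2); split.
  have U2 : U [set x | rnorm (y - A x) < e / 2].
    exact: (proj1 (@rnorm_cvgP R k Y _ U A y _) Uy _ e2).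
  have U12 : U (near_G W (e / 2) `&` [set x | rnorm (y - A x) < e / 2]) by exact: filterI.
  have [x [[x1 [w Ww xw]] /= yx]] := filter_ex U12.
  exists w; split=> //; apply: eV; rewrite [e]splitr.
  have -> : y - w = (y - A x) + (A x - w) by rewrite addrA subrK.
  by apply: le_lt_trans (rnormD _ _) _; exact: ltrD.
exists y; split=> //.
by apply: closed_closure => V /(yclu _ _ Gcl).
Qed.
(** * Direct sums *)

Section exponents.
Variables (R : realType) (p : R) (hp : p = 0 \/ 1 < p).

(** The dual of the c_0 sum is an l_1 sum, hence the value 1 at [p = 0]. *)
Definition conj_exp : R := if p == 0 then 1 else p / (p - 1).
Local Notation q := conj_exp.

Let p1 : p != 0 -> 1 < p.
Proof. by case: hp => [->|//]; rewrite eqxx. Qed.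

Lemma conj_exp_ge1 : 1 <= q.
Proof.
rewrite /q; case: eqVneq => // /p1 h.
by rewrite ler_pdivlMr ?subr_gt0// mul1r gerBl.
Qed.

Lemma conj_exp_gt0 : 0 < q.
Proof. exact: lt_le_trans ltr01 conj_exp_ge1. Qed.

Lemma conj_exp_inv : p != 0 -> p^-1 + q^-1 = 1.
Proof.
move=> p0; have h := p1 p0; rewrite /q (negbTE p0).
by field; rewrite p0 subr_eq0 gt_eqF.
Qed.

Lemma conj_exp_mul : p != 0 -> (q - 1) * p = q.
Proof.
move=> p0; have h := p1 p0; rewrite /q (negbTE p0).
by field; rewrite subr_eq0 gt_eqF.
Qed.

Variable L : choiceType.
Implicit Types (s : seq L) (a d : L -> R).

(* The l_p or c_0 norm of the restriction of [a] to [s] is at most [t]. *)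
Definition seq_bound s a (t : R) : Prop :=
  if p == 0 then forall l, l \in s -> a l <= t else \sum_(l <- s) a l `^ p <= t `^ p.

(** Young's inequality for [d l / t] and [a l], whose powers sum to at most 1. *)
Lemma holder s a d (t : R) : (forall l, 0 <= a l) -> (forall l, 0 <= d l) -> 0 < t ->
  seq_bound s a 1 -> \sum_(l <- s) d l `^ q <= t `^ q -> \sum_(l <- s) d l * a l <= t.
Proof.
move=> a0 d0 t0; rewrite /seq_bound; case: eqVneq => [pz|pn] ba dt.
  have q1 : q = 1 by rewrite /q pz eqxx.
  move: dt; rewrite q1 powRr1 ?(ltW t0)//; apply: le_trans.
  rewrite big_seq [leRHS]big_seq; apply: ler_sum => l /ba al.
  by rewrite powRr1// ler_piMr.
have -> : \sum_(l <- s) d l * a l = t * \sum_(l <- s) d l / t * a l.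
  by rewrite mulr_sumr; apply: eq_bigr => l _; field; rewrite gt_eqF.
rewrite -[leRHS]mulr1 ler_pM2l//.
have p0 : 0 < p by exact: lt_trans (p1 pn).
apply: (@le_trans _ _ (\sum_(l <- s) ((d l / t) `^ q / q + a l `^ p / p))).
  apply: ler_sum => l _; apply: conjugate_powR => //; rewrite ?conj_exp_gt0//.
    by rewrite divr_ge0// ltW.
  by rewrite addrC conj_exp_inv.
rewrite big_split /= -!mulr_suml -(conj_exp_inv pn) addrC.
apply: lerD.
  by rewrite -[leRHS]mul1r ler_wpM2r ?invr_ge0 ?(ltW p0)//; rewrite powR1 in ba.
rewrite -[leRHS]mul1r ler_wpM2r ?invr_ge0 ?(ltW conj_exp_gt0)//.
have -> : \sum_(l <- s) (d l / t) `^ q = (\sum_(l <- s) d l `^ q) * t^-1 `^ q.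
  by rewrite mulr_suml; apply: eq_bigr => l _; rewrite powRM// invr_ge0 ltW.
apply: le_trans (ler_wpM2r (powR_ge0 _ _) dt) _.
by rewrite -powRM ?invr_ge0 ?(ltW t0)// mulfV ?gt_eqF// powR1.
Qed.

(** The test vector is the extremal one of Hoelder's inequality, [d l ^ (q - 1)] normalized in l_p;
    for [p = 0] it is the constant 1. *)
Lemma dual_holder s d : (forall l, 0 <= d l) ->
  (forall a, (forall l, 0 <= a l) -> seq_bound s a 1 -> \sum_(l <- s) d l * a l <= 1) ->
  \sum_(l <- s) d l `^ q <= 1.
Proof.
move=> d0 h; have [pz|pn] := eqVneq p 0.
  have q1 : q = 1 by rewrite /q pz eqxx.
  have := h (fun=> 1) (fun=> ler01); rewrite /seq_bound pz eqxx.
  under eq_bigr do rewrite mulr1.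
  under [in X in _ -> X]eq_bigr do rewrite q1 powRr1//.
  by apply.
set T := \sum_(l <- s) _; rewrite leNgt; apply/negP => T1.
have T0 : 0 < T by exact: lt_trans ltr01 T1.
have p0 : 0 < p by exact: lt_trans (p1 pn).
have q0 := conj_exp_gt0.
pose c := T `^ (- p^-1).
have := h (fun l => c * d l `^ (q - 1)); rewrite /seq_bound (negbTE pn).
have -> : \sum_(l <- s) (c * d l `^ (q - 1)) `^ p = 1.
  transitivity (\sum_(l <- s) T^-1 * d l `^ q).
    apply: eq_bigr => l _; rewrite powRM ?powR_ge0// -!powRrM conj_exp_mul// mulNr mulVf//.
    by rewrite powR_inv1// ltW.
  by rewrite -mulr_sumr mulVf// gt_eqF.
rewrite powR1 => /(_ (fun l => mulr_ge0 (powR_ge0 _ _) (powR_ge0 _ _)) (lexx _)).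
have -> : \sum_(l <- s) d l * (c * d l `^ (q - 1)) = c * T.
  rewrite mulr_sumr; apply: eq_bigr => l _; rewrite mulrCA; congr (_ * _).
  have [->|dl] := eqVneq (d l) 0; first by rewrite mul0r powR0// gt_eqF.
  rewrite -{1}(powRr1 (d0 l)) -powRD; last by rewrite dl implybT.
  by rewrite addrC subrK.
rewrite leNgt => /negP; apply.
have -> : c * T = T `^ q^-1.
  rewrite -[X in c * X](powRr1 (ltW T0)) /c -powRD; last by rewrite (gt_eqF T0) implybT.
  by rewrite -(conj_exp_inv pn) addrA addNr add0r.
have := @gt0_ltr_powR _ q^-1; rewrite invr_gt0 => /(_ q0 1 T).
by rewrite powR1; apply => //; rewrite nnegrE ltW.
Qed.

Lemma sum_seq_sub s r (F : L -> R) : uniq s -> uniq r -> (forall l, 0 <= F l) ->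
  (forall l, l \in s -> l \notin r -> F l = 0) -> \sum_(l <- s) F l <= \sum_(l <- r) F l.
Proof.
move=> us ur F0 Fz.
rewrite (bigID (mem r)) /= [X in _ + X]big1_seq ?addr0; last first.
  by move=> l /andP[lr ls]; exact: Fz.
rewrite [leRHS](bigID (mem s)) /= -[leLHS]addr0; apply: lerD; last exact: sumr_ge0.
rewrite -big_filter -[leRHS]big_filter (perm_big [seq l <- r | l \in s])//.
apply: uniq_perm; rewrite ?filter_uniq// => l; by rewrite !mem_filter andbC.
Qed.

End exponents.

(** * Norms of functionals as real numbers *)

Section dual_norms.
Variables (R : realType) (k : scalar_kind).
Local Notation K := (scalars R k).
Implicit Types X Y : normedModType K.

Definition dnorm X (f : dual X) : R := sup [set modulus (f x) | x in @unit_ball R k X].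

Lemma dnorm_has_sup X (f : dual X) : has_sup [set modulus (f x) | x in @unit_ball R k X].
Proof.
have [C C0 Cf] := bop_bounded f; split.
  by exists (modulus (f 0)), 0 => //; rewrite /unit_ball /= rnorm0.
by exists C => _ [x x1 <-]; apply: le_trans (Cf x) _; rewrite ler_piMr.
Qed.

Lemma dnorm_unit X (f : dual X) x : rnorm x <= 1 -> modulus (f x) <= dnorm f.
Proof. by move=> x1; apply: ub_le_sup; [exact: (dnorm_has_sup f).2|exists x]. Qed.

Lemma dnorm_ge0 X (f : dual X) : 0 <= dnorm f.
Proof. by apply: le_trans (modulus_ge0 (f 0)) (dnorm_unit _ _); rewrite rnorm0. Qed.

Lemma dnorm_le X (f : dual X) (c : R) :
  (forall x, rnorm x <= 1 -> modulus (f x) <= c) -> dnorm f <= c.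
Proof. by move=> h; apply: ge_sup; [exact: (dnorm_has_sup f).1|move=> _ [x x1 <-]; exact: h]. Qed.

Lemma dnorm_approx X (f : dual X) (c : R) : c < dnorm f ->
  exists2 x, rnorm x <= 1 & c < modulus (f x).
Proof.
move=> /(sup_gt (dnorm_has_sup f).1)[_ [x x1 <-] cx]; by exists x.
Qed.

Lemma unit_bound X (f : dual X) (c : R) : 
  (forall x, rnorm x <= 1 -> modulus (f x) <= c) -> forall x, modulus (f x) <= c * rnorm x.
Proof.
move=> h x; have [x0|x0] := eqVneq (rnorm x) 0.
  by rewrite (rnorm_eq0 x0) raddf0 modulus0 rnorm0 mulr0.
have x_gt0 : 0 < rnorm x by rewrite lt_def x0 rnorm_ge0.
have := h (ofR k (rnorm x)^-1 *: x).
rewrite rnormZ -/(modulus _) modulus_ofR ger0_norm ?invr_ge0 ?rnorm_ge0// mulVf//.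
rewrite lexx linearZ modulusM modulus_ofR ger0_norm ?invr_ge0 ?rnorm_ge0// => /(_ isT).
by rewrite mulrC ler_pdivrMr.
Qed.

Lemma dnorm_bound X (f : dual X) x : modulus (f x) <= dnorm f * rnorm x.
Proof. by apply: unit_bound => y; exact: dnorm_unit. Qed.

Lemma dual_ball_unit X (f : dual X) :
  (forall x, rnorm x <= 1 -> modulus (f x) <= 1) -> dual_ball f.
Proof. by move=> h; apply/dual_ballP => x; rewrite -[leRHS]mul1r; exact: unit_bound. Qed.

End dual_norms.

(** * Coordinates and finite truncations in a direct sum *)

Section direct_sum_geometry.
Variables (R : realType) (k : scalar_kind) (p : R) (hp : p = 0 \/ 1 < p) (L : choiceType).
Local Notation K := (scalars R k).
Variable X : L -> normedModType K.
Local Notation S := (dsum hp X).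
Implicit Types (z : S) (s : seq L) (x : forall l, X l).

Let p1 : p != 0 -> 1 < p.
Proof. by case: hp => [->|//]; rewrite eqxx. Qed.

Lemma dsum_seq_bound z (t : R) s : rnorm z <= t -> uniq s ->
  seq_bound p s (fun l => rnorm (z l)) t.
Proof.
rewrite rnorm_dsum => zt us.
have n0 := dsum_norm_ge0 (dsum_coordP z).
have := dsum_bound_weak hp n0 zt (dsum_bound_norm (dsum_coordP z)).
rewrite /dsum_bound /seq_bound; case: eqVneq => [_ h l _|p0]; first exact: h.
by move=> /psum_le/(_ [set` s] (finite_seq s)); rewrite -fsbig_seq.
Qed.

Lemma dsum_coordD z z' l : (z + z') l = z l + z' l.
Proof. by []. Qed.

Lemma dsum_coordB z z' l : (z - z') l = z l - z' l.
Proof. by []. Qed.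

Lemma dsum_coord_sum (I : Type) (r : seq I) (F : I -> S) l :
  (\sum_(i <- r) F i) l = \sum_(i <- r) F i l.
Proof. by elim: r => [|i r IH]; rewrite ?big_nil ?big_cons// dsum_coordD IH. Qed.

Lemma dsum_inj_eq l (v : X l) : dsum_inj hp v l = v.
Proof. exact: dfwithin. Qed.

Lemma dsum_inj_neq l m (v : X l) : l != m -> dsum_inj hp v m = 0.
Proof. by move=> lm; exact: dfwithout. Qed.

(** The family is arbitrary, since its finite truncations lie in the direct sum in any case; test
    vectors are built this way. *)
Definition dtrunc s x : S := \sum_(l <- s) dsum_inj hp (x l).

Lemma dtruncE s x l : uniq s -> dtrunc s x l = if l \in s then x l else 0.
Proof.
rewrite dsum_coord_sum; elim: s => [|m s IH]; first by rewrite big_nil.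
rewrite cons_uniq big_cons inE => /andP[ms /IH ->].
have [lm|lm] := eqVneq l m; last by rewrite dsum_inj_neq ?add0r// eq_sym.
by subst m; rewrite dsum_inj_eq (negbTE ms) addr0.
Qed.

Lemma dsum_rnorm_le z (t : R) : 0 <= t ->
  (forall s, uniq s -> seq_bound p s (fun l => rnorm (z l)) t) -> rnorm z <= t.
Proof.
move=> t0 h; rewrite rnorm_dsum; apply: (dsum_norm_le hp t0).
move: h; rewrite /dsum_bound /seq_bound; case: eqVneq => [_ h l|p0 h].
  exact: (h [:: l]) _ (mem_head _ _).
by apply/psum_le => A fA; rewrite fsbig_finite//; exact: h.
Qed.

Lemma dtrunc_norm s x (t : R) : uniq s -> 0 <= t ->
  seq_bound p s (fun l => rnorm (x l)) t -> rnorm (dtrunc s x) <= t.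
Proof.
move=> us t0 h; apply: dsum_rnorm_le => // r ur; move: h; rewrite /seq_bound.
case: eqVneq => [_ h l _|p0 h].
  by rewrite dtruncE//; case: ifP => [/h//|_]; rewrite rnorm0.
apply: le_trans h; apply: (@le_trans _ _ (\sum_(l <- s) rnorm (dtrunc s x l) `^ p)).
  apply: sum_seq_sub => // l; first by rewrite powR_ge0.
  by move=> _ ls; rewrite dtruncE// (negbTE ls) rnorm0 powR0.
by rewrite big_seq [leRHS]big_seq; apply: ler_sum => l ls; rewrite dtruncE// ls.
Qed.

Lemma powR_le_inv (a b : R) : p != 0 -> 0 <= a -> 0 <= b -> a `^ p <= b `^ p -> a <= b.
Proof.
move=> pn a0 b0; rewrite leNgt => h; rewrite leNgt; apply: contra h => ba.
by apply: gt0_ltr_powR => //; apply: lt_trans (p1 pn).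
Qed.

Lemma dsum_coord_norm z l : rnorm (z l) <= rnorm z.
Proof.
have := @dsum_seq_bound z (rnorm z) [:: l] (lexx _) isT; rewrite /seq_bound.
case: eqVneq => [_ h|pn]; first exact: h (mem_head _ _).
by rewrite big_seq1; apply: powR_le_inv; rewrite ?rnorm_ge0.
Qed.

Lemma dsum_inj_norm l (v : X l) : rnorm (dsum_inj hp v) <= rnorm v.
Proof.
have := @dtrunc_norm [:: l] (single v) (rnorm v) isT (rnorm_ge0 v).
have vl : single v l = v by exact: dfwithin.
rewrite /dtrunc big_seq1 vl; apply; rewrite /seq_bound.
case: eqVneq => [_ m|_]; first by rewrite inE => /eqP ->; rewrite vl.
by rewrite big_seq1 vl.
Qed.

Lemma dsum_inj_linear l : linear (@dsum_inj R k L p hp X l).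
Proof.
move=> a u v; apply: dsum_ext => m; have [lm|lm] := eqVneq l m.
  by subst m; rewrite dsum_inj_eq /= -![single _ _]/(dsum_inj hp _ l) !dsum_inj_eq.
rewrite dsum_inj_neq//= -![single _ _]/(dsum_inj hp _ m) !dsum_inj_neq//.
by rewrite scaler0 addr0.
Qed.

Lemma dsum_inj_bounded l (v : X l) : rnorm (dsum_inj hp v) <= 1 * rnorm v.
Proof. by rewrite mul1r dsum_inj_norm. Qed.

Definition inj_op l : bop (X l) S := bop_of (@dsum_inj_linear l) (@dsum_inj_bounded l).

Lemma dsum_proj_linear l : linear (fun z => z l).
Proof. by []. Qed.

Lemma dsum_proj_bounded l z : rnorm (z l) <= 1 * rnorm z.
Proof. by rewrite mul1r dsum_coord_norm. Qed.

Definition proj_op l : bop S (X l) := bop_of (@dsum_proj_linear l) (@dsum_proj_bounded l).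

(** The net of finite truncations converges in norm. This reduces continuous operators and
    functionals on the direct sum to finitely many coordinates. *)
Lemma dtrunc_approx z (e : R) : 0 < e -> exists s, forall r, uniq r -> {subset s <= r} ->
  rnorm (z - dtrunc r z) <= e.
Proof.
move=> e0; have [pz|pn] := eqVneq p 0.
  have : finite_set [set l | e <= rnorm (z l)].
    by have := dsum_coordP z; rewrite /dsum_mem; case: ifPn => [_|/eqP//]; exact.
  move=> /finite_seqP[s sE].
  exists s => r ur sr; apply: dsum_rnorm_le => [|t ut]; first exact: ltW.
  rewrite /seq_bound ifT ?pz// => l _; rewrite dsum_coordB dtruncE//.
  case: ifPn => [_|lr]; first by rewrite subrr rnorm0 ltW.
  rewrite subr0 leNgt; apply/negP => /ltW h.
  have : [set` s] l by rewrite -sE.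
  by move=> /= /sr; rewrite (negbTE lr).
have zoo : (psum p z < +oo)%E.
  by have := dsum_coordP z; rewrite /dsum_mem; case: ifPn => [/eqP pz|//]; case/eqP: pn.
have p0 : 0 < p by exact: lt_trans (p1 pn).
have fz : psum p z \is a fin_num by rewrite ge0_fin_numE ?psum_ge0.
pose F l := rnorm (z l) `^ p.
have F0 l : 0 <= F l by exact: powR_ge0.
have Fle r : uniq r -> \sum_(l <- r) F l <= fine (psum p z).
  move=> ur; have /psum_le/(_ [set` r] (finite_seq r)) : (psum p z <= (fine (psum p z))%:E)%E.
    by rewrite fineK.
  by rewrite -fsbig_seq.
have [s us hs] : exists2 s, uniq s & fine (psum p z) - e `^ p < \sum_(l <- s) F l.
  have [//|none] := pselect (exists2 s, uniq s & fine (psum p z) - e `^ p < \sum_(l <- s) F l).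
  have : (psum p z <= (fine (psum p z) - e `^ p)%:E)%E.
    apply/psum_le => A fA; rewrite fsbig_finite// leNgt; apply/negP => h.
    by apply: none; eexists; last exact: h.
  by rewrite -{1}(fineK fz) lee_fin lerDl oppr_ge0 leNgt powR_gt0.
exists s => r ur sr; apply: dsum_rnorm_le => [|t ut]; first exact: ltW.
rewrite /seq_bound ifF; last exact: negbTE.
pose t' := [seq l <- t | l \notin r].
have -> : \sum_(l <- t) rnorm ((z - dtrunc r z) l) `^ p = \sum_(l <- t') F l.
  rewrite big_filter [RHS]big_mkcond; apply: eq_bigr => l _; rewrite dsum_coordB dtruncE//.
  by case: ifPn => lr; rewrite ?subrr ?rnorm0 ?powR0// subr0.
have urt : uniq (r ++ t').
  rewrite cat_uniq ur filter_uniq// andbT /=; apply/hasPn => l.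
  by rewrite mem_filter => /andP[].
have := Fle _ urt; rewrite big_cat /= => h.
have : \sum_(l <- s) F l <= \sum_(l <- r) F l.
  by apply: sum_seq_sub => // l ls; rewrite sr.
by move: hs h => *; lra.
Qed.

End direct_sum_geometry.

(** * Functionals on a direct sum and the adjoint of a diagonal operator *)

Section diagonal.
Variables (R : realType) (k : scalar_kind) (p : R) (hp : p = 0 \/ 1 < p) (L : choiceType).
Local Notation K := (scalars R k).
Local Notation q := (conj_exp p).
Variables (X Y : L -> normedModType K) (A : forall l, bop (X l) (Y l)).
Variable D : bop (dsum hp X) (dsum hp Y).
Hypothesis hD : forall l (x : X l), D (dsum_inj hp x) = dsum_inj hp (A l x).

Lemma diagonal_dtrunc s (x : forall l, X l) :
  D (dtrunc hp s x) = dtrunc hp s (fun l => A l (x l)).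
Proof. by rewrite /dtrunc raddf_sum; apply: eq_bigr => l _; exact: hD. Qed.

(** [hD] describes [D] on single coordinate subspaces only; boundedness and truncation extend it to
    all of the direct sum. *)
Lemma diagonal_coord (z : dsum hp X) l : D z l = A l (z l).
Proof.
have [C C0 DC] := bop_bounded D; have [B B0 AB] := bop_bounded (A l).
apply/eqP; rewrite -subr_eq0; apply/eqP/rnorm_eq0/eqP.
rewrite eq_le rnorm_ge0 andbT; apply/ler_addgt0Pr => e e0; rewrite add0r.
have CB : 0 < C + B + 1 by rewrite ltr_wpDl// addr_ge0.
have [s hs] := dtrunc_approx z (divr_gt0 e0 CB).
pose r := undup (l :: s).
have ur : uniq r by exact: undup_uniq.
have lr : l \in r by rewrite mem_undup mem_head.
have sr : {subset s <= r} by move=> m ms; rewrite mem_undup inE ms orbT.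
have := hs r ur sr; set w := z - dtrunc hp r z => hw.
have wl : w l = 0 by rewrite dsum_coordB dtruncE// lr subrr.
have -> : D z l - A l (z l) = D w l.
  have -> : D w = D z - dtrunc hp r (fun m => A m (z m)).
    by rewrite -diagonal_dtrunc /w raddfB.
  by rewrite dsum_coordB dtruncE// lr.
apply: le_trans (dsum_coord_norm _ _) _; apply: le_trans (DC w) _.
apply: (@le_trans _ _ ((C + B + 1) * rnorm w)).
  by rewrite ler_wpM2r ?rnorm_ge0//; lra.
by rewrite mulrC -ler_pdivlMr.
Qed.

Definition coord (Z : L -> normedModType K) (y : dual (dsum hp Z)) l : dual (Z l) :=
  adjoint (inj_op hp Z l) y.

Lemma coordE (Z : L -> normedModType K) (y : dual (dsum hp Z)) l v :
  coord y l v = y (dsum_inj hp v).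
Proof. by []. Qed.

Lemma dual_dtrunc (Z : L -> normedModType K) (y : dual (dsum hp Z)) s z :
  y (dtrunc hp s z) = \sum_(l <- s) coord y l (z l).
Proof. by rewrite /dtrunc raddf_sum. Qed.

Lemma coord_adjoint (g : dual (dsum hp Y)) l :
  coord (adjoint D g) l = adjoint (A l) (coord g l).
Proof. by apply: bop_ext => x; rewrite /= hD. Qed.

(** By [dual_holder] it is enough to test against vectors [a]. Almost norming vectors of the
    coordinates, rotated so that [g] has almost maximal real part, are glued with coefficients
    [a l]; the slack [e / (T + 1)] adds up to at most [e]. *)
Lemma dual_ball_coord_sum (g : dual (dsum hp Y)) s : dual_ball g -> uniq s ->
  \sum_(l <- s) dnorm (coord g l) `^ q <= 1.
Proof.
move=> /dual_ballP gb us; apply: (dual_holder hp) => [l|a a0 ba]; first exact: dnorm_ge0.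
apply/ler_addgt0Pr => e e0.
pose T := \sum_(l <- s) a l.
have T0 : 0 <= T by apply: sumr_ge0.
have T1 : 0 < T + 1 by rewrite ltr_wpDl.
have ex l : exists x : Y l, rnorm x <= 1 /\
    dnorm (coord g l) - e / (T + 1) < toR (coord g l x).
  have : dnorm (coord g l) - e / (T + 1) < dnorm (coord g l).
    by rewrite gtrDl oppr_lt0 divr_gt0.
  move=> /dnorm_approx[x x1 hx]; have [c c1 cx] := unit_rotation (coord g l x).
  exists (c *: x); split; first by rewrite rnormZ -/(modulus c) c1 mul1r.
  have -> : coord g l (c *: x) = c * coord g l x by exact: linearZ.
  by rewrite cx.
pose x l := ofR k (a l) *: sval (cid (ex l)).
have x_le l : rnorm (x l) <= a l.
  rewrite /x rnormZ -/(modulus _) modulus_ofR ger0_norm//.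
  by have [v1 _] := svalP (cid (ex l)); rewrite ler_piMr.
have n1 : rnorm (dtrunc hp s x) <= 1.
  apply: dtrunc_norm => //; move: ba; rewrite /seq_bound; case: eqVneq => [_ h l ls|pn].
    exact: le_trans (x_le l) (h l ls).
  apply: le_trans; apply: ler_sum => l _.
  by apply: ge0_ler_powR; rewrite ?nnegrE ?rnorm_ge0// ltW// (lt_trans _ (p_gt1 hp pn)).
have := le_trans (toR_le_modulus _) (le_trans (gb (dtrunc hp s x)) n1).
have toR0 : toR (0 : K) = 0 by rewrite -(ofR0 R k) ofRK.
rewrite dual_dtrunc (big_morph (@toR R k) (@toRD R k) toR0).
move=> h; rewrite -lerBlDr; apply: le_trans h.
apply: (@le_trans _ _ (\sum_(l <- s) (a l * (dnorm (coord g l) - e / (T + 1))))).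
  have -> : \sum_(l <- s) a l * (dnorm (coord g l) - e / (T + 1)) =
      \sum_(l <- s) dnorm (coord g l) * a l - e / (T + 1) * T.
    by rewrite /T mulr_sumr -sumrB; apply: eq_bigr => l _; ring.
  rewrite lerD2l lerN2 mulrAC ler_pdivrMr// ler_wpM2l ?(ltW e0)// lerDl //.
apply: ler_sum => l _.
have -> : coord g l (x l) = ofR k (a l) * coord g l (sval (cid (ex l))) by exact: linearZ.
rewrite toRM ?ofR_ge0// ofRK ler_wpM2l//.
by have [_ /ltW] := svalP (cid (ex l)).
Qed.

Lemma adjoint_ball_proj l u :
  adjoint_ball (A l) u -> adjoint_ball D (adjoint (proj_op hp X l) u).
Proof.
move=> [g /dual_ballP gb <-]; exists (adjoint (proj_op hp Y l) g).
  by apply/dual_ballP => z; apply: le_trans (gb _) _; exact: dsum_coord_norm.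
by apply: bop_ext => z; rewrite /= diagonal_coord.
Qed.

(** Composition with the coordinate projection embeds K_(A l) into K_D and keeps separation, because
    unit vectors of [X l] are unit vectors of the sum. *)
Lemma szlenk_iter_proj (e : R) a l u : szlenk_iter e (adjoint_ball (A l)) a u ->
  szlenk_iter e (adjoint_ball D) a (adjoint (proj_op hp X l) u).
Proof.
apply: szlenk_iter_map => [x|x|f g _ _ [x x1 fg]]; first exact: adjoint_ball_proj.
  exact: adjoint_weak_star_continuous.
exists (dsum_inj hp x); first exact: le_trans (dsum_inj_norm _ _) x1.
by rewrite -[X in modulus X]/(f (dsum_inj hp x l) - g (dsum_inj hp x l)) dsum_inj_eq.
Qed.

Lemma adjoint_ball_coord y l : adjoint_ball D y -> adjoint_ball (A l) (coord y l).
Proof.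
move=> [g /dual_ballP gb <-]; exists (coord g l); last by rewrite coord_adjoint.
by apply/dual_ballP => v; apply: le_trans (gb _) _; exact: dsum_inj_norm.
Qed.

Lemma dual_sum_linear (Z : L -> normedModType K) s (h : forall l, dual (Z l)) :
  linear (fun z : dsum hp Z => \sum_(l <- s) h l (z l) : K^o).
Proof.
move=> a z w; rewrite scaler_sumr -big_split /=; apply: eq_bigr => l _.
by rewrite linearP.
Qed.

Lemma dual_sum_bounded (Z : L -> normedModType K) s (h : forall l, dual (Z l))
    (z : dsum hp Z) :
  rnorm (\sum_(l <- s) h l (z l) : K^o) <= (\sum_(l <- s) dnorm (h l)) * rnorm z.
Proof.
elim: s => [|l s IH]; first by rewrite !big_nil rnorm0 mul0r.
rewrite !big_cons mulrDl; apply: le_trans (rnormD _ _) _; apply: lerD => //.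
apply: le_trans (dnorm_bound _ _) _; apply: ler_wpM2l; first exact: dnorm_ge0.
exact: dsum_coord_norm.
Qed.

Definition dual_sum (Z : L -> normedModType K) s (h : forall l, dual (Z l)) :
  dual (dsum hp Z) := bop_of (dual_sum_linear s h) (dual_sum_bounded s h).

Lemma modulus_sum s (F : L -> K) :
  modulus (\sum_(l <- s) F l) <= \sum_(l <- s) modulus (F l).
Proof.
elim: s => [|l s IH]; first by rewrite !big_nil modulus0.
by rewrite !big_cons; apply: le_trans (modulusD _ _) _; rewrite lerD2l.
Qed.

Lemma dual_sum_ball s (t : L -> R) (h : forall l, dual (Y l)) : uniq s ->
  (forall l, 0 <= t l) -> (forall l, dual_ball (h l)) -> \sum_(l <- s) t l `^ q <= 1 ->
  dual_ball (dual_sum s (fun l => dual_scale (t l) (h l))).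
Proof.
move=> us t0 hb ts; apply: dual_ball_unit => z z1.
apply: le_trans (modulus_sum _ _) _.
apply: (@le_trans _ _ (\sum_(l <- s) t l * rnorm (z l))).
  apply: ler_sum => l _; rewrite dual_scaleE modulusM modulus_ofR ger0_norm//.
  by rewrite ler_wpM2l//; exact: (proj1 (dual_ballP _) (hb l)).
apply: (holder hp) => //; first by move=> l; exact: rnorm_ge0.
  exact: dsum_seq_bound.
by rewrite powR1.
Qed.

(** Only finite sums of the preimages [g l] are formed. Hoelder's inequality puts them in the dual
    ball after division by [r], their images converge weak* to [x / r] by truncation, and K_D is
    weak* closed. *)
Lemma adjoint_ball_reassemble (x : dual (dsum hp X)) (t : L -> R) (r : R) : 0 < r ->
  (forall l, 0 <= t l) ->
  (forall l, exists2 u, adjoint_ball (A l) u & coord x l = dual_scale (t l) u) ->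
  (forall s, uniq s -> \sum_(l <- s) t l `^ q <= r `^ q) ->
  exists2 u, adjoint_ball D u & x = dual_scale r u.
Proof.
move=> r0 t0 hx ts.
have hx' l : exists g : dual (Y l), dual_ball g /\ coord x l = dual_scale (t l) (adjoint (A l) g).
  by case: (hx l) => _ [g gb <-] xl; exists g.
pose g l := sval (cid (hx' l)).
have gb l : dual_ball (g l) := (svalP (cid (hx' l))).1.
have xg l : coord x l = dual_scale (t l) (adjoint (A l) (g l)) := (svalP (cid (hx' l))).2.
pose v s := adjoint D (dual_sum s (fun l => dual_scale (t l / r) (g l))).
have vK s : uniq s -> adjoint_ball D (v s).
  move=> us; eexists; last reflexivity; apply: dual_sum_ball => // [l|].
    by rewrite divr_ge0// ltW.
  have -> : \sum_(l <- s) (t l / r) `^ q = (\sum_(l <- s) t l `^ q) * r^-1 `^ q.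
    by rewrite mulr_suml; apply: eq_bigr => l _; rewrite powRM// invr_ge0 ltW.
  apply: le_trans (ler_wpM2r (powR_ge0 _ _) (ts s us)) _.
  by rewrite -powRM ?invr_ge0 ?(ltW r0)// mulfV ?gt_eqF// powR1.
have vx s z : dual_scale r (v s) z = x (dtrunc hp s z).
  rewrite dual_dtrunc dual_scaleE.
  have -> : v s z = \sum_(l <- s) dual_scale (t l / r) (g l) (D z l) by [].
  rewrite mulr_sumr; apply: eq_bigr => l _; rewrite xg !dual_scaleE diagonal_coord.
  by rewrite mulrA -ofRM; congr (ofR k _ * _); rewrite mulrC divfK// gt_eqF.
(* The filter of the net of finite sets of coordinates, ordered by inclusion. *)
pose F : set_system (weak_star (dsum hp X)) := [set B | exists s : seq L, forall r', uniq r' ->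
  {subset s <= r'} -> B (v r')].
have FF : ProperFilter F.
  apply: Build_ProperFilter_ex.
    move=> B [s Bs]; exists (v (undup s)); apply: Bs; first exact: undup_uniq.
    by move=> l; rewrite mem_undup.
  split; first by exists [::].
    move=> B C [s Bs] [s' Cs']; exists (s ++ s') => r' ur' sr'; split.
      by apply: Bs => // l ls; apply: sr'; rewrite mem_cat ls.
    by apply: Cs' => // l ls; apply: sr'; rewrite mem_cat ls orbT.
  by move=> B C BC [s Bs]; exists s => r' ur' sr'; exact/BC/Bs.
exists (dual_scale r^-1 x); last by rewrite dual_scaleA mulfV ?gt_eqF// dual_scale1.
have Fx : F --> (dual_scale r^-1 x : weak_star (dsum hp X)).
  apply/weak_star_cvgP => z e e0.
  have [C C0 xC] := bop_bounded x.
  have C1 : 0 < C + 1 by rewrite ltr_wpDl.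
  have re2 : 0 < r * e / 2 by rewrite divr_gt0// mulr_gt0.
  have [s hs] := dtrunc_approx z (divr_gt0 re2 C1).
  exists s => r' ur' sr'.
  suff : modulus (dual_scale r^-1 x z - v r' z) < e by [].
  have -> : v r' z = ofR k r^-1 * x (dtrunc hp r' z).
    by rewrite -vx dual_scaleE mulrA -ofRM mulVf ?gt_eqF// ofR1 mul1r.
  rewrite dual_scaleE -mulrBr -raddfB modulusM modulus_ofR gtr0_norm ?invr_gt0//.
  rewrite mulrC ltr_pdivrMr// [e * r]mulrC.
  have := hs r' ur' sr'; rewrite ler_pdivlMr// => h.
  apply: le_lt_trans (xC _) _; apply: le_lt_trans (_ : _ <= r * e / 2) _; last first.
    by rewrite ltr_pdivrMr// ltr_pMr ?ltr1n// mulr_gt0.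
  by apply: le_trans h; rewrite mulrC ler_wpM2l ?rnorm_ge0// lerDl.
have clK := @adjoint_ball_closed R k _ _ D.
apply: clK => V /Fx FV.
have FK : F (adjoint_ball D) by exists [::] => s us _; exact: vK.
have FKV : F (adjoint_ball D `&` V) by exact: filterI.
exact: filter_ex FKV.
Qed.

End diagonal.
(** * Ranks of the coordinates *)

Section ranks.
Variables (R : realType) (k : scalar_kind) (X : normedModType (scalars R k)).
Variables (e : R) (S : set (dual X)).
Implicit Types f : dual X.

(** Limit stages are intersections, so a point of [S] can only be lost at a successor stage. *)
Lemma szlenk_iter_exit a f : S f -> ~ szlenk_iter e S a f -> exists c,
  [/\ szlenk_iter e S c f, ~ szlenk_iter e S (osucc c) f & ole (osucc c) a].
Proof.
move=> Sf; elim: a => [//|a IH|J g IH] nf.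
  have [af|/IH[c [cf ncf ca]]] := pselect (szlenk_iter e S a f).
    by exists a; split=> //; exact: ole_refl.
  by exists c; split=> //; exact: ole_succ.
have [j /IH[c [cf ncf cj]]] : exists j, ~ szlenk_iter e S (g j) f.
  by apply/existsNP => h; apply: nf; split.
by exists c; split=> //; exists j.
Qed.

Definition szlenk_rank f a : Prop :=
  ~ szlenk_iter e S a f /\ forall c, ~ szlenk_iter e S c f -> ole a c.

(** The rank cannot increase nearby, the complement of a closed derivative being open. If [f] is
    lost between stages [c] and [c + 1], nearby points of stage [c] are not separated from [f]; a
    separated nearby point has therefore left by stage [c], and its rank is smaller. *)
Lemma szlenk_rank_near a f : closed (S : set (weak_star X)) -> szlenk_rank f a ->
  \forall f' \near (f : weak_star X), ~ szlenk_iter e S a f' /\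
    (S f -> S f' -> separated e f f' -> ~ forall c, ~ szlenk_iter e S c f' -> ole a c).
Proof.
move=> clS [na amin].
have near1 : \forall f' \near (f : weak_star X), ~ szlenk_iter e S a f'.
  apply: open_nbhs_nbhs; split=> //; rewrite openC.
  exact: szlenk_iter_closed.
have [Sf|nSf] := pselect (S f); last by apply: filterS near1 => f' ?; split.
have [c [cf ncf ca]] := szlenk_iter_exit Sf na.
have [V nV hV] : exists2 V : set (dual X), nbhs (f : weak_star X) V &
    forall f', V f' -> szlenk_iter e S c f' -> ~ separated e f f'.
  have [//|none] := pselect (exists2 V : set (dual X), nbhs (f : weak_star X) V &
    forall f', V f' -> szlenk_iter e S c f' -> ~ separated e f f').
  case: ncf; apply/szlenk_derivativeP; split=> // V nV.
  apply/not_existsP => no; apply: none; exists V => // f' Vf' cf' sep.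
  by apply: (no f); exists f'; split=> //; split=> //; exact: nbhs_singleton nV.
have near2 : \forall f' \near (f : weak_star X), V f' by [].
apply: filterS (filterI near1 near2) => f' [nf' Vf']; split=> // _ Sf' sep h.
apply: (hV f' Vf' _ sep); apply: contrapT => /h ac.
by case: (@olt_irr c); exact: olt_le_trans ca ac.
Qed.

End ranks.

Lemma expr_small (R : realType) (r a : R) : 0 < r -> r < 1 -> 0 < a -> exists n, r ^+ n < a.
Proof.
move=> r0 r1 a0; have : r ^+ n @[n --> \oo] --> 0.
  by apply: cvg_expr; rewrite gtr0_norm.
move=> /cvgrPdist_lt/(_ _ a0) [n _ hn]; exists n.
have := hn n (leqnn _).
by rewrite /= sub0r normrN gtr0_norm// exprn_gt0.
Qed.

(** * Gauges of the coordinates with respect to the sets K_(A l) *)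

Section coordinate_gauges.
Variables (R : realType) (k : scalar_kind) (p : R) (hp : p = 0 \/ 1 < p) (L : choiceType).
Local Notation K := (scalars R k).
Local Notation q := (conj_exp p).
Variables (X Y : L -> normedModType K) (A : forall l, bop (X l) (Y l)).
Variable D : bop (dsum hp X) (dsum hp Y).
Hypothesis hD : forall l (x : X l), D (dsum_inj hp x) = dsum_inj hp (A l x).

Lemma dual_scale_shift (Z : normedModType K) (a : R) (f g : dual Z) : a != 0 ->
  dual_scale a f = g <-> f = dual_scale a^-1 g.
Proof.
move=> a0; split=> [<-|->]; rewrite dual_scaleA ?mulVf ?mulfV// ?dual_scale1//.
Qed.

(** [t] is the gauge of [f] up to a factor [r]: the last power of [r] with [f] in [t] K_(A l), or 0
    if all powers qualify, in which case [f = 0]. *)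
Lemma power_gauge (r : R) l f : 0 < r -> r < 1 -> adjoint_ball (A l) f ->
  exists t, [/\ 0 <= t, exists2 u, adjoint_ball (A l) u & f = dual_scale t u &
    0 < t -> ~ adjoint_ball (A l) (dual_scale (r * t)^-1 f)].
Proof.
move=> r0 r1 Af.
have [al|/existsNP nal] := pselect (forall n, adjoint_ball (A l) (dual_scale (r ^+ n)^-1 f)).
  exists 0; split=> //; last by rewrite ltxx.
  exists (dual_zero (X l)); first exact: adjoint_ball0.
  apply: bop_ext => v; rewrite dual_scaleE ofR0 mul0r.
  have [C C0 AC] := bop_bounded (A l).
  apply: (@modulus_eq0 R k); apply/eqP; rewrite eq_le modulus_ge0 andbT.
  apply/ler_addgt0Pr => e e0; rewrite add0r.
  have B0 : 0 < C * rnorm v + 1 by rewrite ltr_wpDl// mulr_ge0// rnorm_ge0.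
  have [n rn] := expr_small r0 r1 (divr_gt0 e0 B0).
  have rn0 : 0 < r ^+ n by rewrite exprn_gt0.
  have [g /dual_ballP gb /esym/dual_scale_shift] := al n.
  rewrite invr_eq0 gt_eqF// invrK => /(_ isT) ->.
  rewrite dual_scaleE modulusM modulus_ofR gtr0_norm//.
  apply: (@le_trans _ _ (r ^+ n * (C * rnorm v + 1))).
    rewrite ler_wpM2l ?(ltW rn0)//; apply: le_trans (gb _) _.
    by apply: le_trans (AC v) _; rewrite lerDl.
  by rewrite -ler_pdivlMr// ltW.
have ex : exists n, ~~ `[< adjoint_ball (A l) (dual_scale (r ^+ n)^-1 f) >].
  by case: nal => n hn; exists n; apply/asboolPn.
case: (ex_minnP ex) => -[|n] /asboolPn nn nmin.
  by case: nn; rewrite expr0 invr1 dual_scale1.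
exists (r ^+ n); split; first by rewrite exprn_ge0// ltW.
  have : adjoint_ball (A l) (dual_scale (r ^+ n)^-1 f).
    by apply: contrapT => /asboolPn /nmin; rewrite ltnn.
  move=> An; exists (dual_scale (r ^+ n)^-1 f) => //.
  by rewrite dual_scaleA mulfV ?dual_scale1// expf_neq0// gt_eqF.
by rewrite -exprS.
Qed.

(** The contrapositive of reassembly. One factor [r ^ q] is the bound that must fail there, the
    other comes from [b l = r * t l], which lowers the approximate gauges until they are strictly
    exceeded. *)
Lemma gauge_witness (r : R) (x : dual (dsum hp X)) : 0 < r -> r < 1 -> adjoint_ball D x ->
  ~ (exists2 u, adjoint_ball D u & x = dual_scale r u) ->
  exists s (b : L -> R), [/\ uniq s, forall l, 0 <= b l,
    forall l, l \in s -> 0 < b l /\ ~ adjoint_ball (A l) (dual_scale (b l)^-1 (coord x l)) &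
    r `^ q * r `^ q < \sum_(l <- s) b l `^ q].
Proof.
move=> r0 r1 Dx nx.
have q0 := conj_exp_gt0 hp.
have [t ht] := choice (fun l => power_gauge r0 r1 (adjoint_ball_coord hD l Dx)).
have [s us hs] : exists2 s, uniq s & r `^ q < \sum_(l <- s) t l `^ q.
  have [//|none] := pselect (exists2 s, uniq s & r `^ q < \sum_(l <- s) t l `^ q).
  case: nx; apply: (adjoint_ball_reassemble hD (t := t)) => // [l|l|s us].
  - by case: (ht l).
  - by case: (ht l).
  - by rewrite leNgt; apply/negP => h; apply: none; exists s.
exists [seq l <- s | 0 < t l], (fun l => r * t l); split; first exact: filter_uniq.
- by move=> l; rewrite mulr_ge0 ?(ltW r0)//; case: (ht l).
- move=> l; rewrite mem_filter => /andP[tl _].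
  by split; [exact: mulr_gt0|case: (ht l) => _ _; exact].
have -> : \sum_(l <- [seq l <- s | 0 < t l]) (r * t l) `^ q = r `^ q * \sum_(l <- s) t l `^ q.
  rewrite big_filter big_mkcond mulr_sumr; apply: eq_bigr => l _.
  have [tl _ _] := ht l; rewrite -powRM ?(ltW r0)//.
  by move: tl; rewrite le_eqVlt => /predU1P[<-|->//]; rewrite ltxx mulr0 powR0 ?gt_eqF.
by rewrite ltr_pM2l// powR_gt0.
Qed.

End coordinate_gauges.

(** * The separated coordinates carry weight *)

Section estimates.
Variables (R : realType) (q : R).
Hypothesis q1 : 1 <= q.
Implicit Types G H M b d : R.

Let q0 : 0 < q. Proof. exact: lt_le_trans ltr01 q1. Qed.

Lemma powR_two_ge : 2 <= 2 `^ q :> R.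
Proof. by rewrite -[leLHS]powRr1// ler_powR// ler1n. Qed.

Lemma powR_half (x : R) : 0 <= x -> (x / 2) `^ q <= x `^ q / 2.
Proof.
move=> x0; rewrite powRM ?invr_ge0// ler_wpM2l ?powR_ge0//.
by apply: ge1r_powR => //; rewrite invr_gt0 ltr0n /= invf_le1 ?ler1n.
Qed.

Lemma powR_mono (a c : R) : 0 <= a -> a <= c -> a `^ q <= c `^ q.
Proof.
by move=> a0 ac; apply: ge0_ler_powR; rewrite ?nnegrE ?(ltW q0)//; exact: le_trans ac.
Qed.

Lemma powR_add_le G H M d : 0 <= G -> 0 <= H -> 0 <= M -> 0 <= d -> d <= M * (G + H) ->
  d `^ q <= (2 * M) `^ q * (G `^ q + H `^ q).
Proof.
move=> G0 H0 M0 d0 dM.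
have [m [m0 mE mq]] : exists m, [/\ 0 <= m, G + H <= 2 * m & m `^ q <= G `^ q + H `^ q].
  have [GH|/ltW HG] := leP G H; [exists H|exists G]; split=> //; try lra.
    by rewrite lerDr powR_ge0.
  by rewrite lerDl powR_ge0.
apply: (@le_trans _ _ ((2 * M * m) `^ q)).
  apply: powR_mono => //; apply: le_trans dM _.
  by rewrite [2 * M]mulrC -mulrA ler_wpM2l.
by rewrite powRM ?mulr_ge0// ler_wpM2l// powR_ge0.
Qed.

(** If one of [G], [H] exceeds [2 b], its power is at least [2 b ^ q] and the other at least
    [b ^ q]. Then [8 b ^ q <= 3 (G ^ q + H ^ q)], so the sum of the powers is at most 4 times the
    excess over [b]. *)
Lemma excess_estimate G H M b d : 0 <= b -> b <= G -> b <= H -> 0 <= M -> 0 <= d ->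
  d <= M * (G + H) ->
  d `^ q <= (2 * M) `^ q * (4 * (G `^ q - b `^ q + (H `^ q - b `^ q))) +
    (if (G <= 2 * b) && (H <= 2 * b) then (2 * M) `^ q * 2 * 2 `^ q * b `^ q else 0).
Proof.
move=> b0 bG bH M0 d0 dM.
have G0 := le_trans b0 bG; have H0 := le_trans b0 bH.
have C0 : 0 <= (2 * M) `^ q by exact: powR_ge0.
have GB : b `^ q <= G `^ q by exact: powR_mono.
have HB : b `^ q <= H `^ q by exact: powR_mono.
have B0 : 0 <= b `^ q by exact: powR_ge0.
have bbE : (2 * b) `^ q = 2 `^ q * b `^ q by rewrite powRM.
have bb2 : 2 * b `^ q <= (2 * b) `^ q by rewrite bbE ler_wpM2r// powR_two_ge.
apply: le_trans (powR_add_le G0 H0 M0 d0 dM) _.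
have bb0 : 0 <= 2 * b by rewrite mulr_ge0.
case: ifPn => [/andP[Gb Hb]|].
  apply: (@le_trans _ _ ((2 * M) `^ q * ((2 * b) `^ q + (2 * b) `^ q))).
    by rewrite ler_wpM2l// lerD//; apply: powR_mono.
  rewrite bbE; set C := _ `^ q; set P := b `^ q.
  have -> : C * 2 * 2 `^ q * P = C * (2 `^ q * P + 2 `^ q * P) by ring.
  by rewrite lerDr !mulr_ge0// addr_ge0// subr_ge0.
rewrite addr0 negb_and -!ltNge => GHb; rewrite ler_wpM2l//.
by case/orP: GHb => /ltW /(powR_mono bb0); lra.
Qed.

End estimates.

Lemma sum_restrict (R : realType) (L : choiceType) (s r : seq L) (F : L -> R) :
  uniq s -> uniq r -> {subset s <= r} ->
  \sum_(l <- r) (if l \in s then F l else 0) = \sum_(l <- s) F l.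
Proof.
move=> us ur sr; rewrite -big_mkcond -big_filter; apply: perm_big.
apply: uniq_perm; rewrite ?filter_uniq// => l; rewrite mem_filter.
by case: (boolP (l \in s)) => //= /sr ->.
Qed.

Lemma gap_estimate (R : realType) (a a' d t C n : R) : 0 <= n -> 0 < a - t ->
  n * (C + 1) <= (a - t) / 2 -> d <= C * n -> a <= d + a' -> t < a'.
Proof. by move=> *; lra. Qed.

Lemma estimate_outside (R : realType) (x C E F G H : R) : x <= C * (G + H) ->
  0 <= C -> 0 <= G -> 0 <= H -> x <= C * (4 * (G - 0 + (H - 0))) + E * 0 + F * 0.
Proof.
move=> xC C0 G0 H0; rewrite !mulr0 !addr0 !subr0; apply: le_trans xC _.
by rewrite ler_wpM2l//; lra.
Qed.

Lemma estimate_small (R : realType) (x y z w : R) : x <= y -> 0 <= z -> 0 <= w ->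
  x <= z + y + w.
Proof. by move=> *; lra. Qed.

Lemma estimate_large (R : realType) (x y z u w : R) : x <= z + u -> 0 <= y -> u <= w ->
  x <= z + y + w.
Proof. by move=> *; lra. Qed.

(** Of a mass above [T], the excess term takes at most [T / 8] and the term with [E] at most
    [T / 2]; the remaining [3 T / 8] is bounded by [2 C C' w]. *)
Lemma estimate_final (R : realType) (T C C' E S a a' c w : R) :
  T < C * (4 * (a - S + (a' - S))) + E * S + C * 2 * C' * w -> E <= T / 2 ->
  0 <= E -> 0 <= S -> S <= 1 -> a <= 1 -> a' <= 1 -> 1 - c <= S -> C * 8 * c <= T / 8 ->
  0 < C -> 0 < C' -> T / 8 / (C * C') <= w.
Proof.
move=> h ET E0 S0 S1 a1 a'1 cS Cc C0 C'0; rewrite ler_pdivrMr ?mulr_gt0//.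
have ES : E * S <= T / 2 by apply: le_trans ET; rewrite ler_piMr.
have CS : C * (4 * (a - S + (a' - S))) <= C * (8 * c) by rewrite ler_pM2l//; lra.
have wE : C * 2 * C' * w = 2 * (w * (C * C')) by ring.
rewrite wE in h; set z := w * _ in h *.
have T0 : 0 <= T by lra.
by move: h CS ES Cc T0; rewrite mulrA => *; lra.
Qed.

Section separation.
Variables (R : realType) (k : scalar_kind) (p : R) (hp : p = 0 \/ 1 < p) (L : choiceType).
Local Notation K := (scalars R k).
Local Notation q := (conj_exp p).
Variables (X Y : L -> normedModType K) (A : forall l, bop (X l) (Y l)).
Variable D : bop (dsum hp X) (dsum hp Y).
Hypothesis hD : forall l (x : X l), D (dsum_inj hp x) = dsum_inj hp (A l x).
Variable M : R.
Hypothesis M0 : 0 < M.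
Hypothesis hM : forall l (x : X l), rnorm (A l x) <= M * rnorm x.

Lemma adjoint_ball_dnorm l (g : dual (Y l)) (b : R) : 0 < b -> dnorm g <= b ->
  adjoint_ball (A l) (dual_scale b^-1 (adjoint (A l) g)).
Proof.
move=> b0 gb; exists (dual_scale b^-1 g); last exact: bop_ext.
apply: dual_ball_unit => v v1; rewrite dual_scaleE modulusM modulus_ofR gtr0_norm ?invr_gt0//.
by rewrite ler_pdivrMl// mulr1; apply: le_trans (dnorm_unit _ v1) gb.
Qed.

(** Both gauges are at most [2 * b l]. They also exceed [b l] where this is used, so the sizes are
    fixed up to a factor 2 and the separation is one between points of K_(A l). *)
Definition separated_coord (e : R) (b : L -> R) (y y' : dual (dsum hp X)) l : Prop :=
  [/\ adjoint_ball (A l) (dual_scale (2 * b l)^-1 (coord y l)),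
      adjoint_ball (A l) (dual_scale (2 * b l)^-1 (coord y' l)) &
      separated e (dual_scale (2 * b l)^-1 (coord y l)) (dual_scale (2 * b l)^-1 (coord y' l))].

(** The difference has l_q mass above [(e / 2) ^ q]. Since [b] already carries mass [1 - c], the two
    functionals have little left beyond [b], so coordinates much larger than [b l] contribute
    little; a fixed share must come from separated coordinates of size comparable to [b l]. *)
Lemma separation_weight (e c : R) s (b : L -> R) (y y' : dual (dsum hp X)) :
  0 < e -> (2 * M) `^ q * 8 * c <= (e / 2) `^ q / 8 ->
  adjoint_ball D y -> adjoint_ball D y' -> uniq s -> (forall l, 0 <= b l) ->
  (forall l, l \in s -> [/\ 0 < b l, ~ adjoint_ball (A l) (dual_scale (b l)^-1 (coord y l)) &
                         ~ adjoint_ball (A l) (dual_scale (b l)^-1 (coord y' l))]) ->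
  1 - c <= \sum_(l <- s) b l `^ q -> separated (e / 2) y y' ->
  (e / 2) `^ q / 8 / ((2 * M) `^ q * 2 `^ q) <=
    weight s (fun l => b l `^ q) (separated_coord (e / 8) b y y').
Proof.
move=> e0 hc Dy Dy' us b0 hb sb [z z1 hz].
have q1 := conj_exp_ge1 hp.
have q0 := conj_exp_gt0 hp.
have [g gB yg] := Dy; have [h hB yh] := Dy'.
have yl l : coord y l = adjoint (A l) (coord g l) by rewrite -yg (coord_adjoint hD).
have yl' l : coord y' l = adjoint (A l) (coord h l) by rewrite -yh (coord_adjoint hD).
pose u := dual_comb 1 (- 1) y y'.
have uE v : u v = y v - y' v by rewrite dual_combE mul1r mulN1r.
pose d l := dnorm (coord u l).
have d0 l : 0 <= d l by exact: dnorm_ge0.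
have dM l : d l <= M * (dnorm (coord g l) + dnorm (coord h l)).
  apply: dnorm_le => v v1; rewrite coordE uE -!coordE yl yl'.
  apply: le_trans (modulusD _ _) _; rewrite modulusN mulrDr.
  have bound (f : dual (Y l)) : modulus (f (A l v)) <= M * dnorm f.
    apply: le_trans (dnorm_bound f (A l v)) _; rewrite mulrC ler_wpM2r ?dnorm_ge0//.
    by apply: le_trans (hM v) _; rewrite ler_piMr// ltW.
  exact: lerD (bound _) (bound _).
have [C C0 uC] := bop_bounded u.
have C1 : 0 < C + 1 by rewrite ltr_wpDl.
pose gap := modulus (u z) - e / 2.
have gap0 : 0 < gap by rewrite /gap uE subr_gt0.
have [s0 hs0] := dtrunc_approx z (divr_gt0 (divr_gt0 gap0 (ltr0Sn R 1)) C1).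
pose r := undup (s ++ s0).
have ur : uniq r by exact: undup_uniq.
have sr : {subset s <= r} by move=> l ls; rewrite mem_undup mem_cat ls.
have sr0 : {subset s0 <= r} by move=> l ls; rewrite mem_undup mem_cat ls orbT.
(* Otherwise Hoelder's inequality bounds [u] on the truncation of [z] by [e / 2], whereas [u z]
   exceeds [e / 2] by [gap] and truncation costs at most [gap / 2]. *)
have T_lt : (e / 2) `^ q < \sum_(l <- r) d l `^ q.
  rewrite ltNge; apply/negP => Tge.
  have := holder hp (fun l => rnorm_ge0 (z l)) d0 (divr_gt0 e0 (ltr0Sn R 1))
    (dsum_seq_bound z1 ur) Tge.
  apply/negP; rewrite -ltNge.
  have : modulus (u (dtrunc hp r z)) <= \sum_(l <- r) d l * rnorm (z l).
    rewrite dual_dtrunc; apply: le_trans (modulus_sum _ _) _.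
    by apply: ler_sum => l _; exact: dnorm_bound.
  apply: lt_le_trans.
  have := hs0 r ur sr0; rewrite ler_pdivlMr// => hw.
  have := uC (z - dtrunc hp r z); rewrite raddfB => huw.
  have := modulusD (u z - u (dtrunc hp r z)) (u (dtrunc hp r z)); rewrite subrK => hD'.
  exact: (gap_estimate (rnorm_ge0 (z - dtrunc hp r z)) gap0 hw huw hD').
pose G l := dnorm (coord g l) `^ q; pose H l := dnorm (coord h l) `^ q.
pose B l := if l \in s then b l `^ q else 0.
pose W l := if l \in s then
  (if `[< separated_coord (e / 8) b y y' l >] then b l `^ q else 0) else 0.
have SG : \sum_(l <- r) G l <= 1 by exact: dual_ball_coord_sum.
have SH : \sum_(l <- r) H l <= 1 by exact: dual_ball_coord_sum.
have SB : \sum_(l <- r) B l = \sum_(l <- s) b l `^ q by exact: sum_restrict.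
have SW : \sum_(l <- r) W l = weight s (fun l => b l `^ q) (separated_coord (e / 8) b y y').
  by rewrite /weight [RHS]big_mkcond /=; exact: sum_restrict.
have gP l : l \in s -> b l <= dnorm (coord g l).
  move=> /hb[bl nb _]; rewrite leNgt; apply/negP => /ltW gb.
  by apply: nb; rewrite yl; exact: adjoint_ball_dnorm.
have hP l : l \in s -> b l <= dnorm (coord h l).
  move=> /hb[bl _ nb]; rewrite leNgt; apply/negP => /ltW gb.
  by apply: nb; rewrite yl'; exact: adjoint_ball_dnorm.
have BG l : B l <= G l.
  by rewrite /B; case: ifP => [/gP|_]; rewrite /G ?powR_ge0//; exact: powR_mono.
have BH l : B l <= H l.
  by rewrite /B; case: ifP => [/hP|_]; rewrite /H ?powR_ge0//; exact: powR_mono.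
pose C1q := (2 * M) `^ q; have C1q0 : 0 < C1q by rewrite powR_gt0// mulr_gt0.
have pointwise l : d l `^ q <= C1q * (4 * (G l - B l + (H l - B l))) +
    (e / 4) `^ q * B l + C1q * 2 * 2 `^ q * W l.
  have G0 : 0 <= G l by exact: powR_ge0.
  have H0 : 0 <= H l by exact: powR_ge0.
  have [ls|ls] := boolP (l \in s); last first.
    have Bl : B l = 0 by rewrite /B (negbTE ls).
    have Wl : W l = 0 by rewrite /W (negbTE ls).
    rewrite Bl Wl; apply: estimate_outside (ltW C1q0) G0 H0.
    have := powR_add_le q1 (dnorm_ge0 (coord g l)) (dnorm_ge0 (coord h l)) (ltW M0) (d0 l) (dM l).
    exact.
  have BlE : B l = b l `^ q by rewrite /B ls.
  have W0 : 0 <= W l by rewrite /W ls; case: ifP; rewrite // powR_ge0.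
  have C3 : 0 <= C1q * 2 * 2 `^ q by rewrite !mulr_ge0 ?powR_ge0// ltW.
  have CW : 0 <= C1q * 2 * 2 `^ q * W l by exact: mulr_ge0 C3 W0.
  have CE : 0 <= C1q * (4 * (G l - B l + (H l - B l))).
    apply: (mulr_ge0 (ltW C1q0)); apply: (mulr_ge0 (ler0n R 4)).
    by apply: addr_ge0; rewrite subr_ge0; [exact: BG|exact: BH].
  (* The coordinates with relative difference at most [e / 4] carry at most half of [(e / 2) ^ q].
     For the others, division by [2 * b l] leaves separation [e / 8]. *)
  have [small|large] := leP (d l) (e / 4 * b l).
    apply: estimate_small CE CW; rewrite BlE -powRM ?b0// ?divr_ge0 ?(ltW e0)//.
    exact: (powR_mono q1 (d0 l) small).
  have EB : 0 <= (e / 4) `^ q * B l by rewrite mulr_ge0 ?powR_ge0// BlE powR_ge0.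
  have := excess_estimate q1 (b0 l) (gP l ls) (hP l ls) (ltW M0) (d0 l) (dM l).
  rewrite -/C1q -/(G l) -/(H l) -BlE => est; apply: estimate_large est EB _.
  case: ifPn => [/andP[Gb Hb]|_]; last exact: CW.
  suff -> : W l = B l by [].
  have [bl _ _] := hb l ls; have b2 : 0 < 2 * b l by rewrite mulr_gt0.
  rewrite /W ls BlE asboolT//; split.
  - by rewrite yl; exact: adjoint_ball_dnorm.
  - by rewrite yl'; exact: adjoint_ball_dnorm.
  - have [v v1 hv] := dnorm_approx large; exists v => //.
    rewrite !dual_scaleE -mulrBr modulusM modulus_ofR gtr0_norm ?invr_gt0//.
    have uv : coord u l v = coord y l v - coord y' l v by exact: uE.
    by rewrite ltr_pdivlMl// -uv (_ : 2 * b l * (e / 8) = e / 4 * b l)//; field.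
have : \sum_(l <- r) d l `^ q <= C1q * (4 * (\sum_(l <- r) G l - \sum_(l <- r) B l +
    (\sum_(l <- r) H l - \sum_(l <- r) B l))) + (e / 4) `^ q * (\sum_(l <- r) B l) +
    C1q * 2 * 2 `^ q * (\sum_(l <- r) W l).
  rewrite -!sumrB -big_split /= !mulr_sumr -!big_split /=.
  by apply: ler_sum => l _; exact: pointwise.
rewrite SB SW => /(lt_le_trans T_lt) Sd.
have SS1 : \sum_(l <- s) b l `^ q <= 1.
  by rewrite -SB; apply: le_trans SG; exact: ler_sum.
have TE : (e / 4) `^ q <= (e / 2) `^ q / 2.
  have -> : e / 4 = e / 2 / 2 by field.
  by apply: (powR_half q1); rewrite divr_ge0// ltW.
have SS0 : 0 <= \sum_(l <- s) b l `^ q by apply: sumr_ge0 => l _; exact: powR_ge0.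
exact: (estimate_final Sd TE (powR_ge0 _ _) SS0 SS1 SG SH sb hc C1q0 (powR_gt0 _ (ltr0Sn R 1))).
Qed.

End separation.
(** * Derivatives of the diagonal operator *)

Lemma near_all_seq (T : topologicalType) (I : eqType) (s : seq I) (x : T) (P : I -> T -> Prop) :
  (forall i, i \in s -> \forall y \near x, P i y) ->
  \forall y \near x, forall i, i \in s -> P i y.
Proof.
elim: s => [|i s IH] h; first exact: nearW.
have hs : \forall y \near x, forall j, j \in s -> P j y.
  by apply: IH => j js; apply: h; rewrite inE js orbT.
apply: filterS (filterI (h i (mem_head _ _)) hs) => y [Pi Ps] j.
by rewrite inE => /predU1P[->|/Ps].
Qed.

(** Ranks are compared with those of the center, so one of the two separated points is traded for
    the center at the cost of a factor 2. *)
Lemma separated_split (R : realType) (k : scalar_kind) (X : normedModType (scalars R k))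
    (e : R) (f g h : dual X) :
  separated e g h -> separated (e / 2) f g \/ separated (e / 2) f h.
Proof.
move=> [z z1 gh]; have [fg|fg] := ltP (e / 2) (modulus (f z - g z)).
  by left; exists z.
right; exists z => //; have := modulusD (g z - f z) (f z - h z).
by rewrite addrA subrK [modulus (g z - _)]modulusB => ?; lra.
Qed.

Section main_estimate.
Variables (R : realType) (k : scalar_kind) (p : R) (hp : p = 0 \/ 1 < p) (L : choiceType).
Local Notation K := (scalars R k).
Local Notation q := (conj_exp p).
Variables (X Y : L -> normedModType K) (A : forall l, bop (X l) (Y l)).
Variable D : bop (dsum hp X) (dsum hp Y).
Hypothesis hD : forall l (x : X l), D (dsum_inj hp x) = dsum_inj hp (A l x).
Variable M : R.
Hypothesis M0 : 0 < M.
Hypothesis hM : forall l (x : X l), rnorm (A l x) <= M * rnorm x.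

Lemma coord_scale_continuous (a : R) l :
  continuous ((fun y => dual_scale a (coord y l)) : weak_star (dsum hp X) -> weak_star (X l)).
Proof.
move=> y; apply: (@continuous_comp (weak_star (dsum hp X)) (weak_star (X l)) (weak_star (X l))
  (fun y => coord y l) (dual_scale a)).
  exact: adjoint_weak_star_continuous.
exact: dual_scale_continuous.
Qed.

Section game_run.
Variables (e c kappa : R) (beta : ord) (s : seq L) (b : L -> R).
Hypothesis e0 : 0 < e.
Hypothesis hc : (2 * M) `^ q * 8 * c <= (e / 2) `^ q / 8.
Hypothesis kappaE : kappa = (e / 2) `^ q / 8 / ((2 * M) `^ q * 2 `^ q).
Hypothesis hbeta : forall l, szlenk_iter (e / 8) (adjoint_ball (A l)) beta = set0.
Hypothesis us : uniq s.
Hypothesis b0 : forall l, 0 <= b l.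
Hypothesis bs : 1 - c <= \sum_(l <- s) b l `^ q.

Let scaled (y : dual (dsum hp X)) l := dual_scale (2 * b l)^-1 (coord y l).

(** A weak* open condition, because [s] is finite and the K_(A l) are closed; hence it persists
    along the run of the game. *)
Definition outside (y : dual (dsum hp X)) : Prop := forall l, l \in s ->
  0 < b l /\ ~ adjoint_ball (A l) (dual_scale (b l)^-1 (coord y l)).

Lemma kappa_gt0 : 0 < kappa.
Proof.
have T0 : 0 < (e / 2) `^ q by rewrite powR_gt0// divr_gt0.
have C0 : 0 < (2 * M) `^ q by rewrite powR_gt0// mulr_gt0.
by rewrite kappaE divr_gt0 ?divr_gt0// mulr_gt0// powR_gt0.
Qed.

(** The value 0 off [s] is a default: a move must not increase any entry of the tuple, in [s] or
    not. *)
Lemma coord_rank_ex y l : exists a,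
  if l \in s then szlenk_rank (e / 8) (adjoint_ball (A l)) (scaled y l) a else a = ozero.
Proof.
case: (l \in s); last by exists ozero.
by apply: oleast_ex; exists beta; rewrite hbeta.
Qed.

Definition coord_rank y l : ord := sval (cid (coord_rank_ex y l)).

Lemma coord_rankP y l : l \in s ->
  szlenk_rank (e / 8) (adjoint_ball (A l)) (scaled y l) (coord_rank y l).
Proof. by move=> ls; have := svalP (cid (coord_rank_ex y l)); rewrite -/(coord_rank y l) ls. Qed.

Lemma coord_rank_out y l : l \notin s -> coord_rank y l = ozero.
Proof.
move=> /negbTE ls; have := svalP (cid (coord_rank_ex y l)).
by rewrite -/(coord_rank y l) ls.
Qed.

Lemma coord_rank_le y l : l \in s -> ole (coord_rank y l) beta.
Proof. by move=> ls; apply: (coord_rankP y ls).2; rewrite hbeta. Qed.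

Lemma coord_rank_near y : outside y -> \forall y' \near (y : weak_star (dsum hp X)),
  outside y' /\ forall l, l \in s -> ole (coord_rank y' l) (coord_rank y l) /\
    (separated_coord A (e / 8) b y y' l -> olt (coord_rank y' l) (coord_rank y l)).
Proof.
move=> out.
have near1 : \forall y' \near (y : weak_star (dsum hp X)), outside y'.
  apply: near_all_seq => l ls; have [bl nb] := out l ls.
  have nb' : nbhs (dual_scale (b l)^-1 (coord y l) : weak_star (X l))
      (~` adjoint_ball (A l)).
    by apply: open_nbhs_nbhs; split=> //; rewrite openC; exact: adjoint_ball_closed.
  have near_y : \forall y' \near (y : weak_star (dsum hp X)),
    ~ adjoint_ball (A l) (dual_scale (b l)^-1 (coord (y' : dual _) l)).
    exact: (@coord_scale_continuous (b l)^-1 l y _ nb').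
  by apply: filterS near_y => y' ny'; split.
have near2 : \forall y' \near (y : weak_star (dsum hp X)), forall l, l \in s ->
    ole (coord_rank y' l) (coord_rank y l) /\
    (separated_coord A (e / 8) b y y' l -> olt (coord_rank y' l) (coord_rank y l)).
  apply: near_all_seq => l ls.
  have nr := szlenk_rank_near (@adjoint_ball_closed R k _ _ (A l)) (coord_rankP y ls).
  have near_y : \forall y' \near (y : weak_star (dsum hp X)),
      ~ szlenk_iter (e / 8) (adjoint_ball (A l)) (coord_rank y l) (scaled y' l) /\
      (adjoint_ball (A l) (scaled y l) -> adjoint_ball (A l) (scaled y' l) ->
       separated (e / 8) (scaled y l) (scaled y' l) ->
       ~ forall a, ~ szlenk_iter (e / 8) (adjoint_ball (A l)) a (scaled y' l) ->
           ole (coord_rank y l) a).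
    exact: (@coord_scale_continuous (2 * b l)^-1 l y _ nr).
  apply: filterS near_y => y' [ny' hy']; split; first exact: (coord_rankP y' ls).2.
  move=> [Ky Ky' sep]; apply/oltP => le_rank; apply: (hy' Ky Ky' sep) => a na.
  exact: ole_trans le_rank ((coord_rankP y' ls).2 a na).
exact: filterI near1 near2.
Qed.

(** Leaving one derivative supplies a pair near [y]; its member separated from [y] is the next
    position. The separated coordinates drop in rank and have mass at least [kappa], that is, weight
    at least 1 after division by [kappa]. *)
Lemma szlenk_iter_game xi y : szlenk_iter e (adjoint_ball D) xi y -> outside y ->
  iterated (tuple_move s (fun l => b l `^ q / kappa) (fun=> ozero)) xi (coord_rank y).
Proof.
elim: xi y => [//|xi IH|J f IH] y /=; last by move=> [_ h] out j; exact: IH (h j) out.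
move=> /[dup] /(szlenk_iter_sub (a := osucc xi)) Dy /szlenk_derivativeP[_ h] out.
have [g [g' [[near_g Dg] [near_g' Dg'] /(separated_split y) sep]]] := h _ (coord_rank_near out).
have [y' [[out' ranks] xi_y' sep']] : exists y', [/\ outside y' /\ (forall l, l \in s ->
    ole (coord_rank y' l) (coord_rank y l) /\
    (separated_coord A (e / 8) b y y' l -> olt (coord_rank y' l) (coord_rank y l))),
    szlenk_iter e (adjoint_ball D) xi y' & separated (e / 2) y y'].
  by case: sep; [exists g|exists g'].
exists (coord_rank y'); last exact: IH.
split=> [l|].
  have [ls|ls] := boolP (l \in s); first by case: (ranks l ls).
  by rewrite !coord_rank_out.
have kappa0 := kappa_gt0.
have : kappa <= weight s (fun l => b l `^ q) (separated_coord A (e / 8) b y y').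
  rewrite kappaE; apply: (separation_weight hD M0 hM e0 hc) => //.
    exact: szlenk_iter_sub xi_y'.
  by move=> l ls; have [bl ?] := out l ls; have [_ ?] := out' l ls; split.
rewrite -{1}[kappa]mulr1 mulrC -ler_pdivlMr// => /le_trans; apply.
rewrite /weight mulr_suml; apply: (@weight_sub _ _ s (fun l => b l `^ q / kappa)) => [l|l ls sc].
  by rewrite divr_ge0 ?powR_ge0// ltW.
by split=> //; exact: (ranks l ls).2.
Qed.

End game_run.

Lemma szlenk_iter_shrink (e : R) beta : 0 < e ->
  (forall l, szlenk_iter (e / 8) (adjoint_ball (A l)) beta = set0) ->
  exists r m, [/\ 0 < r, r < 1 & szlenk_iter e (adjoint_ball D) (osucc (onat beta m))
    `<=` dual_scale r @` adjoint_ball D].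
Proof.
move=> e0 hbeta; have q0 := conj_exp_gt0 hp.
pose T := (e / 2) `^ q; have T0 : 0 < T by rewrite powR_gt0// divr_gt0.
pose C1 := (2 * M) `^ q; have C10 : 0 < C1 by rewrite powR_gt0// mulr_gt0.
(* Small enough for the excess bound [8 * C1 * c <= T / 8], and below 1. *)
pose c := Num.min 2^-1 (T / (64 * C1)).
have c0 : 0 < c by rewrite lt_min invr_gt0 ltr0n divr_gt0// mulr_gt0.
have c2 : c <= 2^-1 by rewrite ge_min lexx.
have hc : C1 * 8 * c <= T / 8.
  have : c <= T / (64 * C1) by rewrite ge_min lexx orbT.
  rewrite ler_pdivlMr ?mulr_gt0// => ?.
  by rewrite ler_pdivlMr//; nra.
(* [r] is chosen with [r ^ q * r ^ q = 1 - c], so that the mass given by [gauge_witness] is what the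
   separation estimate requires. *)
pose t := Num.sqrt (1 - c).
have c1 : 0 < 1 - c by lra.
have t0 : 0 < t by rewrite sqrtr_gt0.
have tt : t * t = 1 - c by rewrite -expr2 sqr_sqrtr// ltW.
pose r := t `^ q^-1.
have rq : r `^ q = t by rewrite /r -powRrM mulVf ?gt_eqF// powRr1// ltW.
have r0 : 0 < r by rewrite powR_gt0.
have r1 : r < 1.
  rewrite ltNge; apply/negP => r_ge1.
  have : 1 `^ q <= r `^ q by apply: (powR_mono (conj_exp_ge1 hp)).
  by rewrite powR1 rq => ?; nra.
pose kappa := T / 8 / (C1 * 2 `^ q).
have kappa0 : 0 < kappa by exact: (@kappa_gt0 e).
(* The weights [b l ^ q / kappa] sum to at most [1 / kappa] for every finite [s], so one [m] serves
   all points of K_D. *)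
have [m hm] := game_bound L beta kappa^-1.
exists r, m; split=> // x hx.
have Dx := szlenk_iter_sub hx.
apply: contrapT => nx.
have [|s [b [us b0 hb sb]]] := gauge_witness hD r0 r1 Dx.
  by move=> [u Du xu]; apply: nx; exists u.
apply: (hm s (fun l => b l `^ q / kappa) (fun=> ozero) (coord_rank s b hbeta x)).
- by move=> l; rewrite divr_ge0 ?powR_ge0// ltW.
- rewrite -mulr_suml -[leRHS]mul1r ler_wpM2r ?invr_ge0 ?(ltW kappa0)//.
  have [g gB gx] := Dx; apply: le_trans (dual_ball_coord_sum gB us).
  rewrite big_seq [leRHS]big_seq; apply: ler_sum => l ls.
  apply: (powR_mono (conj_exp_ge1 hp)) => //; have [bl nb] := hb l ls.
  rewrite leNgt; apply/negP => /ltW gb; apply: nb.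
  by rewrite -gx (coord_adjoint hD); exact: adjoint_ball_dnorm.
- by move=> l ls; apply: ole_trans (coord_rank_le _ _ _ ls) (ole_0add _).
- apply: (szlenk_iter_game (c := c)) => //.
  by rewrite -tt -rq ltW.
Qed.

(** Since [beta > 0], each block [beta (m + 1)] contains the [beta m + 1] derivatives of the
    shrinking lemma and gains a factor [r]. Once the remaining set has diameter below [e], one more
    derivative empties it. *)
Lemma szlenk_iter_vanish (e : R) beta : 0 < e -> olt ozero beta ->
  (forall l, szlenk_iter (e / 8) (adjoint_ball (A l)) beta = set0) ->
  exists n, szlenk_iter e (adjoint_ball D) (onat beta n) = set0.
Proof.
move=> e0 beta0 hbeta; have [r [m [r0 r1 shrink]]] := szlenk_iter_shrink e0 hbeta.
have succ_le n : ole (osucc (onat beta n)) (onat beta n.+1).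
  exact: (@oadd_monoR (onat beta n) (osucc ozero) beta).
have iter n : szlenk_iter e (adjoint_ball D) (onat beta (m.+1 * n))
    `<=` dual_scale (r ^+ n) @` adjoint_ball D.
  elim: n => [|n IH] x; first by rewrite muln0 => Dx; exists x; rewrite ?expr0 ?dual_scale1.
  rewrite mulnS addnC => /(szlenk_iter_anti (onatD_ge _ _ _)).
  rewrite szlenk_iterD => /(szlenk_iter_subset IH).
  move=> /(szlenk_iter_scale (ltW e0)) []; rewrite ?exprn_gt0 ?exprn_ile1 ?(ltW r0) ?(ltW r1)//.
  move=> y /(szlenk_iter_anti (succ_le m)) /shrink[u Du <-] <-.
  by exists u => //; rewrite dual_scaleA -exprSr.
have [C C0 DC] := bop_bounded D.
have C1 : 0 < 2 * C + 1 by rewrite ltr_wpDl// mulr_ge0.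
have [n hn] := expr_small r0 r1 (divr_gt0 e0 C1).
have rn0 : 0 < r ^+ n by rewrite exprn_gt0.
exists (m.+1 * n).+1; rewrite -subset0 => x /(szlenk_iter_anti (succ_le _)).
move=> /szlenk_derivativeP[_ /(_ setT)] [|f [g [[_ /iter[u Du <-]] [_ /iter[v Dv <-]] [z z1]]]].
  exact: filterT.
have bound w : adjoint_ball D w -> modulus (w z) <= C.
  move=> [h /dual_ballP hB <-]; apply: le_trans (hB _) _; apply: le_trans (DC z) _.
  by rewrite ler_piMr.
rewrite !dual_scaleE -mulrBr modulusM modulus_ofR gtr0_norm// => h.
have h' := modulusD (u z) (- v z); rewrite modulusN in h'.
have := bound u Du; have := bound v Dv.
by move: hn; rewrite ltr_pdivlMr// => ? ? ?; nra.
Qed.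

End main_estimate.
(** * Indices of the operators *)

Lemma eole_cofinal (x y : eord) :
  (forall b, eolt (Some b) x -> eolt (Some b) y) -> eole x y.
Proof.
by move=> h; apply/eoleP; case: y h => [b|] h; [move=> /h /olt_irr|case].
Qed.

Lemma eole_trans (y x z : eord) : eole x y -> eole y z -> eole x z.
Proof.
case: x y z => [a|] [b|] [c|] //=; exact: ole_trans.
Qed.

Lemma eolt_le_trans (y x z : eord) : eolt x y -> eole y z -> eolt x z.
Proof.
case: x y z => [a|] [b|] [c|] //=; exact: olt_le_trans.
Qed.

Section indices.
Variables (R : realType) (k : scalar_kind).
Local Notation K := (scalars R k).
Variables (X Y : normedModType K) (A : bop X Y).

Lemma Sz_eps_gtP (e : R) b :
  eolt (Some b) (Sz_eps A e) <-> szlenk_iter e (adjoint_ball A) b !=set0.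
Proof. exact: Sz_set_eps_gtP. Qed.

Lemma Sz_gtP b : eolt (Some b) (Sz A) <->
  exists2 e : R, 0 < e & szlenk_iter e (adjoint_ball A) b !=set0.
Proof.
split=> [/eosup_gtP[e /Sz_eps_gtP h]|[e e0 h]]; first by exists e%:num.
by apply/eosup_gtP; exists (PosNum e0); exact/Sz_eps_gtP.
Qed.

Lemma Sz_eps_lt0 (e : R) : eolt (Some ozero) (Sz_eps A e).
Proof. by apply/Sz_eps_gtP; exists (dual_zero X); exact: adjoint_ball0. Qed.

Lemma Sz_double b : eolt (Some b) (Sz A) -> eolt (Some (oadd b b)) (Sz A).
Proof.
move=> /Sz_gtP[e e0 [x hx]]; apply/Sz_gtP; exists (e / 2); first by rewrite divr_gt0.
by exists x; apply: szlenk_iter_double hx => f g; exact: adjoint_ball_mid.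
Qed.

End indices.

Lemma Sz_noncompact (R : realType) (k : scalar_kind) (X : normedModType (scalars R k))
    (Y : completeNormedModType (scalars R k)) (A : bop X Y) :
  ~ compact_operator A -> eolt (Some (osucc ozero)) (Sz A).
Proof.
move=> nc; apply/Sz_gtP; apply: contrapT => h; apply: nc.
apply: compact_operator_szlenk => e e0; rewrite -subset0 => x hx.
by apply: h; exists e => //; exists x.
Qed.

Section diagonal_index.
Variables (R : realType) (k : scalar_kind) (p : R) (hp : p = 0 \/ 1 < p) (L : choiceType).
Local Notation K := (scalars R k).
Variables (X Y : L -> normedModType K) (A : forall l, bop (X l) (Y l)).
Variable D : bop (dsum hp X) (dsum hp Y).
Hypothesis hD : forall l (x : X l), D (dsum_inj hp x) = dsum_inj hp (A l x).
Variable alpha : ord.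
Hypothesis alphaE : eosup (fun l => Sz (A l)) = Some alpha.

Lemma alpha_gtP b : olt b alpha <-> exists l, eolt (Some b) (Sz (A l)).
Proof. by rewrite -[olt b alpha]/(eolt (Some b) (Some alpha)) -alphaE; exact: eosup_gtP. Qed.

Lemma szlenk_iter_alpha l (e : R) : 0 < e -> szlenk_iter e (adjoint_ball (A l)) alpha = set0.
Proof.
move=> e0; rewrite -subset0 => x hx; apply: (@olt_irr alpha); apply/alpha_gtP; exists l.
by apply/Sz_gtP; exists e => //; exists x.
Qed.

Lemma alpha_double b : olt b alpha -> olt (oadd b b) alpha.
Proof. by move=> /alpha_gtP[l /Sz_double h]; apply/alpha_gtP; exists l. Qed.

(** Adding [b] at most doubles the larger of [b n] and [b], and doubling stays below [alpha]. *)
Lemma alpha_onat b n : olt b alpha -> olt ozero alpha -> olt (onat b n) alpha.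
Proof.
move=> ba a0; elim: n => //= n IH.
have [nb|/oltW bn] := ole_total (onat b n) b.
  exact: ole_lt_trans (oadd_monoL b nb) (alpha_double ba).
exact: ole_lt_trans (oadd_monoR _ bn) (alpha_double IH).
Qed.

(** For [b > 0] the successor is at most [b + b]; for [b = 0] the bound [1 < alpha] is used
    directly. *)
Lemma alpha_limit b : olt (osucc ozero) alpha -> olt b alpha -> olt (osucc b) alpha.
Proof.
move=> a1 ba; have [b0|b0] := ole_total b ozero.
  by apply: ole_lt_trans a1; exact: b0.
apply: ole_lt_trans (alpha_double ba); exact: (oadd_monoR b (b := osucc ozero)).
Qed.

Lemma Sz_diagonal_ge : eole (Some alpha) (Sz D).
Proof.
apply: eole_cofinal => b /alpha_gtP[l /Sz_gtP[e e0 [x hx]]]; apply/Sz_gtP; exists e => //.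
by exists (adjoint (proj_op hp X l) x); exact: szlenk_iter_proj.
Qed.

Section bounded.
Variable M : R.
Hypothesis M0 : 0 < M.
Hypothesis hM : forall l (x : X l), rnorm (A l x) <= M * rnorm x.
Hypothesis alpha0 : olt ozero alpha.

Lemma Sz_diagonal_le_omega : eole (Sz D) (Some (omul alpha oomega)).
Proof.
apply/eosup_leP => e'; have e0 : 0 < e'%:num by [].
move: (e'%:num) e0 => {e'} e e0; apply/eoleP => /Sz_eps_gtP[x hx].
have [|n hn] := szlenk_iter_vanish hD M0 hM e0 alpha0.
  by move=> l; apply: szlenk_iter_alpha; rewrite divr_gt0.
suff : szlenk_iter e (adjoint_ball D) (onat alpha n) x by rewrite hn.
apply: szlenk_iter_anti hx; rewrite -omul_nat.
by apply: (@ole_sup _ (fun n => omul alpha (iter n osucc ozero)) n); exact: ole_refl.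
Qed.

Lemma Sz_diagonal_le : [set: L] !=set0 ->
  (forall e : R, 0 < e -> eolt (eosup (fun l => Sz_eps (A l) e)) (Some alpha)) ->
  eole (Sz D) (Some alpha).
Proof.
move=> [l0 _] small; apply/eosup_leP => e'; have e0 : 0 < e'%:num by [].
move: (e'%:num) e0 => {e'} e e0; apply/eoleP => /Sz_eps_gtP[x hx].
have e8 : 0 < e / 8 by rewrite divr_gt0.
have := small _ e8; case betaE : (eosup _) => [beta|] //= ba.
have beta_gtP b : olt b beta <-> exists l, eolt (Some b) (Sz_eps (A l) (e / 8)).
  by rewrite -[olt b beta]/(eolt (Some b) (Some beta)) -betaE; exact: eosup_gtP.
(* Each K_(A l) contains 0, so every index is positive; the index set is nonempty. *)
have beta0 : olt ozero beta by apply/beta_gtP; exists l0; exact: Sz_eps_lt0.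
have [|n hn] := szlenk_iter_vanish hD M0 hM e0 beta0.
  move=> l; rewrite -subset0 => y hy; apply: (@olt_irr beta); apply/beta_gtP; exists l.
  by apply/Sz_eps_gtP; exists y.
suff : szlenk_iter e (adjoint_ball D) (onat beta n) x by rewrite hn.
by apply: szlenk_iter_anti hx; apply: oltW; exact: alpha_onat.
Qed.

End bounded.

Lemma Sz_diagonal_ge_omega (e : R) : olt (osucc ozero) alpha -> 0 < e ->
  eole (Some alpha) (eosup (fun l => Sz_eps (A l) e)) ->
  eole (Some (omul alpha oomega)) (Sz D).
Proof.
move=> a1 e0 large.
have a0 : olt ozero alpha by exact: oltW a1.
have ne : szlenk_iter e (adjoint_ball D) alpha !=set0.
  apply: szlenk_iter_limit => //; first exact: adjoint_ball_compact.
    by move=> b; exact: alpha_limit.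
  move=> b ba; have := @eolt_le_trans (Some alpha) (Some b) _ ba large.
  move=> /eosup_gtP[l /Sz_eps_gtP[x hx]].
  by exists (adjoint (proj_op hp X l) x); exact: szlenk_iter_proj.
(* Starting from a point at stage [alpha], doubling gives [alpha 2 ^ n]; these are cofinal in
   [alpha omega]. *)
have pow n : eolt (Some (onat alpha (2 ^ n))) (Sz D).
  elim: n => [|n IH].
    apply/Sz_gtP; exists e => //.
    case: ne => x hx; exists x; apply: szlenk_iter_anti hx; exact: onat1_ge.
  have := Sz_double IH; case: (Sz D) => [s|] //=; apply: ole_lt_trans.
  by rewrite expnS mul2n -addnn; exact: onatD_le.
apply: eole_cofinal => b /= [n hn].
have := pow n; case: (Sz D) => [s|] //=; apply: olt_trans; apply: olt_le_trans hn _.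
by rewrite omul_nat; apply: onat_le; exact/ltnW/ltn_expl.
Qed.

End diagonal_index.

Theorem theorem1p6 (R : realType) (k : scalar_kind) (L : choiceType)
    (p : R) (hp : p = 0 \/ 1 < p)
    (X Y : L -> completeNormedModType (scalars R k))
    (A : forall l, bop (X l) (Y l))
    (D : bop (dsum hp (fun l => X l)) (dsum hp (fun l => Y l))) :
  [set: L] !=set0 ->
  (exists M : R, forall l (x : X l), rnorm (A l x) <= M * rnorm x) ->
  (forall l, asplund (A l)) ->
  (exists l, ~ compact_operator (A l)) ->
  (forall l (x : X l), D (dsum_inj hp x) = dsum_inj hp (A l x)) ->
  (eoeq (Sz D) (eosup (fun l => Sz (A l))) <->
     forall e : R, 0 < e ->
       eolt (eosup (fun l => Sz_eps (A l) e)) (eosup (fun l => Sz (A l)))) /\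
  (~ (forall e : R, 0 < e ->
       eolt (eosup (fun l => Sz_eps (A l) e)) (eosup (fun l => Sz (A l)))) ->
     eoeq (Sz D) (eomul (eosup (fun l => Sz (A l))) oomega)).
Proof.
move=> L0 [M hM] asp [l0 nc] hD.
have [alpha alphaE] : exists alpha, eosup (fun l => Sz (A l)) = Some alpha.
  have : eosup (fun l => Sz (A l)) <> None.
    by rewrite /eosup; case: pselect => // -[l hl]; case: (asp l).
  by case: (eosup _) => // alpha _; exists alpha.
(* The estimates need a positive bound, and [M] may be negative when all [X l] are trivial on the
   nose of the inequality, or 0. *)
pose M' := `|M| + 1.
have M'0 : 0 < M' by rewrite ltr_wpDl.
have hM' l (x : X l) : rnorm (A l x) <= M' * rnorm x.
  apply: le_trans (hM l x) _; rewrite ler_wpM2r ?rnorm_ge0//.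
  by apply: le_trans (ler_norm M) _; rewrite lerDl.
have a1 : olt (osucc ozero) alpha.
  by apply/(alpha_gtP alphaE); exists l0; exact: Sz_noncompact.
have a0 : olt ozero alpha by exact: oltW a1.
rewrite alphaE.
have omega_case : ~ (forall e : R, 0 < e ->
    eolt (eosup (fun l => Sz_eps (A l) e)) (Some alpha)) ->
    eoeq (Sz D) (Some (omul alpha oomega)).
  move=> /existsNP[e /not_implyP[e0 /eoleP large]]; split.
    exact: (Sz_diagonal_le_omega hD alphaE M'0 hM' a0).
  exact: (Sz_diagonal_ge_omega hD alphaE a1 e0 large).
split=> //; split=> [[Da aD]|small]; last first.
  split; last exact: (Sz_diagonal_ge hD alphaE).
  exact: (Sz_diagonal_le hD alphaE M'0 hM' a0 L0 small).
(* The two values differ: [alpha omega <= alpha] fails because [0 < alpha] gives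
   [alpha < alpha 2]. *)
apply: contrapT => /omega_case[Do oD].
have ole_alpha : ole (omul alpha oomega) alpha := eole_trans oD Da.
apply: (@olt_irr alpha); apply: olt_le_trans ole_alpha.
apply: olt_le_trans (olt_double a0) _; rewrite -omul_nat.
by apply: (@ole_sup _ (fun n => omul alpha (iter n osucc ozero)) 2); exact: ole_refl.
Qed.
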